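(* Let $Q=(q_{ij})_{i,j\in E}$ be an irreducible regular $Q$-matrix on a countable state space $E$ and let $H$ be a non-empty finite subset of $E$. Suppose the $Q$-process is $\ell$-ergodic for some non-negative integer $\ell$. Then the $Q$-process is not $(\ell+1)$-ergodic if and only if there is a sequence $\{y^{(n)}\}_{n=1}^{\infty}$ of real-valued functions $y^{(n)}=(y^{(n)}_i)_{i\in E}$ on $E$ satisfying the following conditions: (1) for each $n\ge 1$, $\sup_{i\in E} y^{(n)}_i<\infty$ and $y=y^{(n)}$ solves the inequality $$y_i\le \sum_{j\notin H}\Pi_{ij}\,y_j+\frac{\ell+1}{q_i}\,\mathbf{E}_i\sigma_H^{\ell},\qquad i\in E;$$ (2) $\sup_{n\ge 1}\max_{i\in H} y^{(n)}_i=\infty$ (or equivalently, $\varlimsup_{n\to\infty}\max_{i\in H}y^{(n)}_i=\infty$).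
   Context: A $Q$-matrix on a countable set $E$ has $q_{ij}\ge 0$ for $i\ne j$ and $q_i:=-q_{ii}=\sum_{j\ne i}q_{ij}<\infty$. It is regular if the associated continuous-time Markov chain (the $Q$-process) $(X_t)_{t\ge0}$ is unique (non-explosive). The embedding chain is $\Pi=(\Pi_{ij})$, $\Pi_{ij}=q_{ij}/q_i$ for $j\neq i$ and $\Pi_{ii}=0$. With $\eta_1$ the first jump time, $\sigma_H=\inf\{t\ge\eta_1: X_t\in H\}$ for $H\subseteq E$. For an integer $\ell\ge1$ the $Q$-process is $\ell$-ergodic iff $\max_{i\in H}\mathbf{E}_i\sigma_H^{\ell}<\infty$ for some (equivalently, any) non-empty finite $H\subseteq E$. The process is called $0$-ergodic when it is recurrent; $1$-ergodic means ergodic. The functions $y^{(n)}$ are finite-valued but need not be non-negative nor bounded below. *)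

(* Defs.v *)
From HB Require Import structures.
From mathcomp Require Export all_boot all_order all_algebra.
From mathcomp Require Export all_classical all_reals all_analysis.

Set Implicit Arguments.
Unset Strict Implicit.
Unset Printing Implicit Defensive.

Import Order.TTheory GRing.Theory Num.Theory.
Import numFieldNormedType.Exports.

Local Open Scope classical_set_scope.
Local Open Scope ring_scope.
Local Open Scope ereal_scope.

Section Qmatrix.
Context {R : realType} {E : countType}.
Implicit Types (Q : E -> E -> R) (p : R -> E -> E -> R) (i j k : E).

Definition rate Q i : R := (- Q i i)%R.

Definition is_Qmatrix Q : Prop :=
  (forall i j, i != j -> (0 <= Q i j)%R) /\
  (forall i, \esum_(j in [set j | j != i]) (Q i j)%:E = (rate Q i)%:E).

Definition irreducible Q : Prop :=
  forall i j, exists2 s : seq E,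
    path (fun a b => (0 < Q a b)%R) i s & last i s = j.

(* Total division makes [embedding Q i j = 0] when [rate Q i = 0]. *)
Definition embedding Q i j : R := if j == i then 0%R else (Q i j / rate Q i)%R.

(* Only times [t >= 0] are meaningful. Total masses smaller than 1 are allowed;
   the mass is constantly 1 exactly for an honest [p]. *)
Definition transition_function p : Prop :=
  [/\ forall t i j, (0 <= t)%R -> (0 <= p t i j)%R,
      forall t i, (0 <= t)%R -> \esum_(j in [set: E]) (p t i j)%:E <= 1,
      forall i j, p 0%R i j = (i == j)%:R &
      forall s t i j, (0 <= s)%R -> (0 <= t)%R ->
        (p (s + t)%R i j)%:E = \esum_(k in [set: E]) (p s i k * p t k j)%:E].

Definition honest p : Prop :=
  forall t i, (0 <= t)%R -> \esum_(j in [set: E]) (p t i j)%:E = 1.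

(* The derivative at 0 also yields continuity at 0. *)
Definition Qfunction Q p : Prop :=
  transition_function p /\
  forall i j,
    ((p t i j - (i == j)%:R) / t)%R @[t --> (0%R : R)^'+] --> Q i j.

(* The Q-function is unique, even among the sub-Markovian ones, and is honest
   (i.e. the chain is non-explosive). *)
Definition regular Q : Prop :=
  exists p, [/\ Qfunction Q p, honest p &
    forall p', Qfunction Q p' ->
      forall t i j, (0 <= t)%R -> p' t i j = p t i j].

(* A finite sampling scheme is a list of pairs (time increment, state). *)
Fixpoint sample_weight p i (s : seq (R * E)) : R :=
  if s is (u, j) :: s' then (p u i j * sample_weight p j s')%R else 1%R.

Fixpoint sample_event (Omega : Type) (X : R -> Omega -> E) (t : R)
    (s : seq (R * E)) : set Omega :=
  if s is (u, j) :: s'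
  then [set w | X (t + u)%R w = j] `&` sample_event X (t + u)%R s'
  else setT.

(* [P i] is the law of the process started from [i]: taking the increment 0 in
   the last clause gives [X 0 = i] almost surely. *)
Definition is_Qprocess Q (d : measure_display) (Omega : measurableType d)
    (P : E -> probability Omega R) (X : R -> Omega -> E) : Prop :=
  [/\ forall t j, (0 <= t)%R -> measurable [set w | X t w = j],
      forall w t, (0 <= t)%R -> \forall s \near t^'+, X s w = X t w &
      exists2 p, Qfunction Q p &
        forall i (s : seq (R * E)), (forall a, a \in s -> (0 <= a.1)%R) ->
          P i (sample_event X 0%R s) = (sample_weight p i s)%:E].

(* Signed sum, for [f] with a finite positive part; it may be -oo. *)
Definition signed_esum (A : set E) (f : E -> R) : \bar R :=
  \esum_(j in A) (Num.max (f j) 0)%:E - \esum_(j in A) (Num.max (- f j) 0)%:E.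

Section HittingTimes.
Context {d : measure_display} {Omega : measurableType d}.
Implicit Types (P : E -> probability Omega R) (X : R -> Omega -> E).

(* +oo when there is no jump *)
Definition first_jump X (w : Omega) : \bar R :=
  ereal_inf [set t%:E | t in [set t : R | (0 <= t)%R /\ X t w <> X 0%R w]].

(* +oo when there is no such time *)
Definition return_time X (H : set E) (w : Omega) : \bar R :=
  ereal_inf [set t%:E | t in
    [set t : R | [/\ (0 <= t)%R, first_jump X w <= t%:E & H (X t w)]]].

Definition return_moment P X (H : set E) (l : nat) i : \bar R :=
  \int[P i]_w (return_time X H w ^+ l).

Definition recurrent P X : Prop :=
  forall i, P i [set w | return_time X [set i] w < +oo] = 1.

Definition ergodic P X (l : nat) : Prop :=
  if l is 0%N then recurrent P X
  else exists H : set E, [/\ finite_set H, H !=set0 &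
         forall i, H i -> return_moment P X H l i < +oo].

End HittingTimes.

End Qmatrix.

(* Main.v *)
(** For a killing rate lam > 0 replace the return time sigma_H to H by the
    bounded variable s_lam = (1 - exp (- lam sigma_H)) / lam, which increases
    to sigma_H as lam decreases to 0, and the moments by m_k(lam) = E s_lam ^ k.
    Conditioning on the first step of the skeleton chain of mesh h and letting
    h tend to 0 gives
      (1 + k lam / q_i) m_k(lam)_i
        = sum_(j notin H) Pi_ij m_k(lam)_j + (k / q_i) m_{k-1}(lam)_i.
    Hence y^(n) = m_{l+1}(lam_n), with lam_n tending to 0, is a bounded
    subsolution of the inequality, and it converges to E sigma_H ^ (l+1), which
    is infinite somewhere on H if the process is not (l+1)-ergodic.

    Conversely, let the (l+1)-st return moment to some finite set be finite. On
    the enlarged set K, the union of that set and H, a combination of the return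
    moments to K is a finite supersolution m. A comparison principle gives
    y <= m + max_K y for every subsolution y bounded above: the positive part of
    the difference is bounded and subharmonic off K, so on an exhaustion of E by
    finite sets it is dominated by the Laplace transform of the exit time, which
    vanishes in the limit as there is no explosion, plus a multiple of
    lam m_1(lam), which vanishes with lam as sigma_K has a finite mean. Following
    a path of positive probability from the maximum over K to H then bounds
    max_K y, uniformly in y, so that y is bounded on H uniformly in n. The passage
    from K back to the inhomogeneity E sigma_H ^ l is an induction on the order
    of the moments, in which the m_k(lam) are themselves the subsolutions.

    Non-explosion of the given process is read off from uniqueness: the
    probabilities of being in j at time t having visited only finitely many
    states form a Q-function, so they agree with p and have total mass 1. *)

From mathcomp Require Import ring lra measurable_realfun.
Require Import Defs.

Import Order.TTheory GRing.Theory Num.Theory.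
Import numFieldNormedType.Exports.
Local Open Scope classical_set_scope.
Local Open Scope ring_scope.
Local Open Scope ereal_scope.

Set Implicit Arguments.
Unset Strict Implicit.
Unset Printing Implicit Defensive.

(** * Sums and expectations *)

Section RealLimits.
Context {R : realType}.
Implicit Types (u : nat -> R).

Lemma limr_ge_cvg u (l c : R) : u @ \oo --> l -> (forall n, c <= u n)%R -> (c <= l)%R.
Proof.
move=> ul cu; rewrite -(cvg_lim _ ul)//; apply: limr_ge; first exact: cvgP ul.
exact: nearW.
Qed.

Lemma limr_le_cvg u (l c : R) : u @ \oo --> l -> (forall n, u n <= c)%R -> (l <= c)%R.
Proof.
move=> ul cu; rewrite -(cvg_lim _ ul)//; apply: limr_le; first exact: cvgP ul.
exact: nearW.
Qed.

End RealLimits.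

(** * Unordered sums: scaling, splitting and passage to the limit *)

Section Esum.
Context {R : realType} {T : choiceType}.
Implicit Types (S : set T) (a b : T -> \bar R).

Lemma esumZl S a (r : R) : (0 <= r)%R -> (forall i, 0 <= a i) ->
  \esum_(i in S) (r%:E * a i) = r%:E * \esum_(i in S) a i.
Proof.
move=> r0 a0; rewrite /esum -ereal_supZl//.
  congr ereal_sup; apply/seteqP; split => [_ [F FS <-]|_ [_ [F FS <-] <-]].
    by exists (\sum_(i \in F) a i); [exists F|rewrite ge0_mule_fsumr].
  by exists F => //; rewrite ge0_mule_fsumr.
by apply/set0P; exists (\sum_(i \in set0) a i); exists set0 => //; exact: fsets_set0.
Qed.

Lemma esumZr S a (r : R) : (0 <= r)%R -> (forall i, 0 <= a i) ->
  \esum_(i in S) (a i * r%:E) = (\esum_(i in S) a i) * r%:E.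
Proof.
move=> r0 a0; rewrite muleC -esumZl//; apply: eq_esum => i _; exact: muleC.
Qed.

Lemma esum_setD1 S a k : S k -> (forall i, 0 <= a i) ->
  \esum_(i in S) a i = a k + \esum_(i in S `\ k) a i.
Proof.
move=> Sk a0; rewrite (esumID [set k])//; congr (_ + _).
by rewrite (_ : S `&` [set k] = [set k]) ?esum_set1//; apply/setIidPr => _ ->.
Qed.

Lemma esum_setU1 S a k : ~ S k -> (forall i, 0 <= a i) ->
  \esum_(i in S `|` [set k]) a i = a k + \esum_(i in S) a i.
Proof.
move=> Sk a0; rewrite (esum_setD1 (k := k))//; last by right.
by rewrite setDUl setDv setU0 setDidl//; apply/seteqP; split=> [x [] + xk|//]; rewrite xk.
Qed.

Lemma le_esum_subset S S' a : S `<=` S' ->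
  \esum_(i in S) a i <= \esum_(i in S') a i.
Proof.
move=> SS'; apply: le_ereal_sup => _ [F [finF FS] <-].
by exists F => //; split => //; exact: subset_trans SS'.
Qed.

Lemma esum_lb S a k : S k -> (forall i, 0 <= a i) -> a k <= \esum_(i in S) a i.
Proof. by move=> Sk a0; rewrite (esum_setD1 Sk)// leeDl// esum_ge0. Qed.

(** Fatou's lemma for unordered sums: a finite partial sum of the limits already exceeds [x], and
    finite sums pass to the limit. The form with an eventual strict bound avoids lower limits. *)
Lemma esum_fatou S (a : nat -> T -> \bar R) (b : T -> \bar R) (x : R) :
  (forall n i, 0 <= a n i) -> (forall i, a ^~ i @ \oo --> b i) ->
  x%:E < \esum_(i in S) b i -> \forall n \near \oo, x%:E < \esum_(i in S) a n i.
Proof.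
move=> a0 ab /ereal_sup_gt[_ [F FS <-]] xF.
have finF : finite_set F by case: FS.
have cvF : \sum_(i \in F) a n i @[n --> \oo] --> \sum_(i \in F) b i.
  rewrite fsbig_finite//; under eq_fun do rewrite fsbig_finite//.
  by apply: cvg_nnesum => [i _|i _]; [exact: nearW|exact: ab].
have : \forall n \near \oo, x%:E < \sum_(i \in F) a n i.
  exact: (cvF _ (open_ereal_gt' xF)).
apply: filterS => n /lt_le_trans; apply.
by apply: esum_ge; exists F.
Qed.

(** A Scheffé-type theorem: convergence of the total masses [A n] to the mass of the limit prevents
    mass from escaping. Fatou's lemma for the products [a * b] bounds the limit from one side, and
    for [a * (C - b)] from the other. *)
Lemma esum_scheffe S (a b : nat -> T -> R) (a' b' : T -> R) (C : R)
    (A s : nat -> R) (A' s' : R) :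
  (forall n i, 0 <= a n i)%R -> (forall n i, 0 <= b n i <= C)%R ->
  (forall i, a ^~ i @ \oo --> a' i) -> (forall i, b ^~ i @ \oo --> b' i) ->
  A @ \oo --> A' ->
  (forall n, \esum_(i in S) (a n i)%:E = (A n)%:E) ->
  \esum_(i in S) (a' i)%:E = A'%:E ->
  (forall n, \esum_(i in S) (a n i * b n i)%:E = (s n)%:E) ->
  \esum_(i in S) (a' i * b' i)%:E = s'%:E ->
  s @ \oo --> s'.
Proof.
move=> a0 b0 ca cb cA hA hA' hs hs'.
have a'0 i : (0 <= a' i)%R.
  by apply: (limr_ge_cvg (ca i)) => n; exact: a0.
have b'0 i : (0 <= b' i <= C)%R.
  apply/andP; split; [apply: (limr_ge_cvg (cb i))|apply: (limr_le_cvg (cb i))];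
    by move=> n; case/andP: (b0 n i).
have compl (f g : T -> R) F G : (forall i, 0 <= f i)%R ->
    (forall i, 0 <= g i <= C)%R ->
    \esum_(i in S) (f i)%:E = F%:E -> \esum_(i in S) (f i * g i)%:E = G%:E ->
    \esum_(i in S) (f i * (C - g i))%:E = (F * C - G)%:E.
  move=> f0 g0 hF hG.
  have C0 (i : T) : (0 <= C)%R by case/andP: (g0 i); exact: le_trans.
  have [[i0 _]|S0] := pselect (exists i, S i); last first.
    have {}S0 : S = set0 by rewrite -subset0 => x Sx; apply: S0; exists x.
    move: hF hG; rewrite S0 !esum_set0 => -[<-] [<-].
    by rewrite mul0r subr0.
  have : \esum_(i in S) (f i * g i)%:E + \esum_(i in S) (f i * (C - g i))%:E =
         (F * C)%:E.
    rewrite -esumD; last 2 first.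
    - by move=> i _; rewrite lee_fin mulr_ge0//; case/andP: (g0 i).
    - by move=> i _; rewrite lee_fin mulr_ge0// subr_ge0; case/andP: (g0 i).
    rewrite EFinM -hF -esumZr//; last exact: C0 i0.
    by apply: eq_esum => i _; rewrite -EFinD -EFinM -mulrDr addrC subrK.
  rewrite hG => h; have := congr1 (fun x => x - G%:E) h.
  by rewrite addeAC subee// add0e => ->.
apply/cvgrPdist_lt => e e0.
have e20 : (0 < e / 2)%R by rewrite divr_gt0.
have lo : \forall n \near \oo, (s' - e < s n)%R.
  have : \forall n \near \oo, (s' - e)%:E < \esum_(i in S) (a n i * b n i)%:E.
    apply: (@esum_fatou S _ (fun i => (a' i * b' i)%:E)).
    - by move=> n i; rewrite lee_fin mulr_ge0//; case/andP: (b0 n i).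
    - by move=> i; apply: cvg_EFin; [exact: nearW|exact: cvgM].
    - by rewrite hs' lte_fin ltrBlDr ltrDl.
  by apply: filterS => n; rewrite hs lte_fin.
(* The upper bound on [s n] is Fatou's lower bound for the complementary sum [A n * C - s n];
   convergence of [A n] then removes the first term. *)
have hi : \forall n \near \oo, (A' * C - s' - e / 2 < A n * C - s n)%R.
  have : \forall n \near \oo,
      (A' * C - s' - e / 2)%:E < \esum_(i in S) (a n i * (C - b n i))%:E.
    apply: (@esum_fatou S _ (fun i => (a' i * (C - b' i))%:E)).
    - by move=> n i; rewrite lee_fin mulr_ge0// subr_ge0; case/andP: (b0 n i).
    - move=> i; apply: cvg_EFin; [exact: nearW|apply: cvgM => //].
      by apply: cvgB => //; exact: cvg_cst.
    - by rewrite (compl _ _ _ _ a'0 b'0 hA' hs') lte_fin ltrBlDr ltrDl.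
  by apply: filterS => n; rewrite (compl _ _ _ _ (a0 n) (b0 n) (hA n) (hs n)) lte_fin.
have hAC : (A n * C)%R @[n --> \oo] --> (A' * C)%R by apply: cvgM => //; exact: cvg_cst.
have /cvgrPdist_lt/(_ _ e20) hA'' := hAC.
near=> n.
have h1 : (s' - e < s n)%R by near: n.
have h2 : (A' * C - s' - e / 2 < A n * C - s n)%R by near: n.
have h3 : (`|A' * C - A n * C| < e / 2)%R by near: n.
move: h3; rewrite !ltr_norml => /andP[h3 h4].
by apply/andP; split; lra.
Unshelve. all: by end_near.
Qed.

End Esum.

(** * Unions and additivity indexed by a countable type *)

Section CountableAdditivity.
Context {R : realType} {E : countType} {d : measure_display}
  {Omega : measurableType d} (mu : {measure set Omega -> \bar R}).

Lemma countable_bigcup_measurable (S : set E) (B : E -> set Omega) :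
  (forall j, measurable (B j)) -> measurable (\bigcup_(j in S) B j).
Proof.
move=> mB; rewrite (_ : \bigcup_(j in S) B j =
    \bigcup_n (if @pickle_inv E n is Some j then if j \in S then B j else set0 else set0)).
  apply: bigcup_measurable => n _; case: (@pickle_inv E n) => [j|//]; case: ifP => //.
apply/seteqP; split=> [w [j Sj Bj]|w [n _]].
  by exists (pickle j) => //; rewrite pickleK_inv mem_set.
by case: (@pickle_inv E n) => [j|//]; case: ifPn => // /set_mem Sj; exists j.
Qed.

Lemma measure_countable_bigcup (S : set E) (B : E -> set Omega) :
  (forall j, measurable (B j)) -> trivIset S B ->
  mu (\bigcup_(j in S) B j) = \esum_(j in S) mu (B j).
Proof.
move=> mB tB.
pose G n := if @pickle_inv E n is Some j then B j else set0.
have GB j : G (pickle j) = B j by rewrite /G pickleK_inv.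
have mG n : measurable (G n) by rewrite /G; case: (@pickle_inv E n).
have pinj : set_inj S (@pickle E) by move=> x y _ _; exact: (pcan_inj pickleK).
transitivity (mu (\bigcup_(n in pickle @` S) G n)).
  congr (mu _); apply/seteqP; split=> [w [j Sj Bj]|w [_ [j Sj <-]]].
    by exists (pickle j); [exists j|rewrite GB].
  by rewrite GB => Bj; exists j.
rewrite measure_bigcup//.
  rewrite nneseries_esum// (_ : [set x | _] = pickle @` S); last first.
    by apply/seteqP; split=> x /=; rewrite inE.
  by rewrite (esum_image S pickle)//; apply: eq_esum => j _; rewrite GB.
by move=> _ _ [j Sj <-] [k Sk <-]; rewrite !GB => /(tB _ _ Sj Sk) ->.
Qed.

End CountableAdditivity.

(** [B] is the lower limit of the sets [B_ n], a countable union of countable intersections. *)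
Lemma eventually_cst_measurable {d : measure_display} {Omega : measurableType d}
    (B_ : nat -> set Omega) (B : set Omega) :
  (forall n, measurable (B_ n)) ->
  (forall w, \forall n \near \oo, B_ n w <-> B w) -> measurable B.
Proof.
move=> mB hB.
rewrite (_ : B = \bigcup_N \bigcap_(n in [set n | (N <= n)%N]) B_ n).
  apply: bigcupT_measurable => N; apply: bigcap_measurable => //.
  by exists N => /=.
apply/seteqP; split=> [w Bw|w [N _ hN] /=].
  by have [N _ hN] := hB w; exists N => // n Nn; apply/(hN n Nn).
have [M _ hM] := hB w; apply/(hM (maxn N M)) => /=; first exact: leq_maxr.
by apply: hN => /=; exact: leq_maxl.
Qed.

(** * Expectations of bounded random variables *)

Section BoundedExpectation.
Context {R : realType} {d : measure_display} {Omega : measurableType d}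
  (mu : probability Omega R).

Lemma bounded_integrable (g : Omega -> R) (C : R) :
  measurable_fun setT g -> (forall w, `|g w| <= C)%R ->
  mu.-integrable setT (EFin \o g).
Proof.
move=> mg gC; apply: measurable_bounded_integrable => //.
  by rewrite (@le_lt_trans _ _ 1)// ?probability_le1// ltry.
by exists C; split => [|x Cx w _]; [exact: num_real|exact: le_trans (gC w) (ltW Cx)].
Qed.

Lemma Rintegral_prob_cst (r : R) : (\int[mu]_(_ in setT) r = r)%R.
Proof.
rewrite Rintegral_cst//.
exact: etrans (congr1 (fun x => r * fine x)%R (probability_setT mu)) (mulr1 r).
Qed.

Lemma Rintegral_itv (g : Omega -> R) (a b : R) :
  measurable_fun setT g -> (forall w, a <= g w <= b)%R ->
  (a <= \int[mu]_w g w <= b)%R.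
Proof.
move=> mg gab.
have icst (r : R) : mu.-integrable setT (EFin \o fun=> r).
  by apply: (@bounded_integrable _ `|r|%R).
have ig : mu.-integrable setT (EFin \o g).
  apply: (@bounded_integrable _ (`|a| + `|b|)%R) => // w.
  have /andP[ga gb] := gab w; rewrite ler_norml; apply/andP; split.
    rewrite lerNl (le_trans (_ : _ <= - a)%R) ?lerN2//.
    by rewrite (le_trans (ler_norm _))// normrN lerDl.
  by rewrite (le_trans gb)// (le_trans (ler_norm _))// lerDr.
rewrite -{1}(Rintegral_prob_cst a) -(Rintegral_prob_cst b).
by apply/andP; split; apply: le_Rintegral => // w _; case/andP: (gab w).
Qed.

Lemma bounded_convergence (g_ : nat -> Omega -> R) (g : Omega -> R) (C : R) :
  (forall n, measurable_fun setT (g_ n)) -> (forall n w, `|g_ n w| <= C)%R ->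
  (forall w, g_ ^~ w @ \oo --> g w) ->
  measurable_fun setT g /\
  (\int[mu]_w g_ n w)%R @[n --> \oo] --> (\int[mu]_w g w)%R.
Proof.
move=> mg gC cg.
have mg' : measurable_fun setT g.
  by apply: (measurable_fun_cvg mg) => w _; exact: cg.
split => //.
have [] := @dominated_convergence _ _ _ mu setT measurableT
  (fun n w => (g_ n w)%:E) (fun w => (g w)%:E) (fun=> C%:E).
- by move=> n; apply/measurable_EFinP.
- exact/measurable_EFinP.
- by apply: aeW => w _; apply: cvg_EFin; [exact: nearW|exact: cg].
- by apply: (@bounded_integrable _ `|C|%R) => // w; rewrite lexx.
- by apply: aeW => w n _; rewrite abse_EFin lee_fin.
move=> ig _ h.
apply: fine_cvg; rewrite fineK//.
exact: integrable_fin_num ig.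
Qed.

Lemma Rintegral_sum_indic (B : nat -> set Omega) (c : nat -> R) m :
  (forall n, measurable (B n)) ->
  (\int[mu]_w (\sum_(0 <= n < m) c n * \1_(B n) w) =
   \sum_(0 <= n < m) c n * fine (mu (B n)))%R.
Proof.
move=> mB.
have bi k : mu.-integrable setT (EFin \o (fun w => \1_(B k) w : R)).
  apply: (@bounded_integrable _ 1); first by apply: measurable_indic; exact: mB.
  by move=> w; rewrite indicE; case: (_ \in _); rewrite ?normr1 ?normr0.
elim: m => [|m IH].
  by under eq_Rintegral do rewrite big_nil; rewrite big_nil Rintegral_cst// mul0r.
under eq_Rintegral do rewrite big_nat_recr//=.
rewrite RintegralD//.
- rewrite IH big_nat_recr//= RintegralZl//; congr (_ + _ * _)%R.
  by rewrite /Rintegral integral_indic// setIT.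
- rewrite (_ : EFin \o _ = fun w => \sum_(0 <= n < m) (c n)%:E * (\1_(B n) w)%:E).
    by apply: integrable_sum => // n _; apply: integrableZl => //; exact: bi.
  by apply/funext => w /=; rewrite -sumEFin.
- rewrite (_ : EFin \o _ = fun w => (c m)%:E * (\1_(B m) w)%:E)//.
  by apply: integrableZl => //; exact: bi.
Qed.

(** The indicators converge pointwise, so bounded convergence applies. Probabilities of
    continuous-time events are obtained in this way from those of their discretisations. *)
Lemma eventually_cst_cvg (B_ : nat -> set Omega) (B : set Omega) :
  (forall n, measurable (B_ n)) ->
  (forall w, \forall n \near \oo, B_ n w <-> B w) ->
  mu (B_ n) @[n --> \oo] --> mu B.
Proof.
move=> mB hB; have mB' := eventually_cst_measurable mB hB.
have cv w : (\1_(B_ n) w : R) @[n --> \oo] --> (\1_B w : R).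
  apply: cvg_near_cst; move: (hB w); apply: filterS => n h.
  by rewrite !indicE (_ : (w \in B_ n) = (w \in B))//; apply/idP/idP; rewrite !inE h.
have i1 n w : (`|\1_(B_ n) w : R| <= 1)%R.
  by rewrite indicE; case: (_ \in _); rewrite ?normr1 ?normr0.
have [_ ci] := @bounded_convergence (fun n => \1_(B_ n)) (\1_B) 1
  (fun n => measurable_indic (mB n)) i1 cv.
have := ci; under eq_fun do rewrite /Rintegral integral_indic// setIT.
rewrite /Rintegral integral_indic// setIT => h.
have fin D : measurable D -> mu D \is a fin_num by move=> mD; exact: fin_num_measure.
rewrite -(fineK (fin _ mB')); apply: cvg_EFin => //.
by apply: nearW => n; exact: fin.
Qed.

End BoundedExpectation.

(** * Skeleton chains *)

Section PathEvents.
Context {R : realType} {E : countType}.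
Implicit Types (p : R -> E -> E -> R) (i j k : E) (t u v : R).

(* A step [(u, A)] constrains the move of the skeleton over a time [u]: from
   [i] only the states in [A i] are allowed. *)
Fixpoint path_event (Omega : Type) (X : R -> Omega -> E) (t : R)
    (r : seq (R * (E -> set E))) : set Omega :=
  if r is (u, A) :: r'
  then [set w | A (X t w) (X (t + u)%R w)] `&` path_event X (t + u)%R r'
  else setT.

(** Iterated substochastic kernels, each being [p u] restricted to the allowed moves, applied to the
    constant 1. *)
Fixpoint path_weight (p : R -> E -> E -> R) (i : E)
    (r : seq (R * (E -> set E))) : \bar R :=
  if r is (u, A) :: r'
  then \esum_(j in A i) ((p u i j)%:E * path_weight p j r') else 1.

Definition end_time (t : R) (U : Type) (s : seq (R * U)) : R :=
  foldl (fun t a => (t + a.1)%R) t s.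

Lemma end_time_rcons t (U : Type) (s : seq (R * U)) a :
  end_time t (rcons s a) = (end_time t s + a.1)%R.
Proof. by rewrite /end_time foldl_rcons. Qed.

Lemma end_time_ge0 t (U : eqType) (s : seq (R * U)) : (0 <= t)%R ->
  (forall a, a \in s -> (0 <= a.1)%R) -> (0 <= end_time t s)%R.
Proof.
elim: s t => [|a s IH] t t0 h //=; apply: IH.
  by rewrite addr_ge0// h// mem_head.
by move=> b bs; apply: h; rewrite in_cons bs orbT.
Qed.

Lemma sample_event_rcons Omega (X : R -> Omega -> E) t s u k :
  sample_event X t (rcons s (u, k)) =
  sample_event X t s `&` [set w | X (end_time t s + u)%R w = k].
Proof.
elim: s t => [|[v j] s IH] t /=; first by rewrite setTI setIT.
by rewrite IH setIA.
Qed.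

Lemma sample_weight_rcons p i s u k v j :
  (sample_weight p i (rcons (rcons s (u, k)) (v, j)) =
   sample_weight p i (rcons s (u, k)) * p v k j)%R.
Proof.
elim: s i => [|[w l] s IH] i /=; first by rewrite !mulr1.
by rewrite IH mulrA.
Qed.

Lemma path_event_cat Omega (X : R -> Omega -> E) t r r' :
  path_event X t (r ++ r') = path_event X t r `&` path_event X (end_time t r) r'.
Proof.
elim: r t => [|[u S] r IH] t /=; first by rewrite setTI.
by rewrite IH setIA.
Qed.

Lemma path_weight_ge0 p i r : (forall a, a \in map fst r -> (0 <= a)%R) ->
  (forall t j k, (0 <= t)%R -> (0 <= p t j k)%R) -> 0 <= path_weight p i r.
Proof.
move=> + p0; elim: r i => [|[u S] r IH] i h //=.
apply: esum_ge0 => j _; apply: mule_ge0.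
  by rewrite lee_fin p0// h// mem_head.
by apply: IH => a ar; apply: h; rewrite in_cons ar orbT.
Qed.

Lemma measurable_path_event (d : measure_display) (Omega : measurableType d)
    (X : R -> Omega -> E) t r :
  (forall t j, (0 <= t)%R -> measurable [set w | X t w = j]) ->
  (forall a, a \in map fst r -> (0 <= a)%R) -> (0 <= t)%R ->
  measurable (path_event X t r).
Proof.
move=> mX; elim: r t => [|[u S] r IH] t h t0 //=.
have u0 : (0 <= u)%R by apply: h; rewrite mem_head.
apply: measurableI; last first.
  by apply: IH; [move=> a ar; apply: h; rewrite in_cons ar orbT|exact: addr_ge0].
rewrite (_ : [set w | _] = \bigcup_(i in setT) \bigcup_(j in S i)
    ([set w | X t w = i] `&` [set w | X (t + u)%R w = j])); last first.
  apply/seteqP; split=> w /=.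
    by move=> h'; exists (X t w) => //; exists (X (t + u)%R w).
  by move=> [i _ [j Sj [-> ->]]].
apply: countable_bigcup_measurable => i; apply: countable_bigcup_measurable => j.
by apply: measurableI; apply: mX; rewrite // addr_ge0.
Qed.

Lemma path_event_nseq Omega (X : R -> Omega -> E) t n h S w :
  path_event X t (nseq n (h, S)) w <->
  forall k : nat, (k < n)%N -> S (X (t + k%:R * h)%R w) (X (t + k.+1%:R * h)%R w).
Proof.
elim: n t => [|n IH] t /=; first by split.
have e m : (t + h + m%:R * h = t + m.+1%:R * h)%R.
  by rewrite -addrA -nat1r mulrDl mul1r.
split=> [[h0 /IH hn] [|k]|hn].
- by rewrite mul0r addr0 mul1r.
- by rewrite ltnS => /hn; rewrite !e.
- split; first by have := hn 0%N isT; rewrite mul0r addr0 mul1r.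
  by apply/IH => k kn; rewrite !e; exact: hn.
Qed.

End PathEvents.

(** * The Markov property of skeletons, from the finite-dimensional laws *)

Section SkeletonMarkov.
Context {R : realType} {E : countType} {d : measure_display}
  {Omega : measurableType d} {P : E -> probability Omega R}
  {X : R -> Omega -> E} {p : R -> E -> E -> R}.
Context (mX : forall t j, (0 <= t)%R -> measurable [set w | X t w = j])
  (p_ge0 : forall t i j, (0 <= t)%R -> (0 <= p t i j)%R)
  (p_0 : forall i, p 0%R i i = 1%R)
  (fdd : forall i (s : seq (R * E)), (forall a, a \in s -> (0 <= a.1)%R) ->
    P i (sample_event X 0%R s) = (sample_weight p i s)%:E).

(** The finite-dimensional laws only treat prescribed states. The induction on [r] therefore splits
    the event over the state reached by the next step and appends that state to the prescribed
    prefix; the prefix ends in [(u, k)] so that the current state is known to be [k]. *)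
Let markov_prefix i s u k (r : seq (R * (E -> set E))) :
  (forall a, a \in rcons s (u, k) -> (0 <= a.1)%R) ->
  (forall a, a \in map fst r -> (0 <= a)%R) ->
  P i (sample_event X 0%R (rcons s (u, k)) `&`
       path_event X (end_time 0%R (rcons s (u, k))) r) =
  (sample_weight p i (rcons s (u, k)))%:E * path_weight p k r.
Proof.
elim: r s u k => [|[v S] r IH] s u k s0 r0 /=.
  by rewrite setIT fdd// mule1.
have v0 : (0 <= v)%R by apply: r0; rewrite mem_head.
have r0' a : a \in map fst r -> (0 <= a)%R.
  by move=> ar; apply: r0; rewrite in_cons ar orbT.
have s0' j a : a \in rcons (rcons s (u, k)) (v, j) -> (0 <= a.1)%R.
  by rewrite mem_rcons in_cons => /orP[/eqP->//|/s0].
pose B j := sample_event X 0%R (rcons (rcons s (u, k)) (v, j)) `&`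
  path_event X (end_time 0%R (rcons (rcons s (u, k)) (v, j))) r.
have mS q t : (0 <= t)%R -> (forall a, a \in q -> (0 <= a.1)%R) ->
    measurable (sample_event X t q).
  elim: q t => [|[x y] q IHq] t t0 h //=.
  have x0 : (0 <= x)%R by apply: (h (x, y)); rewrite mem_head.
  apply: measurableI; first by apply: mX; exact: addr_ge0.
  by apply: IHq; [exact: addr_ge0|move=> a aq; apply: h; rewrite in_cons aq orbT].
have mB j : measurable (B j).
  apply: measurableI; first by apply: mS => //; exact: s0'.
  by apply: measurable_path_event => //; apply: end_time_ge0 => //; exact: s0'.
transitivity (P i (\bigcup_(j in S k) B j)).
  congr (P i _); apply/seteqP; split=> w.
    rewrite sample_event_rcons => -[[sw xk] [Sw rw]].
    exists (X (end_time 0%R (rcons s (u, k)) + v)%R w).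
      by move: Sw; rewrite /= end_time_rcons /= xk.
    by rewrite /B sample_event_rcons (end_time_rcons _ _ (v, _)) /= sample_event_rcons.
  move=> [j Sj [hs hp]]; rewrite sample_event_rcons in hs.
  rewrite (end_time_rcons _ _ (v, _)) in hp; case: hs => h1 h2.
  split => //; split => //=; rewrite h2; move: h1.
  by rewrite sample_event_rcons end_time_rcons => -[_ /= ->].
rewrite measure_countable_bigcup//; last first.
  move=> j1 j2 _ _ [w [[]]].
  by rewrite /B !sample_event_rcons => -[_ /= <-] _ [[_ /= <-]].
transitivity (\esum_(j in S k) ((sample_weight p i (rcons s (u, k)))%:E *
    ((p v k j)%:E * path_weight p j r))).
  apply: eq_esum => j _; apply: etrans; first exact: (IH _ _ _ (s0' j) r0').
  by rewrite sample_weight_rcons EFinM muleA.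
rewrite esumZl//; last first.
  by move=> j; apply: mule_ge0; [rewrite lee_fin p_ge0|exact: path_weight_ge0].
(* The weight of the prefix is non-negative because it is a probability. *)
by rewrite -lee_fin -fdd.
Qed.

Lemma initial_state i : P i [set w | X 0%R w = i] = 1.
Proof.
have := @fdd i [:: (0%R, i)]; rewrite /= setIT mulr1 addr0 p_0 => -> // a.
by rewrite inE => /eqP->.
Qed.

(** The preceding formula is applied to the single observation of [i] at time 0; paths that start
    elsewhere form a null set for [P i]. *)
Lemma path_event_weight i r : (forall a, a \in map fst r -> (0 <= a)%R) ->
  P i (path_event X 0%R r) = path_weight p i r.
Proof.
move=> r0; have := @markov_prefix i [::] 0%R i r.
rewrite /= setIT mulr1 p_0 mul1e => <-//; last by move=> a; rewrite inE => /eqP->.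
rewrite /end_time/= addr0.
have mr : measurable (path_event X 0%R r) by exact: measurable_path_event.
have mi : measurable [set w | X 0%R w = i] by exact: mX.
apply: etrans; first exact: (measureDI (P i) mr mi).
have e0 : P i (path_event X 0%R r `\` [set w | X 0%R w = i]) = 0; last first.
  by apply: etrans; first exact: (congr1 (+%E^~ _) e0); rewrite /= add0e setIC.
apply/eqP; rewrite eq_le measure_ge0 andbT.
have <- : P i (~` [set w | X 0%R w = i]) = 0.
  by rewrite probability_setC// initial_state subee.
apply: le_measure; rewrite ?inE; [exact: measurableD|exact: measurableC|].
by move=> w [].
Qed.

End SkeletonMarkov.

Section PathWeights.
Context {R : realType} {E : countType} {p : R -> E -> E -> R}
  (p_ge0 : forall t i j, (0 <= t)%R -> (0 <= p t i j)%R).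

(** Once the state is forced to be [k], the remaining weight no longer depends on the earlier path
    and leaves all the sums. Its finiteness lets it be handled as a real factor. *)
Lemma path_weight_through i r u k r' :
  (0 <= u)%R -> (forall a, a \in map fst r -> (0 <= a)%R) ->
  (forall a, a \in map fst r' -> (0 <= a)%R) ->
  path_weight p k r' \is a fin_num ->
  path_weight p i (rcons r (u, fun=> [set k]) ++ r') =
  path_weight p i (rcons r (u, fun=> [set k])) * path_weight p k r'.
Proof.
move=> u0 + r'0 fk; have w0 := path_weight_ge0 k r'0 p_ge0.
elim: r i => [|[v S] r IH] i r0 /=.
  by rewrite !esum_set1 ?mule1// ?lee_fin ?p_ge0// mule_ge0// lee_fin p_ge0.
have v0 : (0 <= v)%R by apply: r0; rewrite mem_head.
have r0' a : a \in map fst r -> (0 <= a)%R.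
  by move=> ar; apply: r0; rewrite in_cons ar orbT.
rewrite -(fineK fk) -esumZr; last 2 first.
- by rewrite fine_ge0.
- move=> j; rewrite mule_ge0 ?lee_fin ?p_ge0// path_weight_ge0// => a.
  by rewrite map_rcons mem_rcons in_cons => /orP[/eqP->//|/r0'].
by apply: eq_esum => j _; rewrite IH// fineK// muleA.
Qed.

End PathWeights.

(** The moves of a skeleton that has not yet returned to [H]. The alternative [j = i] is what lets a
    chain started inside [H] wait there for its first jump. *)
Definition allowed (E : Type) (H : set E) (i : E) : set E := [set j | j = i \/ ~ H j].

Lemma grid_point {R : realType} (s h : R) : (0 <= s)%R -> (0 < h)%R ->
  exists n : nat, (s <= n%:R * h < s + h)%R.
Proof.
move=> s0 h0.
have ex : exists n : nat, (s <= n%:R * h)%R.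
  have /andP[_ hn] := truncn_itv (divr_ge0 s0 (ltW h0)).
  by exists (Num.trunc (s / h)).+1; rewrite -ler_pdivrMr// ltW.
case: (ex_minnP ex) => n hn minn; exists n; rewrite hn /=.
case: n hn minn => [|n] hn minn; first by rewrite mul0r ltr_wpDl.
rewrite ltNge; apply/negP => hn'.
have hn'' : (s <= n%:R * h)%R by move: hn'; rewrite -natr1 mulrDl mul1r lerD2r.
by have := minn n hn''; rewrite ltnn.
Qed.

(** * Return times read off from a fine mesh *)

Section ReturnTime.
Context {R : realType} {E : countType} {d : measure_display}
  {Omega : measurableType d} {X : R -> Omega -> E}.
Context (rcX : forall w (t : R), (0 <= t)%R -> \forall s \near t^'+, X s w = X t w).
Implicit Types (H : set E) (w : Omega) (t h : R).

Lemma right_constant w t : (0 <= t)%R ->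
  exists2 e : R, (0 < e)%R & forall s, (t <= s < t + e)%R -> X s w = X t w.
Proof.
move=> t0; have [e /= e0 he] := rcX w t0.
exists e => // s /andP[]; rewrite le_eqVlt => /predU1P[->//|ts se].
by apply: he => //=; rewrite distrC gtr0_norm ?subr_gt0// ltrBlDl.
Qed.

Lemma first_jump_ge0 w : 0 <= first_jump X w.
Proof. by apply: le_ereal_inf_tmp => _ [t [t0 _] <-]; rewrite lee_fin. Qed.

Lemma return_time_ge0 H w : 0 <= return_time X H w.
Proof. by apply: le_ereal_inf_tmp => _ [t [t0 _ _] <-]; rewrite lee_fin. Qed.

Lemma return_time_subset H H' w : H `<=` H' -> return_time X H' w <= return_time X H w.
Proof.
move=> HH'; apply: ereal_inf_le_tmp => _ [t [t0 jt Ht] <-].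
by exists t => //; split => //; exact: HH'.
Qed.

(** A path keeps its value for a while after the infimum [s], and [D] has points arbitrarily close
    to [s] from the right, so the state at [s] is the state at some time in [D]. *)
Let inf_attained w (D : set R) (s : R) : (forall t, D t -> 0 <= t)%R ->
  ereal_inf (EFin @` D) = s%:E -> (0 <= s)%R /\ exists2 t, D t & X t w = X s w.
Proof.
move=> D0 Ds.
have s0 : (0 <= s)%R.
  by rewrite -lee_fin -Ds; apply: le_ereal_inf_tmp => _ [t /D0 t0 <-]; rewrite lee_fin.
split => //; have [e e0 he] := right_constant w s0.
have : ereal_inf (EFin @` D) < (s + e)%:E by rewrite Ds lte_fin ltrDl.
move=> /ereal_inf_lt[_ [t Dt <-]]; rewrite lte_fin => te; exists t => //.
by apply: he; rewrite te andbT -lee_fin -Ds; apply: ereal_inf_lbound; exists t.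
Qed.

Lemma first_jump_attained w e : first_jump X w = e%:E ->
  (0 <= e)%R /\ X e w <> X 0%R w.
Proof.
move=> je; have [|e0 [t [t0 jt] <-]] := inf_attained w _ je; first by move=> t [].
by [].
Qed.

Lemma return_time_attained H w s : return_time X H w = s%:E ->
  [/\ (0 <= s)%R, first_jump X w <= s%:E & H (X s w)].
Proof.
move=> rs; have [|s0 [t [t0 jt Ht] <-]] := inf_attained w _ rs; first by move=> t [].
split => //; rewrite -rs.
by apply: le_ereal_inf_tmp => _ [u [_ ju _] <-].
Qed.

(** A forbidden step ends in [H] at a state different from the one it started from. A jump has then
    taken place, so the return time is at most the end of that step. *)
Lemma return_time_gt_path H w h n : (0 <= h)%R ->
  (n%:R * h)%:E < return_time X H w -> path_event X 0%R (nseq n (h, allowed H)) w.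
Proof.
move=> h0 nh; apply/path_event_nseq => k kn; rewrite !add0r.
apply: contrapT => /not_orP[neq /contrapT HX].
have kh m : (0 <= m%:R * h)%R by rewrite mulr_ge0.
move: nh; rewrite ltNge => /negP; apply; apply: (@le_trans _ _ (k.+1%:R * h)%:E).
  apply: ereal_inf_lbound; exists (k.+1%:R * h)%R => //; split => //.
  (* If the state before the step is still the initial one, the jump occurs by the end of the step;
     otherwise it has occurred before the step. *)
  have [e|e] := pselect (X (k%:R * h)%R w = X 0%R w).
    apply: ereal_inf_lbound; exists (k.+1%:R * h)%R => //; split => //.
    by rewrite -e.
  apply: (@le_trans _ _ (k%:R * h)%:E).
    by apply: ereal_inf_lbound; exists (k%:R * h)%R.
  by rewrite lee_fin ler_wpM2r// ler_nat.
by rewrite lee_fin ler_wpM2r// ler_nat.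
Qed.

(** The mesh must be shorter than the intervals of constancy that follow the first jump and the
    return time; the grid then sees both events. The threshold [dl] depends on the path but not on
    [n]. *)
Lemma path_eventE H w : exists2 dl : R, (0 < dl)%R & forall h n, (0 < h < dl)%R ->
  path_event X 0%R (nseq n (h, allowed H)) w <-> (n%:R * h)%:E < return_time X H w.
Proof.
have [rty|] := eqVneq (return_time X H w) +oo.
  exists 1%R => // h n /andP[h0 _]; rewrite rty ltry; split => // _.
  by apply: return_time_gt_path; rewrite ?ltW// rty ltry.
move=> rtny; have rtfin : return_time X H w \is a fin_num.
  by rewrite ge0_fin_numE ?return_time_ge0// ltey.
have /esym rts := fineK rtfin; set s := fine _ in rts.
have [s0 js HXs] := return_time_attained rts.
have jfin : first_jump X w \is a fin_num.
  by rewrite ge0_fin_numE ?first_jump_ge0// (le_lt_trans js)// ltry.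
have /esym je := fineK jfin; set e := fine _ in je.
have [e0 Xe] := first_jump_attained je.
have [d1 d10 hd1] := right_constant w s0.
have [d2 d20 hd2] := right_constant w e0.
exists (Num.min d1 d2); first by rewrite lt_min d10.
move=> h n /andP[h0]; rewrite lt_min => /andP[hlt1 hlt2].
split; last exact/return_time_gt_path/ltW.
move=> /path_event_nseq pe; rewrite rts lte_fin ltNge; apply/negP => sn.
have [k /andP[k1 k2]] := grid_point e0 h0.
have [n0 /andP[n1 n2]] := grid_point s0 h0.
have n0n : (n0 <= n)%N.
  have : (n0%:R * h < n.+1%:R * h)%R.
    by rewrite (lt_le_trans n2)// -natr1 mulrDl mul1r lerD2r.
  by rewrite ltr_pM2r// ltr_nat ltnS.
have kn0 : (k <= n0)%N.
  have : (k%:R * h < n0.+1%:R * h)%R.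
    rewrite (lt_le_trans k2)// -natr1 mulrDl mul1r lerD2r (le_trans _ n1)//.
    by rewrite je lee_fin in js.
  by rewrite ltr_pM2r// ltr_nat ltnS.
have Xk : X (k%:R * h)%R w <> X 0%R w.
  by rewrite (hd2 (k%:R * h)%R)// k1 (lt_trans k2)// ltrD2l.
have Xn0 : H (X (n0%:R * h)%R w).
  by rewrite (hd1 (n0%:R * h)%R)// n1 (lt_trans n2)// ltrD2l.
(* No allowed step enters [H] from another state. Read backwards from a grid point in [H], the
   skeleton has thus been constant since time 0, which contradicts the jump seen at index [k]. *)
have stay m : (m <= n)%N -> H (X (m%:R * h)%R w) ->
    forall r, (r <= m)%N -> X (r%:R * h)%R w = X (m%:R * h)%R w.
  elim: m => [|m IH] mn Hm r; first by rewrite leqn0 => /eqP->.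
  rewrite leq_eqVlt ltnS => /predU1P[->//|rm].
  have := pe m mn; rewrite !add0r => -[Xm|//].
  by rewrite Xm; apply: IH => //; [exact: ltnW|rewrite -Xm].
by apply: Xk; rewrite (stay _ n0n Xn0 _ kn0) -(stay _ n0n Xn0 0%N)// mul0r.
Qed.

End ReturnTime.

(** * The first-step equation *)

Section FirstStep.
Context {R : realType} {E : countType} {Q : E -> E -> R} {d : measure_display}
  {Omega : measurableType d} {P : E -> probability Omega R}
  {X : R -> Omega -> E} {p : R -> E -> E -> R}.
Context (mX : forall (t : R) j, (0 <= t)%R -> measurable [set w | X t w = j])
  (rcX : forall w (t : R), (0 <= t)%R -> \forall s \near t^'+, X s w = X t w)
  (p_ge0 : forall (t : R) i j, (0 <= t)%R -> (0 <= p t i j)%R)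
  (p_0 : forall i, p 0%R i i = 1%R)
  (p_honest : honest p)
  (p_deriv : forall i j,
    ((p t i j - (i == j)%:R) / t)%R @[t --> (0%R : R)^'+] --> Q i j)
  (fdd : forall i (s : seq (R * E)), (forall a, a \in s -> (0 <= a.1)%R) ->
    P i (sample_event X 0%R s) = (sample_weight p i s)%:E)
  (Q_ge0 : forall i j, i != j -> (0 <= Q i j)%R)
  (Q_sum : forall i, \esum_(j in [set j | j != i]) (Q i j)%:E = (rate Q i)%:E).
Context (H : set E).

(** The mesh [h N] tends to 0 while the horizon [M N * h N], equal to [N.+1], tends to infinity. *)
Let h (N : nat) : R := N.+1%:R^-1.
Let M (N : nat) : nat := (N.+1 * N.+1)%N.
Let A N n : set Omega := path_event X 0%R (nseq n (h N, allowed H)).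
Let u N i n : R := fine (P i (A N n)).

Let h_gt0 N : (0 < h N)%R. Proof. by rewrite invr_gt0. Qed.

Let Mh N : ((M N)%:R * h N = N.+1%:R)%R.
Proof. by rewrite /M natrM /h mulfK// pnatr_eq0. Qed.

Let M_gt0 N : (0 < M N)%N. Proof. by []. Qed.

Let nseq_ge0 N n a : a \in map fst (nseq n (h N, allowed H)) -> (0 <= a)%R.
Proof. by rewrite map_nseq => /nseqP[-> _]; exact: (ltW (h_gt0 N)). Qed.

Let mA N n : measurable (A N n).
Proof. by apply: measurable_path_event => // a; exact: (@nseq_ge0 N n). Qed.

Let uE N i n : (u N i n)%:E = P i (A N n).
Proof. by rewrite fineK// fin_num_measure. Qed.

Let u_ge0 N i n : (0 <= u N i n)%R. Proof. exact: fine_ge0. Qed.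

Let u_0 N i : u N i 0%N = 1%R.
Proof. by apply: EFin_inj; rewrite uE /A /= probability_setT. Qed.

(** The first step of the skeleton. The diagonal term is separate because remaining at [i] is
    allowed even when [i] lies in [H]. *)
Let u_S N i n : (u N i n.+1)%:E =
  (p (h N) i i * u N i n)%:E + \esum_(j in ~` H `\ i) (p (h N) i j * u N j n)%:E.
Proof.
have hN0 := ltW (h_gt0 N).
rewrite uE (path_event_weight mX p_ge0 p_0 fdd) /=; last first.
  by move=> a /(@nseq_ge0 N n.+1).
have -> : allowed H i = [set j | j = i \/ ~ H j] by [].
rewrite (esum_setD1 (k := i)); last 2 first.
- by left.
- move=> j; apply: mule_ge0; first by rewrite lee_fin p_ge0.
  by apply: path_weight_ge0 => // a; exact: (@nseq_ge0 N n).
have e j : (p (h N) i j)%:E * path_weight p j (nseq n (h N, allowed H)) =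
    (p (h N) i j * u N j n)%:E.
  by rewrite EFinM uE (path_event_weight mX p_ge0 p_0 fdd)// => a; exact: (@nseq_ge0 N n).
rewrite e; congr (_ + _); rewrite (_ : _ `\ i = ~` H `\ i).
  by apply: eq_esum => j _; exact: e.
apply/seteqP; split=> j [Hj ji]; split => //; last by right.
by case: Hj => // /ji.
Qed.

Let h_cvg : h @ \oo --> 0%R.
Proof. exact: cvg_harmonic. Qed.

Let deriv i j : ((p (h N) i j - (i == j)%:R) / h N)%R @[N --> \oo] --> Q i j.
Proof. by have /cvg_at_rightP := @p_deriv i j; apply; split. Qed.

(** Honesty turns the sum of the off-diagonal quotients into a diagonal quotient, whose limit is the
    jump rate. *)
Let jump N i : \esum_(j in [set j | j != i]) (p (h N) i j / h N)%:E =
  ((1 - p (h N) i i) / h N)%:E.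
Proof.
have hN0 := ltW (h_gt0 N).
under eq_esum do rewrite EFinM.
rewrite esumZr ?invr_ge0//; last by move=> j; rewrite lee_fin p_ge0.
have := p_honest i hN0; rewrite (esum_setD1 (k := i))//; last first.
  by move=> j; rewrite lee_fin p_ge0.
rewrite (_ : _ `\ i = [set j | j != i]); last first.
  by apply/seteqP; split=> [j [_ /eqP]//|j /eqP ji]; split.
set S := esum _ _; case: S => [s| |] //=.
by move=> [e]; rewrite -EFinM (_ : s = 1 - p (h N) i i)%R// -e; ring.
Qed.

(** * The first-step equation for a bounded test function of the return time *)

Section TestFunction.
Context {f : R -> R} {fe ge : \bar R -> R} {C L : R}.
Context (f0 : f 0%R = 0%R)
  (f_mono : forall s t : R, (0 <= s)%R -> (s <= t)%R -> (f s <= f t)%R)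
  (fC : forall s : R, (0 <= s)%R -> (f s <= C)%R)
  (fL : forall s t : R, (0 <= s)%R -> (0 <= t)%R -> (f (s + t) - f s <= L * t)%R)
  (f_fin : forall (v : nat -> R) (s : R), (forall n, 0 <= v n)%R -> v @ \oo --> s ->
     f (v n) @[n --> \oo] --> fe s%:E)
  (f_inf : f n.+1%:R @[n --> \oo] --> fe +oo)
  (g_fin : forall (v : nat -> R) (s : R), (forall n, 0 <= v n)%R -> v @ \oo --> s ->
     ((f (v n + n.+1%:R^-1) - f (v n)) / n.+1%:R^-1)%R @[n --> \oo] --> ge s%:E)
  (g_inf : ge +oo = 0%R).

Let c N n : R := (f (n.+1%:R * h N) - f (n%:R * h N))%R.
(* [Y N] telescopes to [f] at the return time of the skeleton of mesh [h N], cut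
   off at [N.+1]. [Y' N] is the part of it that comes after a first step, and
   their difference, rescaled by [h N], tends to the derivative [ge] of [f]. *)
Let Y N w : R := (\sum_(0 <= n < M N) c N n * \1_(A N n) w)%R.
Let Y' N w : R := (\sum_(0 <= n < (M N).-1) c N n.+1 * \1_(A N n) w)%R.

Let grid_ge0 N n : (0 <= n%:R * h N)%R.
Proof. by rewrite mulr_ge0// ltW. Qed.

Let c_ge0 N n : (0 <= c N n)%R.
Proof. by rewrite subr_ge0 f_mono// ler_pM2r// ler_nat. Qed.

Let sum_c N m : (\sum_(0 <= n < m) c N n = f (m%:R * h N))%R.
Proof. by rewrite telescope_sumr// mul0r f0 subr0. Qed.

Let sum_c' N m : (\sum_(0 <= n < m) c N n.+1 = f (m.+1%:R * h N) - f (h N))%R.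
Proof.
by rewrite (telescope_sumr (fun n => f (n.+1%:R * h N)))// mul1r.
Qed.

Let sum_lt (F : nat -> R) m k : (k <= m)%N ->
  (\sum_(0 <= n < m) F n * (n < k)%N%:R = \sum_(0 <= n < k) F n)%R.
Proof.
move=> km; rewrite (big_cat_nat _ (n := k))//= [X in (_ + X)%R]big_nat_cond.
rewrite [X in (_ + X)%R]big1 ?addr0; last first.
  by move=> n /andP[/andP[kn _] _]; rewrite ltnNge kn mulr0.
by apply: eq_big_nat => n /andP[_ ->]; rewrite mulr1.
Qed.

(** On a path for which the mesh is fine enough, [A N n] holds exactly for the indices below the
    first grid point at or after the return time. With [k] that index, cut off at [M N], both sums
    telescope; the shift in [Y'] advances the argument of [f] by one mesh, unless the cutoff is
    active. *)
Let count N w : (forall n, A N n w <-> (n%:R * h N)%:E < return_time X H w) ->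
  exists k : nat, [/\ (k <= M N)%N, Y N w = f (k%:R * h N)%R,
    (Y' N w - Y N w + c N 0%N =
      if (k < M N)%N then f (k%:R * h N + h N) - f (k%:R * h N) else 0)%R,
    return_time X H w = +oo -> k = M N &
    forall s, return_time X H w = s%:E -> (s + h N < N.+1%:R)%R ->
      (k < M N)%N /\ (s <= k%:R * h N < s + h N)%R].
Proof.
move=> hA.
have [k [kM kA koo ks]] : exists k : nat, [/\ (k <= M N)%N,
    forall n, (n < M N)%N -> (\1_(A N n) w = (n < k)%N%:R :> R)%R,
    return_time X H w = +oo -> k = M N &
    forall s, return_time X H w = s%:E -> (s + h N < N.+1%:R)%R ->
      (k < M N)%N /\ (s <= k%:R * h N < s + h N)%R].
  have [rty|] := eqVneq (return_time X H w) +oo.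
    exists (M N); split => //; last by rewrite rty.
    by move=> n nM; rewrite indicE nM mem_set//; apply/hA; rewrite rty ltry.
  move=> rtny; have rtfin : return_time X H w \is a fin_num.
    by rewrite ge0_fin_numE ?return_time_ge0// ltey.
  have /esym rts := fineK rtfin; set s := fine _ in rts.
  have s0 : (0 <= s)%R by rewrite -lee_fin -rts return_time_ge0.
  have [k /andP[k1 k2]] := grid_point s0 (h_gt0 N).
  have nk n : (A N n w) <-> (n < k)%N.
    rewrite hA rts lte_fin; split => [ns|nk].
      have := lt_le_trans ns k1; rewrite ltr_pM2r// ltr_nat//.
    have : (n.+1%:R * h N <= k%:R * h N)%R by rewrite ler_pM2r// ler_nat.
    rewrite -natr1 mulrDl mul1r => /le_lt_trans-/(_ _ k2).
    by rewrite ltrD2r.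
  exists (minn k (M N)); split.
  - exact: geq_minr.
  - move=> n nM; rewrite indicE leq_min nM andbT; congr (_%:R).
    by congr nat_of_bool; apply/idP/idP; rewrite inE => /nk.
  - by rewrite rts.
  - move=> s'; rewrite rts => -[<-] sM.
    have kM : (k < M N)%N.
      by rewrite -(ltr_nat R) -(ltr_pM2r (h_gt0 N)) Mh (lt_trans k2).
    by rewrite (minn_idPl (ltnW kM)) kM k1.
exists k; split => //.
  rewrite /Y (_ : \sum_(0 <= n < M N) _ = \sum_(0 <= n < M N) c N n * (n < k)%N%:R)%R.
    by rewrite sum_lt// sum_c.
  by apply: eq_big_nat => n /andP[_ nM]; rewrite kA.
have -> : Y N w = f (k%:R * h N)%R.
  rewrite /Y (_ : \sum_(0 <= n < M N) _ = \sum_(0 <= n < M N) c N n * (n < k)%N%:R)%R.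
    by rewrite sum_lt// sum_c.
  by apply: eq_big_nat => n /andP[_ nM]; rewrite kA.
have -> : Y' N w = (f ((minn k (M N).-1).+1%:R * h N) - f (h N))%R.
  rewrite -sum_c' /Y' -(@sum_lt (fun n => c N n.+1) _ _ (geq_minr k _)).
  apply: eq_big_nat => n /andP[_ nM]; rewrite kA; last exact: leq_trans nM (leq_pred _).
  by rewrite leq_min nM andbT.
rewrite /c mul0r f0 mul1r subr0.
case: ltnP => kM'.
  have kM2 : (k <= (M N).-1)%N by rewrite -ltnS prednK.
  by rewrite (minn_idPl kM2) -natr1 mulrDl mul1r; ring.
have -> : k = M N by apply/eqP; rewrite eqn_leq kM.
by rewrite (minn_idPr (leq_pred _)) prednK//; ring.
Qed.

(** Eventually the mesh is fine enough for the given path. If there is no return, [k] is [M N] and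
    the horizon diverges; otherwise [k * h N] is squeezed between the return time and the return
    time plus [h N]. *)
Let Y_cvg w : Y ^~ w @ \oo --> fe (return_time X H w) /\
  ((Y' N w - Y N w + c N 0%N) / h N)%R @[N --> \oo] --> ge (return_time X H w).
Proof.
have [dl dl0 hdl] := path_eventE rcX H w.
have ev : \forall N \near \oo, forall n,
    A N n w <-> (n%:R * h N)%:E < return_time X H w.
  have : \forall N \near \oo, (h N < dl)%R by apply: (cvgr_lt _ h_cvg).
  by apply: filterS => N hN n; apply: hdl; rewrite h_gt0.
have [rty|] := eqVneq (return_time X H w) +oo.
  rewrite rty g_inf; split.
    apply: cvg_trans f_inf; apply: near_eq_cvg.
    by apply: filterS ev => N /count[k [_ -> _ /(_ rty)-> _]]; rewrite Mh.
  apply: cvg_near_cst; apply: filterS ev => N /count[k [_ _ -> /(_ rty)-> _]].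
  by rewrite ltnn mul0r.
move=> rtny; have rtfin : return_time X H w \is a fin_num.
  by rewrite ge0_fin_numE ?return_time_ge0// ltey.
have /esym rts := fineK rtfin; set s := fine _ in rts.
have s0 : (0 <= s)%R by rewrite -lee_fin -rts return_time_ge0.
have big : \forall N \near \oo, (s + h N < N.+1%:R)%R.
  have h1 : \forall N \near \oo, (h N < 1)%R by apply: (cvgr_lt _ h_cvg); exact: ltr01.
  have h2 : \forall N \near \oo, (s < N%:R)%R by exact: nbhs_infty_gtr.
  by apply: filterS2 h1 h2 => N h1 h2; rewrite -natr1 ltrD.
have [k hk] : exists k : nat -> nat, \forall N \near \oo,
   [/\ Y N w = f ((k N)%:R * h N)%R,
     (Y' N w - Y N w + c N 0%N = f ((k N)%:R * h N + h N) - f ((k N)%:R * h N))%R &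
     (s <= (k N)%:R * h N < s + h N)%R].
  have : \forall N \near \oo, exists k : nat,
   [/\ Y N w = f (k%:R * h N)%R,
     (Y' N w - Y N w + c N 0%N = f (k%:R * h N + h N) - f (k%:R * h N))%R &
     (s <= k%:R * h N < s + h N)%R].
    apply: filterS2 ev big => N /count[k [_ e1 e2 _ /(_ _ rts) e3]] /e3[kM ks].
    by exists k; split => //; rewrite e2 kM.
  move=> [N0 _ hN0].
  have /choice[k hk] : forall N, exists k : nat, (N0 <= N)%N ->
   [/\ Y N w = f (k%:R * h N)%R,
     (Y' N w - Y N w + c N 0%N = f (k%:R * h N + h N) - f (k%:R * h N))%R &
     (s <= k%:R * h N < s + h N)%R].
    move=> N; have [NN|NN] := leqP N0 N; last by exists 0%N.
    by have [k ?] := hN0 N NN; exists k.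
  by exists k; exists N0.
have kcvg : ((k N)%:R * h N)%R @[N --> \oo] --> s.
  apply: (@squeeze_cvgr _ _ _ _ (fun=> s) (fun N => s + h N)%R).
  - by apply: filterS hk => N [_ _ /andP[-> /ltW->]].
  - exact: cvg_cst.
  - by rewrite -[X in _ --> X]addr0; apply: cvgD => //; exact: cvg_cst.
rewrite rts; split.
  have h1 : f ((k N)%:R * h N)%R @[N --> \oo] --> fe s%:E by exact: f_fin.
  by apply: cvg_trans h1; apply: near_eq_cvg; apply: filterS hk => N [->].
have h1 := g_fin (fun N => grid_ge0 N (k N)) kcvg.
by apply: cvg_trans h1; apply: near_eq_cvg; apply: filterS hk => N [_ ->].
Qed.

Let mY N : measurable_fun setT (Y N).
Proof. by apply: measurable_sum => n; exact: measurable_funM. Qed.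

Let mY' N : measurable_fun setT (Y' N).
Proof. by apply: measurable_sum => n; exact: measurable_funM. Qed.

Let indic_bound N n w : (0 <= (\1_(A N n) w : R) <= 1)%R.
Proof. by rewrite indicE; case: (_ \in _); rewrite ?lexx ?ler01. Qed.

Let Y_bound N w : (`|Y N w| <= C)%R.
Proof.
rewrite ger0_norm; last first.
  by apply: sumr_ge0 => n _; rewrite mulr_ge0//; case/andP: (indic_bound N n w).
apply: (@le_trans _ _ (\sum_(0 <= n < M N) c N n)%R); last by rewrite sum_c fC.
by apply: ler_sum => n _; rewrite ler_piMr//; case/andP: (indic_bound N n w).
Qed.

Let Y'_bound N w : (0 <= Y' N w <= C)%R.
Proof.
apply/andP; split.
  by apply: sumr_ge0 => n _; rewrite mulr_ge0//; case/andP: (indic_bound N n w).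
apply: (@le_trans _ _ (\sum_(0 <= n < (M N).-1) c N n.+1)%R).
  by apply: ler_sum => n _; rewrite ler_piMr//; case/andP: (indic_bound N n w).
rewrite sum_c' lerBlDr (le_trans (fC _))// lerDl -f0 f_mono//.
exact: ltW (h_gt0 N).
Qed.

(** Summation by parts gives a sum of the increments [c N n.+1] over the differences of successive
    indicators. Each increment is at most [L * h N], and since the events [A N n] decrease in [n]
    the differences are non-negative with total at most 1. *)
Let D_bound N w : (`|(Y' N w - Y N w + c N 0%N) / h N| <= L)%R.
Proof.
have anti n : ((\1_(A N n.+1) w : R) <= \1_(A N n) w)%R.
  rewrite !indicE; have [An|_] := boolP (w \in A N n.+1); last by rewrite ler0n.
  rewrite mem_set//; apply/path_event_nseq => k kn.
  by move/set_mem/path_event_nseq : An; apply; exact: ltnW.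
have -> : (Y' N w - Y N w + c N 0%N = \sum_(0 <= n < (M N).-1)
    c N n.+1 * (\1_(A N n) w - \1_(A N n.+1) w))%R.
  rewrite /Y -(prednK (M_gt0 N)) big_nat_recl//= /Y'.
  have -> : \1_(A N 0%N) w = 1%R :> R by rewrite indicE mem_set.
  rewrite mulr1; under [RHS]eq_bigr do rewrite mulrBr.
  by rewrite sumrB; ring.
have D0 n : (0 <= (\1_(A N n) w : R) - \1_(A N n.+1) w)%R by rewrite subr_ge0.
rewrite ger0_norm; last first.
  rewrite divr_ge0//; last exact: ltW (h_gt0 N).
  by apply: sumr_ge0 => n _; rewrite mulr_ge0.
rewrite ler_pdivrMr//.
have cL n : (c N n <= L * h N)%R.
  by rewrite /c -natr1 mulrDl mul1r fL//; exact: ltW (h_gt0 N).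
have Lh0 : (0 <= L * h N)%R by exact: le_trans (c_ge0 N 0) (cL 0%N).
apply: (@le_trans _ _ (\sum_(0 <= n < (M N).-1)
    (L * h N) * (\1_(A N n) w - \1_(A N n.+1) w))%R).
  by apply: ler_sum => n _; rewrite ler_wpM2r.
rewrite -mulr_sumr (@telescope_sumr_eq _ _ _ (fun n => - (\1_(A N n) w : R))%R)//; last first.
  by move=> k _; ring.
by apply: ler_piMr => //; rewrite opprK addrC.
Qed.

Lemma measurable_test_return : measurable_fun setT (fun w => fe (return_time X H w)) /\
  measurable_fun setT (fun w => ge (return_time X H w)).
Proof.
split.
  by apply: (measurable_fun_cvg (h := Y)) => [N|w _]; [exact: mY|case: (Y_cvg w)].
apply: (measurable_fun_cvg (h := fun N w => (Y' N w - Y N w + c N 0%N) / h N)%R) => [N|w _].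
  apply: measurable_funM => //; apply: measurable_funD => //.
  exact: measurable_funB.
by case: (Y_cvg w).
Qed.

(** The recursion of the skeleton, divided by the mesh, has the quotients [p / h] as jump
    coefficients. Their total masses converge to the jump rate, so the Scheffé-type lemma takes the
    sum to the limit, while the diagonal term contributes the derivative [ge]. *)
Lemma first_step i : (0 < rate Q i)%R ->
  (\int[P i]_w fe (return_time X H w))%R%:E =
    \esum_(j in ~` H)
      (embedding Q i j * (\int[P j]_w fe (return_time X H w)))%:E +
    ((\int[P i]_w ge (return_time X H w)) / rate Q i)%:E.
Proof.
move=> qi.
pose F j := (\int[P j]_w fe (return_time X H w))%R.
rewrite -/(F i); under eq_esum => j _ do rewrite -/(F j).
pose y N j := (\int[P j]_w Y N w)%R; pose y' N j := (\int[P j]_w Y' N w)%R.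
pose G := (\int[P i]_w ge (return_time X H w))%R.
have iY N j : (P j).-integrable setT (EFin \o Y N).
  exact: (bounded_integrable _ (mY N) (Y_bound N)).
have iY' N j : (P j).-integrable setT (EFin \o Y' N).
  apply: (@bounded_integrable _ _ _ (P j) _ C (mY' N)) => w.
  by have /andP[y0 yC] := Y'_bound N w; rewrite ger0_norm.
have cy j : y ^~ j @ \oo --> F j.
  by have [] := bounded_convergence (P j) mY Y_bound (fun w => (Y_cvg w).1).
have mD N : measurable_fun setT (fun w => (Y' N w - Y N w + c N 0%N) / h N)%R.
  apply: measurable_funM => //; apply: measurable_funD => //.
  exact: measurable_funB.
have cD j : ((y' N j - y N j + c N 0%N) / h N)%R @[N --> \oo] -->
    (\int[P j]_w ge (return_time X H w))%R.
  have [_] := bounded_convergence (P j) mD D_bound (fun w => (Y_cvg w).2).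
  apply: cvg_trans; apply: near_eq_cvg; apply: nearW => N.
  rewrite RintegralZr//; last first.
    apply: (@bounded_integrable _ _ _ (P j) _ (L * h N)%R).
      by apply: measurable_funD => //; exact: measurable_funB.
    move=> w; have := D_bound N w.
    by rewrite normrM (gtr0_norm (_ : 0 < (h N)^-1)%R) ?invr_gt0// ler_pdivrMr.
  rewrite RintegralD//.
  - rewrite RintegralB; [|by []|exact: iY'|exact: iY].
    by rewrite Rintegral_prob_cst.
  - rewrite (_ : EFin \o _ = (EFin \o Y' N) \- (EFin \o Y N))//.
    by apply: integrableB; [|exact: iY'|exact: iY].
  - by apply: (@bounded_integrable _ _ _ (P j) _ `|c N 0%N|%R).
have c0 : c N 0%N @[N --> \oo] --> 0%R.
  apply: (@squeeze_cvgr _ _ _ _ (fun=> 0%R) (fun N => L * h N)%R).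
  - apply: nearW => N; rewrite c_ge0/= /c mul1r mul0r.
    by have := fL (lexx 0%R) (ltW (h_gt0 N)); rewrite add0r.
  - exact: cvg_cst.
  - by rewrite -[X in _ --> X](mulr0 L); apply: cvgM => //; exact: cvg_cst.
(* [y'] and [y] differ by [h N] times a convergent sequence, up to the vanishing [c N 0]. *)
have cy' j : y' ^~ j @ \oo --> F j.
  have : ((y' N j - y N j + c N 0%N) / h N * h N + y N j - c N 0%N)%R @[N --> \oo] -->
      ((\int[P j]_w ge (return_time X H w)) * 0 + F j - 0)%R.
    by apply: cvgB => //; apply: cvgD => //; exact: cvgM.
  rewrite mulr0 add0r subr0; apply: cvg_trans; apply: near_eq_cvg; apply: nearW => N.
  by rewrite divfK ?gt_eqF//; ring.
have yE N j : y N j = (\sum_(0 <= n < M N) c N n * u N j n)%R.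
  by apply: Rintegral_sum_indic => n; exact: mA.
have y'E N j : y' N j = (\sum_(0 <= n < (M N).-1) c N n.+1 * u N j n)%R.
  by apply: Rintegral_sum_indic => n; exact: mA.
have y'_bound N j : (0 <= y' N j <= C)%R by exact: Rintegral_itv.
(* The one-step recursion [u_S], multiplied by [c N n.+1] and summed over [n]; the shift of index
   accounts for [y'] on one side and for [y] without its first term on the other. *)
have rec N : \esum_(j in ~` H `\ i) (p (h N) i j * y' N j)%:E =
    (y N i - c N 0%N - p (h N) i i * y' N i)%:E.
  have hN0 := ltW (h_gt0 N).
  have e1 : (y N i - c N 0%N = \sum_(0 <= n < (M N).-1) c N n.+1 * u N i n.+1)%R.
    by rewrite yE -(prednK (M_gt0 N)) big_nat_recl//= u_0 mulr1; ring.
  suff : \esum_(j in ~` H `\ i) (p (h N) i j * y' N j)%:E +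
      (p (h N) i i * y' N i)%:E = (y N i - c N 0%N)%:E.
    by set S := esum _ _; case: S => [s| |]//= [<-]; congr (_%:E); ring.
  rewrite e1 -sumEFin.
  transitivity (\sum_(0 <= n < (M N).-1)
    (\esum_(j in ~` H `\ i) (p (h N) i j * (c N n.+1 * u N j n))%:E +
     (p (h N) i i * (c N n.+1 * u N i n))%:E)); last first.
    apply: eq_bigr => n _; rewrite [RHS]EFinM u_S ge0_muleDr; last 2 first.
    - by rewrite lee_fin mulr_ge0// p_ge0.
    - by apply: esum_ge0 => j _; rewrite lee_fin mulr_ge0// p_ge0.
    rewrite addeC -esumZl//; last by move=> j; rewrite lee_fin mulr_ge0// p_ge0.
    congr (_ + _); first by rewrite -EFinM mulrCA.
    by apply: eq_esum => j _; rewrite -EFinM mulrCA.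
  rewrite big_split/= -esum_sum; last first.
    by move=> n j _ _; rewrite lee_fin mulr_ge0 ?p_ge0// mulr_ge0.
  congr (_ + _); last by rewrite sumEFin -mulr_sumr y'E.
  by apply: eq_esum => j _; rewrite sumEFin -mulr_sumr y'E.
have FC j : (0 <= F j <= C)%R.
  apply/andP; split; [apply: (limr_ge_cvg (cy' j))|apply: (limr_le_cvg (cy' j))];
    by move=> n; case/andP: (y'_bound n j).
(* The restriction to the complement of [H] goes into [b] and not into [a]: the masses of [a] are
   then total jump quotients, whose convergence is known. *)
pose a N j := if j == i then 0%R else (p (h N) i j / h N)%R.
pose b N j := if j \in H then 0%R else y' N j.
pose a' j := if j == i then 0%R else Q i j.
pose b' j := if j \in H then 0%R else F j.
have a'0 j : (0 <= a' j)%R.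
  by rewrite /a'; case: eqP => // /eqP ji; rewrite Q_ge0// eq_sym.
have b'0 j : (0 <= b' j <= C)%R.
  by rewrite /b'; case: ifP => // _; case/andP: (FC j) => x y0; rewrite lexx (le_trans x).
have hA' : \esum_(j in [set j | j != i]) (a' j)%:E = (rate Q i)%:E.
  by rewrite -Q_sum; apply: eq_esum => j /= ji; rewrite /a' (negbTE ji).
pose s' := fine (\esum_(j in [set j | j != i]) (a' j * b' j)%:E).
have hs' : \esum_(j in [set j | j != i]) (a' j * b' j)%:E = s'%:E.
  rewrite /s' fineK// ge0_fin_numE; last first.
    by apply: esum_ge0 => j _; rewrite lee_fin mulr_ge0//; case/andP: (b'0 j).
  have C0 : (0 <= C)%R by case/andP: (b'0 i); exact: le_trans.
  apply: (@le_lt_trans _ _ (\esum_(j in [set j | j != i]) ((a' j)%:E * C%:E))).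
    apply: le_esum => j ji; rewrite -EFinM lee_fin.
    by rewrite ler_wpM2l//; case/andP: (b'0 j).
  by rewrite esumZr// hA' -EFinM ltry.
have sc : ((y N i - c N 0%N - p (h N) i i * y' N i) / h N)%R @[N --> \oo] --> s'.
  apply: (@esum_scheffe _ _ [set j | j != i] a b a' b' C
    (fun N => (1 - p (h N) i i) / h N)%R _ (rate Q i)) => //.
  - move=> N j; rewrite /a; case: ifP => // _.
    by rewrite divr_ge0 ?p_ge0// ltW.
  - move=> N j; rewrite /b; case: ifP => // _.
    by case/andP: (y'_bound N i) => x y0; rewrite lexx (le_trans x).
  - move=> j; rewrite /a /a'; case: eqP => [_|/eqP ji]; first exact: cvg_cst.
    have := @deriv i j; rewrite eq_sym (negbTE ji).
    by under eq_fun do rewrite subr0.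
  - by move=> j; rewrite /b /b'; case: ifP => _ //; exact: cvg_cst.
  - have := @deriv i i; rewrite eqxx /= => /cvgN; rewrite -/(rate Q i).
    apply: cvg_trans; apply: near_eq_cvg; apply: nearW => N.
    by rewrite /= -mulNr opprB.
  - by move=> N; rewrite -jump; apply: eq_esum => j /= ji; rewrite /a (negbTE ji).
  - move=> N; rewrite EFinM -rec -esumZr ?invr_ge0 ?(ltW (h_gt0 N))//; last first.
      move=> j; rewrite lee_fin mulr_ge0 ?p_ge0 ?(ltW (h_gt0 N))//.
      by case/andP: (y'_bound N j).
    rewrite esum_mkcond [RHS]esum_mkcond; apply: eq_esum => j _.
    rewrite /a /b; case: (eqVneq j i) => ji.
      by rewrite ji mul0r; case: ifP => _; case: ifPn => // /set_mem[_ []].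
    rewrite -EFinM (mem_set (_ : [set j | j != i] j))//; case: ifPn => jH.
      by rewrite mulr0 memNset// => -[nH _]; apply: nH; exact/set_mem.
    rewrite mem_set; last first.
      by split; [move/mem_set; rewrite (negbTE jH)|exact/eqP].
    by congr (_%:E); ring.
(* The same quotient, regrouped as the jump quotient times [y'] minus the rescaled difference of
   [y'] and [y], has a second expression for its limit. *)
have sG : ((y N i - c N 0%N - p (h N) i i * y' N i) / h N)%R @[N --> \oo] -->
    (rate Q i * F i - G)%R.
  have hr : ((1 - p (h N) i i) / h N)%R @[N --> \oo] --> rate Q i.
    have := @deriv i i; rewrite eqxx /= => /cvgN; rewrite -/(rate Q i).
    apply: cvg_trans; apply: near_eq_cvg; apply: nearW => N.
    by rewrite /= -mulNr opprB.
  have h1 : ((1 - p (h N) i i) / h N * y' N i -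
      (y' N i - y N i + c N 0%N) / h N)%R @[N --> \oo] --> (rate Q i * F i - G)%R.
    by apply: cvgB; [exact: cvgM|exact: cD].
  apply: cvg_trans h1; apply: near_eq_cvg; apply: nearW => N /=.
  by ring.
have s'E : s' = (rate Q i * F i - G)%R by apply: cvg_unique sc sG.
transitivity ((s' / rate Q i)%:E + (G / rate Q i)%:E).
  by rewrite s'E -EFinD; congr (_%:E); field; rewrite gt_eqF.
congr (_ + _); rewrite EFinM -hs' -esumZr ?invr_ge0 ?(ltW qi)//; last first.
  by move=> j; rewrite lee_fin mulr_ge0//; case/andP: (b'0 j).
rewrite esum_mkcond [RHS]esum_mkcond; apply: eq_esum => j _.
rewrite /a' /b' /embedding; case: (eqVneq j i) => ji.
  by rewrite ji !mul0r mul0e; case: ifP; case: ifP.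
rewrite (mem_set (_ : [set j | j != i] j))//; case: ifPn => jH.
  by rewrite mulr0 mul0e memNset// => nH; apply: nH; exact/set_mem.
rewrite mem_set; last by move/mem_set; rewrite (negbTE jH).
by rewrite -EFinM; congr (_%:E); ring.
Qed.

End TestFunction.
End FirstStep.

(** * Damped moments *)

Section DampedMoments.
Context {R : realType}.
Implicit Types (lam s t : R) (x y : \bar R) (k : nat).

(** Its expectation at a random time is the Laplace transform of that time; the value at [+oo] is
    the limit of the exponential. *)
Definition damping lam x : R := if x is s%:E then expR (- (lam * s)) else 0%R.

(* A bounded version of [x ^+ k], increasing to it as [lam] decreases to 0. *)
Definition damped_power lam k x : R := (((1 - damping lam x) / lam) ^+ k)%R.

Lemma damping_ge0 lam x : (0 <= damping lam x)%R.
Proof. by case: x => //= s; exact: expR_ge0. Qed.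

Lemma damping_le1 lam x : (0 <= lam)%R -> 0 <= x -> (damping lam x <= 1)%R.
Proof.
move=> l0; case: x => //= s s0; rewrite -expR0 ler_expR oppr_le0.
by rewrite mulr_ge0.
Qed.

Lemma damped_base_itv lam x : (0 < lam)%R -> 0 <= x ->
  (0 <= (1 - damping lam x) / lam <= lam^-1)%R.
Proof.
move=> l0 x0; apply/andP; split.
  by rewrite divr_ge0 ?subr_ge0 ?damping_le1// ltW.
by rewrite ler_piMl ?invr_ge0 ?(ltW l0)// gerBl damping_ge0.
Qed.

Lemma damped_power_itv lam k x : (0 < lam)%R -> 0 <= x ->
  (0 <= damped_power lam k x <= lam^-1 ^+ k)%R.
Proof.
move=> l0 x0; have /andP[b0 b1] := damped_base_itv l0 x0.
by rewrite exprn_ge0//= lerXn2r// nnegrE// (le_trans b0).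
Qed.

Lemma expR_increment (x : R) : (0 <= x)%R ->
  (expR (- x) * x <= 1 - expR (- x) <= x)%R.
Proof.
move=> x0; apply/andP; split.
  have : (expR (- x) * (1 + x) <= expR (- x) * expR x)%R.
    by rewrite ler_wpM2l ?expR_ge0// expR_ge1Dx.
  by rewrite -expRD addNr expR0 mulrDr mulr1 lerBrDl.
by have := expR_ge1Dx (- x)%R; lra.
Qed.

Lemma damped_increment lam s t : (0 < lam)%R -> (0 <= s)%R -> (0 <= t)%R ->
  ((1 - damping lam (s + t)%:E) / lam - (1 - damping lam s%:E) / lam =
   expR (- (lam * s)) * ((1 - expR (- (lam * t))) / lam))%R.
Proof.
by move=> l0 s0 t0; rewrite /= mulrDr opprD expRD; field; rewrite gt_eqF.
Qed.

Lemma damped_increment_itv lam t : (0 < lam)%R -> (0 <= t)%R ->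
  (expR (- (lam * t)) * t <= (1 - expR (- (lam * t))) / lam <= t)%R.
Proof.
move=> l0 t0; have /andP[h1 h2] := expR_increment (mulr_ge0 (ltW l0) t0).
rewrite ler_pdivlMr// ler_pdivrMr// ![(_ * lam)%R]mulrC; apply/andP; split => //.
by rewrite mulrCA.
Qed.

Lemma damped_power_mono lam k s t : (0 < lam)%R -> (0 <= s)%R -> (s <= t)%R ->
  (damped_power lam k s%:E <= damped_power lam k t%:E)%R.
Proof.
move=> l0 s0 st; have t0 := le_trans s0 st.
have /andP[b0 _] := @damped_base_itv lam s%:E l0 s0.
have /andP[b0' _] := @damped_base_itv lam t%:E l0 t0.
rewrite /damped_power lerXn2r ?nnegrE// -subr_ge0.
have ts0 : (0 <= t - s)%R by rewrite subr_ge0.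
have := damped_increment l0 s0 ts0.
rewrite (_ : s + (t - s) = t)%R; last by ring.
move=> ->.
rewrite mulr_ge0 ?expR_ge0// divr_ge0 ?(ltW l0)// subr_ge0 -expR0 ler_expR oppr_le0.
by rewrite mulr_ge0 ?(ltW l0)// subr_ge0.
Qed.

(** A difference of powers factors into the increment of the base, at most [t], and [k.+1] products,
    each at most [lam^-1 ^+ k]. *)
Lemma damped_power_lip lam k s t : (0 < lam)%R -> (0 <= s)%R -> (0 <= t)%R ->
  (damped_power lam k.+1 (s + t)%:E - damped_power lam k.+1 s%:E <=
   k.+1%:R * lam^-1 ^+ k * t)%R.
Proof.
move=> l0 s0 t0; have st0 := addr_ge0 s0 t0.
have /andP[b0 b1] := @damped_base_itv lam s%:E l0 s0.
have /andP[a0 a1] := @damped_base_itv lam (s + t)%:E l0 st0.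
rewrite /damped_power subrXX damped_increment//.
have /andP[i0 i1] := damped_increment_itv l0 t0.
rewrite [leRHS]mulrC ler_pM//.
- by rewrite mulr_ge0 ?expR_ge0// (le_trans _ i0)// mulr_ge0// expR_ge0.
- by apply: sumr_ge0 => i _; rewrite mulr_ge0// exprn_ge0.
- rewrite (le_trans _ i1)// ler_piMl//; first by rewrite (le_trans _ i0)// mulr_ge0// expR_ge0.
  by rewrite -expR0 ler_expR oppr_le0 mulr_ge0// ltW.
rewrite [leRHS](_ : _ = \sum_(i < k.+1) lam^-1 ^+ k)%R; last first.
  by rewrite sumr_const card_ord mulr_natl.
apply: ler_sum => i _.
have -> : (lam^-1 ^+ k = lam^-1 ^+ (k - i) * lam^-1 ^+ i)%R.
  by rewrite -exprD subnK// -ltnS.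
have li : (0 <= lam^-1)%R by rewrite invr_ge0 ltW.
by rewrite /= ler_pM ?exprn_ge0// lerXn2r// nnegrE.
Qed.

Lemma cvg_damping lam (v : nat -> R) s : v @ \oo --> s ->
  damping lam (v n)%:E @[n --> \oo] --> damping lam s%:E.
Proof.
move=> vs /=; apply: (@continuous_cvg _ _ _ _ _ _ (@expR R)); first exact: continuous_expR.
by apply: cvgN; apply: cvgM => //; exact: cvg_cst.
Qed.

Lemma cvg_exprn (v : nat -> R) s k : v @ \oo --> s -> ((v n) ^+ k)%R @[n --> \oo] --> (s ^+ k)%R.
Proof.
move=> vs; apply: (@continuous_cvg _ _ _ _ _ _ (fun x : R => x ^+ k)%R) => //.
exact: exprn_continuous.
Qed.

Lemma cvg_sum_ord m (u : 'I_m -> nat -> R) (l : 'I_m -> R) :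
  (forall i, u i @ \oo --> l i) ->
  (\sum_(i < m) u i n)%R @[n --> \oo] --> (\sum_(i < m) l i)%R.
Proof.
elim: m u l => [|m IH] u l ul.
  by under eq_fun do rewrite big_ord0; rewrite big_ord0; exact: cvg_cst.
under eq_fun do rewrite big_ord_recr; rewrite big_ord_recr.
by apply: cvgD => //; exact: IH.
Qed.

Lemma cvg_damped_base lam (v : nat -> R) s : v @ \oo --> s ->
  ((1 - damping lam (v n)%:E) / lam)%R @[n --> \oo] --> ((1 - damping lam s%:E) / lam)%R.
Proof.
move=> vs; apply: cvgM; last exact: cvg_cst.
by apply: cvgB; [exact: cvg_cst|exact: cvg_damping].
Qed.

Lemma cvg_damped_power lam k (v : nat -> R) s : v @ \oo --> s ->
  damped_power lam k (v n)%:E @[n --> \oo] --> damped_power lam k s%:E.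
Proof. by move=> vs; apply: cvg_exprn; exact: cvg_damped_base. Qed.

Lemma cvg_damping_pinfty lam : (0 < lam)%R ->
  damping lam (n.+1%:R)%:E @[n --> \oo] --> 0%R.
Proof.
move=> l0; apply: (@squeeze_cvgr _ _ _ _ (fun=> 0%R) (fun n => lam^-1 * n.+1%:R^-1)%R).
- apply: nearW => n; rewrite damping_ge0/= -invfM expRN lef_pV2 ?posrE ?expR_gt0//.
    by rewrite (le_trans _ (expR_ge1Dx _))// lerDr.
  by rewrite mulr_gt0// ltr0n.
- exact: cvg_cst.
- rewrite -[X in _ --> X](mulr0 lam^-1%R); apply: cvgM; first exact: cvg_cst.
  exact: cvg_harmonic.
Qed.

(** The derivative of the damped power, along a base point [v n] that moves with the mesh. The
    difference quotient factors exactly into a damping factor, a quotient tending to 1, and a sum of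
    [k.+1] products with a common limit. *)
Lemma cvg_damped_slope lam k (v : nat -> R) s : (0 < lam)%R ->
  (forall n, 0 <= v n)%R -> v @ \oo --> s ->
  ((damped_power lam k.+1 (v n + n.+1%:R^-1)%:E - damped_power lam k.+1 (v n)%:E)
     / n.+1%:R^-1)%R @[n --> \oo] -->
  (k.+1%:R * damped_power lam k s%:E * damping lam s%:E)%R.
Proof.
move=> l0 v0 vs.
pose a n := ((1 - damping lam (v n + n.+1%:R^-1)%:E) / lam)%R.
pose b n := ((1 - damping lam (v n)%:E) / lam)%R.
pose e n : R := ((1 - expR (- (lam * n.+1%:R^-1))) / lam / n.+1%:R^-1)%R.
have hs : (v n + n.+1%:R^-1)%R @[n --> \oo] --> s.
  by rewrite -[X in _ --> X]addr0; apply: cvgD => //; exact: cvg_harmonic.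
have ca : a @ \oo --> ((1 - damping lam s%:E) / lam)%R by exact: cvg_damped_base.
have cb : b @ \oo --> ((1 - damping lam s%:E) / lam)%R by exact: cvg_damped_base.
have ce : e @ \oo --> (1 : R)%R.
  apply: (@squeeze_cvgr _ _ _ _ (fun n => damping lam (n.+1%:R^-1)%:E) (fun=> 1%R)).
  - apply: nearW => n; have n0 : (0 < n.+1%:R^-1 :> R)%R by rewrite invr_gt0.
    have /andP[h1 h2] := damped_increment_itv l0 (ltW n0).
    by apply/andP; split; [rewrite ler_pdivlMr|rewrite (ler_pdivrMr _ _ n0) mul1r].
  - rewrite -[X in _ --> X](_ : damping lam 0%:E = 1%R); first exact: cvg_damping cvg_harmonic.
    by rewrite /= mulr0 oppr0 expR0.
  - exact: cvg_cst.
have cS : (\sum_(i < k.+1) a n ^+ (k - i) * b n ^+ i)%R @[n --> \oo] -->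
    (\sum_(i < k.+1) ((1 - damping lam s%:E) / lam) ^+ (k - i) *
       ((1 - damping lam s%:E) / lam) ^+ i)%R.
  by apply: cvg_sum_ord => i; apply: cvgM; exact: cvg_exprn.
have -> : (k.+1%:R * damped_power lam k s%:E * damping lam s%:E =
    damping lam s%:E * 1 * \sum_(i < k.+1) ((1 - damping lam s%:E) / lam) ^+ (k - i) *
       ((1 - damping lam s%:E) / lam) ^+ i)%R.
  rewrite mulr1 mulrC; congr (_ * _)%R.
  transitivity (\sum_(i < k.+1) damped_power lam k s%:E)%R.
    by rewrite sumr_const card_ord mulr_natl.
  by apply: eq_bigr => i _; rewrite -exprD subnK// -ltnS.
have h : (damping lam (v n)%:E * e n * \sum_(i < k.+1) a n ^+ (k - i) * b n ^+ i)%R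
    @[n --> \oo] --> (damping lam s%:E * 1 *
      \sum_(i < k.+1) ((1 - damping lam s%:E) / lam) ^+ (k - i) *
       ((1 - damping lam s%:E) / lam) ^+ i)%R.
  by apply: cvgM => //; apply: cvgM => //; exact: cvg_damping.
apply: cvg_trans h; apply: near_eq_cvg; apply: nearW => n /=.
rewrite /damped_power subrXX damped_increment// [RHS]mulrAC.
by rewrite -/(a n) -/(b n) /e mulrA.
Qed.

End DampedMoments.

(** * Non-explosion *)

Section Confinement.
Context {R : realType} {E : countType} {Q : E -> E -> R} {d : measure_display}
  {Omega : measurableType d} {P : E -> probability Omega R}
  {X : R -> Omega -> E} {p : R -> E -> E -> R}.
Context (mX : forall (t : R) j, (0 <= t)%R -> measurable [set w | X t w = j])
  (rcX : forall w (t : R), (0 <= t)%R -> \forall s \near t^'+, X s w = X t w)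
  (p_ge0 : forall (t : R) i j, (0 <= t)%R -> (0 <= p t i j)%R)
  (p_0 : forall i, p 0%R i i = 1%R)
  (p_honest : honest p)
  (p_deriv : forall i j,
    ((p t i j - (i == j)%:R) / t)%R @[t --> (0%R : R)^'+] --> Q i j)
  (fdd : forall i (s : seq (R * E)), (forall a, a \in s -> (0 <= a.1)%R) ->
    P i (sample_event X 0%R s) = (sample_weight p i s)%:E).
Implicit Types (A : set E) (T s t : R) (i j : E) (m n : nat) (w : Omega).

Definition confined A T t : set Omega :=
  [set w | forall s, (T <= s <= T + t)%R -> A (X s w)].

(** The [m] steps of length [t / m.+1] stop one step short of time [t]; the last step, in [mesh_to],
    fixes the final state instead of constraining it to a set. *)
Definition mesh (S : E -> set E) t m : seq (R * (E -> set E)) :=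
  nseq m ((t / m.+1%:R)%R, S).

Definition mesh_to (S : E -> set E) j t m : seq (R * (E -> set E)) :=
  rcons (mesh S t m) ((t / m.+1%:R)%R, fun=> [set j]).

Lemma mesh_ge0 S t m m' : (0 <= t)%R ->
  forall a, a \in map fst (nseq m ((t / m'.+1%:R)%R, S : E -> set E)) -> (0 <= a)%R.
Proof. by move=> t0 a; rewrite map_nseq => /nseqP[-> _]; rewrite divr_ge0. Qed.

Lemma mesh_to_ge0 S j t m : (0 <= t)%R ->
  forall a, a \in map fst (mesh_to S j t m) -> (0 <= a)%R.
Proof.
move=> t0 a; rewrite map_rcons mem_rcons in_cons => /orP[/eqP->|]; last exact: mesh_ge0.
by rewrite divr_ge0.
Qed.

Lemma end_time_nseq T m h (S : E -> set E) :
  end_time T (nseq m (h, S)) = (T + m%:R * h)%R.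
Proof.
elim: m T => [|m IH] T; first by rewrite mul0r addr0.
by rewrite /end_time/= -/(end_time _ _) IH -addrA -nat1r mulrDl mul1r.
Qed.

Lemma end_time_mesh_to T (S : E -> set E) j t m :
  end_time T (mesh_to S j t m) = (T + t)%R.
Proof.
rewrite end_time_rcons end_time_nseq /= -addrA -{2}(mul1r (t / _)%R) -mulrDl natr1.
by rewrite mulrCA divff ?mulr1// pnatr_eq0.
Qed.

Lemma path_event_mesh_to T (S : E -> set E) j t m w :
  path_event X T (mesh_to S j t m) w <->
  path_event X T (mesh S t m) w /\ X (T + t)%R w = j.
Proof.
rewrite /mesh_to -cats1 path_event_cat /=.
have := end_time_mesh_to T S j t m; rewrite end_time_rcons /= => ->.
by split=> [[? []]|[? ?]].
Qed.

(** A path that is outside [A] before the end of the window remains outside for a positive time and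
    is caught by a fine mesh. The end point itself is covered by the separate condition at
    [T + t]. *)
Lemma mesh_confined A T t w : (0 <= T)%R -> (0 <= t)%R ->
  \forall m \near \oo,
    (path_event X T (mesh (fun=> A) t m) w /\ A (X (T + t)%R w)) <-> confined A T t w.
Proof.
move=> T0 t0.
have grid m k : (k < m.+1)%N -> (T <= T + k.+1%:R * (t / m.+1%:R) <= T + t)%R.
  move=> km; rewrite lerDl lerD2l mulr_ge0 ?divr_ge0//= mulrCA ler_piMr//.
  by rewrite ler_pdivrMr// mul1r ler_nat.
have hyp m : confined A T t w ->
    path_event X T (mesh (fun=> A) t m) w /\ A (X (T + t)%R w).
  move=> cw; split; last by apply: cw; rewrite lexx lerDl t0.
  by apply/path_event_nseq => k km; apply: cw; apply: grid; exact: leqW.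
have [cw|/existsNP[s /not_implyP[/andP[Ts sT] nA]]] := pselect (confined A T t w).
  by apply: nearW => m; split => // _; exact: hyp.
have notc : ~ confined A T t w by move=> /(_ s); apply/not_implyP; split => //; rewrite Ts.
have [sTt|sTt] := eqVneq s (T + t)%R.
  by apply: nearW => m; split => // -[_]; rewrite -sTt.
have slt : (s < T + t)%R by rewrite lt_neqAle sTt.
have s0 : (0 <= s)%R by exact: le_trans Ts.
have [e e0 he] := right_constant rcX w s0.
have tp : (0 < t)%R by move: (le_lt_trans Ts slt); rewrite ltrDl.
have hc : (t / m.+1%:R)%R @[m --> \oo] --> 0%R.
  rewrite -[X in _ --> X](mulr0 t); apply: cvgM; first exact: cvg_cst.
  exact: cvg_harmonic.
near=> m; split => // -[/path_event_nseq pe AT]; exfalso.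
(* The halves make room for two mesh steps: the grid point found after [s] may have index 0, and
   only indices from 1 on are constrained, so the next one is used. *)
have he2 : (t / m.+1%:R < e / 2)%R.
  by near: m; apply: (cvgr_lt _ hc); rewrite divr_gt0.
have ht2 : (t / m.+1%:R < (T + t - s) / 2)%R.
  by near: m; apply: (cvgr_lt _ hc); rewrite divr_gt0// subr_gt0.
have h0 : (0 < t / m.+1%:R)%R by rewrite divr_gt0.
set h := (t / m.+1%:R)%R in pe he2 ht2 h0.
have sT0 : (0 <= s - T)%R by rewrite subr_ge0.
have [k /andP[k1 k2]] := grid_point sT0 h0.
have kh : (k.+1%:R * h = k%:R * h + h)%R by rewrite -natr1 mulrDl mul1r.
have mh : (m.+1%:R * h = t)%R by rewrite /h mulrCA divff ?mulr1// pnatr_eq0.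
have km : (k.+1 < m.+1)%N.
  by rewrite -(ltr_nat R) -(ltr_pM2r h0) kh mh; lra.
apply: nA; rewrite -(he (T + k.+1%:R * h)%R); first exact: pe.
by rewrite kh; apply/andP; split; lra.
Unshelve. all: by end_near.
Qed.

Lemma measurable_set_at A t : (0 <= t)%R -> measurable [set w | A (X t w)].
Proof.
move=> t0; rewrite (_ : [set _ | _] = \bigcup_(j in A) [set w | X t w = j]).
  by apply: countable_bigcup_measurable => j; exact: mX.
by apply/seteqP; split=> [w Aw|w [j Aj /= ->]//]; exists (X t w).
Qed.

Definition confined_to A T t j : set Omega :=
  confined A T t `&` [set w | X (T + t)%R w = j].

Lemma confined_to_out A T t j : (0 <= t)%R -> ~ A j -> confined_to A T t j = set0.
Proof.
move=> t0 Aj; rewrite -subset0 => w [cw Xj]; apply: Aj; rewrite -Xj.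
by apply: cw; rewrite lexx lerDl t0.
Qed.

Lemma mesh_to_confined A T t j w : (0 <= T)%R -> (0 <= t)%R -> A j ->
  \forall m \near \oo,
    path_event X T (mesh_to (fun=> A) j t m) w <-> confined_to A T t j w.
Proof.
move=> T0 t0 Aj; apply: filterS (mesh_confined A w T0 t0) => m h.
rewrite path_event_mesh_to; split=> [[pe Xj]|[/h[]//]].
by split => //; apply/h; rewrite Xj.
Qed.

Lemma measurable_confined A T t : (0 <= T)%R -> (0 <= t)%R ->
  measurable (confined A T t).
Proof.
move=> T0 t0; apply: (@eventually_cst_measurable _ _ (fun m =>
  path_event X T (mesh (fun=> A) t m) `&` [set w | A (X (T + t)%R w)])).
  move=> m; apply: measurableI; last by apply: measurable_set_at; exact: addr_ge0.
  by apply: measurable_path_event => //; exact: mesh_ge0.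
by move=> w; exact: mesh_confined.
Qed.

Lemma measurable_confined_to A T t j : (0 <= T)%R -> (0 <= t)%R ->
  measurable (confined_to A T t j).
Proof.
move=> T0 t0; apply: measurableI; first exact: measurable_confined.
by apply: mX; exact: addr_ge0.
Qed.

Lemma cvg_mesh_to A t i j : (0 <= t)%R -> A j ->
  P i (path_event X 0 (mesh_to (fun=> A) j t m)) @[m --> \oo] -->
  P i (confined_to A 0 t j).
Proof.
move=> t0 Aj; apply: eventually_cst_cvg => [m|w]; last exact: mesh_to_confined.
by apply: measurable_path_event => //; exact: mesh_to_ge0.
Qed.

Lemma path_weight_fin i r : (forall a, a \in map fst r -> (0 <= a)%R) ->
  path_weight p i r \is a fin_num.
Proof.
move=> r0; rewrite -(path_event_weight mX p_ge0 p_0 fdd i r0).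
by rewrite fin_num_measure//; exact: measurable_path_event.
Qed.

(** The Chapman-Kolmogorov equation of the chain killed on leaving [A]. On two concatenated meshes
    the path weight factors through the state at time [s]; that state ranges over the finite set
    [A], so the sum passes to the limit. *)
Lemma confined_to_chapman A s t i j : finite_set A -> (0 <= s)%R -> (0 <= t)%R ->
  P i (confined_to A 0 (s + t) j) =
  \esum_(k in [set: E]) (P i (confined_to A 0 s k) * P k (confined_to A 0 t j)).
Proof.
move=> finA s0 t0; have [Aj|nAj] := pselect (A j); last first.
  rewrite confined_to_out ?addr_ge0// measure0 esum1// => k _.
  by rewrite (confined_to_out _ t0 nAj) measure0 mule0.
pose r m := (mesh (fun=> A) s m ++ [:: ((s / m.+1%:R)%R, fun=> A)]) ++
  mesh_to (fun=> A) j t m.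
have r0 m a : a \in map fst (r m) -> (0 <= a)%R.
  rewrite !map_cat !mem_cat => /orP[/orP[|]|]; [exact: (mesh_ge0 s0)| |exact: (mesh_to_ge0 t0)].
  by rewrite inE => /eqP->; rewrite divr_ge0.
have mr m : measurable (path_event X 0 (r m)).
  by apply: measurable_path_event => // a; exact: r0.
have rE m : path_event X 0 (r m) =
    path_event X 0 (mesh (fun=> A) s m) `&` [set w | A (X (0 + s)%R w)] `&`
    path_event X s (mesh_to (fun=> A) j t m).
  have e : end_time 0 (mesh (fun=> A) s m ++ [:: ((s / m.+1%:R)%R, fun=> A)]) = s.
    by rewrite /end_time foldl_cat/= -/(end_time _ _) end_time_nseq add0r
      -{2}(mul1r (s / _)%R) -mulrDl natr1 mulrCA divff ?mulr1// pnatr_eq0.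
  rewrite /r path_event_cat e path_event_cat /= setIT; congr (_ `&` _ `&` _).
  move: e; rewrite /end_time foldl_cat/= -/(end_time _ _) => ->.
  by rewrite add0r.
have cL : P i (path_event X 0 (r m)) @[m --> \oo] --> P i (confined_to A 0 (s + t) j).
  apply: eventually_cst_cvg => // w.
  apply: filterS2 (mesh_confined A w (lexx 0%R) s0) (mesh_to_confined w s0 t0 Aj) => m h1 h2.
  rewrite rE /= h1 h2 /confined_to !add0r; split.
    move=> [c1 [c2 Xj]]; split => // u; rewrite /= add0r => /andP[u0 ust].
    have [us|us] := leP u s; first by apply: c1; rewrite add0r u0.
    by apply: c2; rewrite (ltW us).
  move=> [c Xj]; split; last split => //.
    by move=> u /andP[u0 us]; apply: c; rewrite u0 /= add0r (le_trans us)// add0r lerDl.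
  by move=> u /andP[us ust]; apply: c; rewrite (le_trans s0)//= add0r.
have split_ m : P i (path_event X 0 (r m)) =
    \sum_(k \in A) (P i (path_event X 0 (mesh_to (fun=> A) k s m)) *
      P k (path_event X 0 (mesh_to (fun=> A) j t m))).
  transitivity (\esum_(k in A)
      P i (path_event X 0 (mesh_to (fun=> A) k s m ++ mesh_to (fun=> A) j t m))).
    have mk k : measurable (path_event X 0 (mesh_to (fun=> A) k s m ++ mesh_to (fun=> A) j t m)).
      apply: measurable_path_event => // a; rewrite map_cat mem_cat => /orP[].
        exact: (mesh_to_ge0 s0).
      exact: (mesh_to_ge0 t0).
    have kE k w : path_event X 0 (mesh_to (fun=> A) k s m ++ mesh_to (fun=> A) j t m) w <->
        [/\ path_event X 0 (mesh (fun=> A) s m) w, X s w = k &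
          path_event X s (mesh_to (fun=> A) j t m) w].
      rewrite path_event_cat end_time_mesh_to add0r; split=> [[]|[h1 h2 h3]].
        by move=> /path_event_mesh_to[h1]; rewrite add0r.
      by split => //; apply/path_event_mesh_to; rewrite add0r.
    rewrite -(@measure_countable_bigcup _ _ _ _ (P i))//; last first.
      by move=> k1 k2 _ _ [w [/kE[_ <- _] /kE[_ <- _]]].
    congr (P i _); rewrite rE; apply/seteqP; split=> w.
      by move=> [[h1 h2] h3]; exists (X s w); [rewrite add0r in h2|apply/kE].
    move=> [k Ak /kE[h1 h2 h3]]; split => //; split => //=.
    by rewrite add0r h2.
  rewrite esum_fset//; apply: eq_fsbigr => k _.
  have w0 a : a \in map fst (mesh_to (fun=> A) k s m ++ mesh_to (fun=> A) j t m) -> (0 <= a)%R.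
    by rewrite map_cat mem_cat => /orP[]; [exact: (mesh_to_ge0 s0)|exact: (mesh_to_ge0 t0)].
  rewrite !(path_event_weight mX p_ge0 p_0 fdd)//; try exact: mesh_to_ge0.
  apply: (path_weight_through p_ge0).
  - by rewrite divr_ge0.
  - exact: mesh_ge0.
  - exact: mesh_to_ge0.
  - by apply: path_weight_fin; exact: mesh_to_ge0.
have cR : P i (path_event X 0 (r m)) @[m --> \oo] -->
    \sum_(k \in A) (P i (confined_to A 0 s k) * P k (confined_to A 0 t j)).
  have e (v : E -> \bar R) :
      \sum_(k \in A) v k =
      \sum_(k <- finmap.enum_fset (fset_set A) | k \in A) v k.
    rewrite fsbig_finite//= [LHS]big_seq [RHS]big_seq_cond.
    apply: eq_bigl => k; apply/idP/andP => [kA|[]//]; split => //.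
    by rewrite -in_fset_set.
  rewrite e (eq_cvg _ _ (fun m => etrans (split_ m) (e _))).
  apply: cvg_nnesum => k; first by move=> _; apply: nearW => m; exact: mule_ge0.
  rewrite inE => Ak; apply: cvgeM; [|exact: cvg_mesh_to|exact: cvg_mesh_to].
  by rewrite mule_def_fin// fin_num_measure//; exact: measurable_confined_to.
apply: etrans (cvg_unique (@ereal_hausdorff R) cL cR) _.
rewrite -esum_fset//; last by move=> k _; exact: mule_ge0.
rewrite esum_mkcond [RHS]esum_mkcond; apply: eq_esum => k _.
case: ifPn => kA; first by rewrite mem_set.
by rewrite mem_set// confined_to_out// ?measure0 ?mul0e// => Ak; rewrite mem_set in kA.
Qed.

Definition finite_part n : set E := [set j | (pickle j < n)%N].

Lemma finite_part_finite n : finite_set (finite_part n).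
Proof.
apply: (@sub_finite_set _ _ (pickle @^-1` `I_n)) => //.
apply: finite_preimage; last exact: finite_II.
by move=> x y _ _; exact: (pcan_inj pickleK).
Qed.

(* The probability that the chain is in [j] at time [t] and has visited only
   finitely many states before. *)
Definition tame_to T t j : set Omega := \bigcup_n confined_to (finite_part n) T t j.

Definition tame_prob t i j : R := fine (P i (tame_to 0 t j)).

Lemma finite_part_mono n m : (n <= m)%N -> finite_part n `<=` finite_part m.
Proof. by move=> nm j /= /leq_trans; apply. Qed.

Lemma tame_near T t j w :
  \forall n \near \oo, confined_to (finite_part n) T t j w <-> tame_to T t j w.
Proof.
have [[N _ [cN XN]]|no] := pselect (tame_to T t j w).
  exists N => // n Nn; split => _; first by exists N.
  by split => // s sT; apply: finite_part_mono Nn _ _; exact: cN.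
by apply: nearW => n; split => // c; exfalso; apply: no; exists n.
Qed.

Lemma measurable_tame t j : (0 <= t)%R -> measurable (tame_to 0 t j).
Proof.
by move=> t0; apply: bigcupT_measurable => n; exact: measurable_confined_to.
Qed.

Lemma tame_probE t i j : (0 <= t)%R -> (tame_prob t i j)%:E = P i (tame_to 0 t j).
Proof. by move=> t0; rewrite fineK// fin_num_measure//; exact: measurable_tame. Qed.

Lemma cvg_tame t i j : (0 <= t)%R ->
  P i (confined_to (finite_part n) 0 t j) @[n --> \oo] --> P i (tame_to 0 t j).
Proof.
move=> t0; apply: eventually_cst_cvg => [n|w]; last exact: tame_near.
exact: measurable_confined_to.
Qed.

Lemma le_tame A t i j : finite_set A -> (0 <= t)%R ->
  P i (confined_to A 0 t j) <= (tame_prob t i j)%:E.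
Proof.
move=> /finite_seqP[s As] t0; rewrite tame_probE//; apply: le_measure; rewrite ?inE.
- exact: measurable_confined_to.
- exact: measurable_tame.
move=> w [cw Xj]; exists (\max_(x <- s) (pickle x).+1)%N => //; split => // u /cw.
rewrite As /= => xs; rewrite /finite_part /=.
exact: (@leq_bigmax_seq _ _ xpredT (fun x => (pickle x).+1) (X u w) xs).
Qed.

(** Each finite part satisfies the equation. One inequality bounds its summands by the limiting
    ones, the other is Fatou's lemma for the sum over the intermediate state. *)
Lemma tame_chapman s t i j : (0 <= s)%R -> (0 <= t)%R ->
  (tame_prob (s + t) i j)%:E =
  \esum_(k in [set: E]) (tame_prob s i k * tame_prob t k j)%:E.
Proof.
move=> s0 t0; have st0 := addr_ge0 s0 t0; rewrite tame_probE//.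
have E0 k : (tame_prob s i k * tame_prob t k j)%:E =
    P i (tame_to 0 s k) * P k (tame_to 0 t j).
  by rewrite EFinM !tame_probE.
rewrite (eq_esum (fun k _ => E0 k)).
have le n k : P i (confined_to (finite_part n) 0 s k) *
    P k (confined_to (finite_part n) 0 t j) <= P i (tame_to 0 s k) * P k (tame_to 0 t j).
  apply: lee_pmul => //.
    by rewrite -tame_probE// le_tame//; exact: finite_part_finite.
  by rewrite -tame_probE// le_tame//; exact: finite_part_finite.
have CK n := confined_to_chapman i j (@finite_part_finite n) s0 t0.
apply/eqP; rewrite eq_le; apply/andP; split.
  apply: (cvge_to_le (@cvg_tame _ i j st0)); apply: nearW => n.
  by rewrite CK; apply: le_esum => k _; exact: le.
rewrite leNgt; apply/negP; rewrite -[P i _]fineK; last first.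
  by rewrite fin_num_measure//; exact: measurable_tame.
pose a n k := P i (confined_to (finite_part n) 0 s k) *
    P k (confined_to (finite_part n) 0 t j).
move=> /(@esum_fatou _ _ setT a) [||N _ /(_ N (leqnn N))].
- by move=> n k; exact: mule_ge0.
- move=> k; apply: cvgeM; [|exact: cvg_tame|exact: cvg_tame].
  by rewrite mule_def_fin// fin_num_measure//; exact: measurable_tame.
rewrite /a -CK ltNge => /negP; apply.
exact: le_tame (@finite_part_finite N) st0.
Qed.

Lemma tame_prob_le t i j : (0 <= t)%R -> (tame_prob t i j <= p t i j)%R.
Proof.
move=> t0; rewrite -lee_fin tame_probE//.
have := @fdd i [:: (t, j)]; rewrite /= setIT mulr1 => <-; last first.
  by move=> a; rewrite inE => /eqP->.
apply: le_measure; rewrite ?inE; [exact: measurable_tame|by apply: mX; rewrite add0r|].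
by move=> w [n _ []].
Qed.

Let p_le1 t i j : (0 <= t)%R -> (p t i j <= 1)%R.
Proof.
move=> t0; rewrite -lee_fin -(p_honest i t0).
by apply: (@esum_lb _ _ setT (fun j => (p t i j)%:E)) => // k; rewrite lee_fin p_ge0.
Qed.

Let bernoulli (a : R) n : (0 <= a <= 1)%R -> (1 - n%:R * (1 - a) <= a ^+ n)%R.
Proof.
move=> /andP[a0 a1]; elim: n => [|n IH]; first by rewrite mul0r subr0.
rewrite exprS; apply: (@le_trans _ _ (a * (1 - n%:R * (1 - a)))%R); last first.
  by rewrite ler_wpM2l.
rewrite -natr1 -subr_ge0.
have -> : (a * (1 - n%:R * (1 - a)) - (1 - (n%:R + 1) * (1 - a)) =
  n%:R * ((1 - a) * (1 - a)))%R by ring.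
by rewrite mulr_ge0// mulr_ge0// subr_ge0.
Qed.

Let weight_stay h i m :
  (0 <= h)%R ->
  path_weight p i (rcons (nseq m (h, fun=> [set i])) (h, fun=> [set i])) =
  (p h i i ^+ m.+1)%:E.
Proof.
move=> h0; elim: m => [|m IH] /=; rewrite esum_set1 ?mule1//.
- by rewrite lee_fin p_ge0.
- by rewrite IH -EFinM -exprS.
- by rewrite IH -EFinM lee_fin mulr_ge0 ?exprn_ge0 ?p_ge0.
Qed.

(** Started at [i], such a path waits there, switches to [j] at most once and then remains at
    [j]. *)
Let switch i j (k : E) : set E := if k == i then [set i] `|` [set j] else [set j].

(** The switch can take place at any of the [m.+1] steps, and each choice contributes at least one
    factor [p h i j] and [m] factors [p h i i * p h j j]. *)
Let weight_switch h i j m : i != j -> (0 <= h)%R ->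
  (m.+1%:R * p h i j * (p h i i * p h j j) ^+ m)%:E <=
  path_weight p i (rcons (nseq m (h, switch i j)) (h, fun=> [set j])).
Proof.
move=> ij h0; have pij := p_ge0 i j h0; have pii := p_ge0 i i h0; have pjj := p_ge0 j j h0.
have stay n : path_weight p j (rcons (nseq n (h, switch i j)) (h, fun=> [set j])) =
    (p h j j ^+ n.+1)%:E.
  rewrite -weight_stay//; elim: n => //= n IH.
  by rewrite {1}/switch eq_sym (negbTE ij) !esum_set1 ?IH// mule_ge0 ?lee_fin// path_weight_ge0//
    => a; rewrite map_rcons map_nseq mem_rcons in_cons => /orP[/eqP->//|/nseqP[->]].
have w0 n k : 0 <= path_weight p k (rcons (nseq n (h, switch i j)) (h, fun=> [set j])).
  by apply: path_weight_ge0 => // a; rewrite map_rcons map_nseq mem_rcons in_cons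
    => /orP[/eqP->//|/nseqP[->]].
elim: m => [|m IH] /=; first by rewrite esum_set1 ?mule1 ?lee_fin// expr0 mulr1 mul1r.
rewrite {1}/switch eqxx esum_setU1//; last 2 first.
- by move=> /eqP; rewrite eq_sym (negbTE ij).
- by move=> k; apply: mule_ge0 => //; rewrite lee_fin p_ge0.
rewrite esum_set1 ?mule_ge0// stay.
apply: (@le_trans _ _ ((p h i j * p h j j ^+ m.+1)%:E +
  (p h i i)%:E * (m.+1%:R * p h i j * (p h i i * p h j j) ^+ m)%:E)); last first.
  by rewrite EFinM leeD2l// lee_wpmul2l// lee_fin.
rewrite -EFinM -EFinD lee_fin !exprMn.
set a := p h i i; set b := p h j j; set c := p h i j.
have a1 : (a <= 1)%R by exact: p_le1. have b1 : (b <= 1)%R by exact: p_le1.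
have e1 : (a ^+ m.+1 * b ^+ m.+1 <= b ^+ m.+1)%R.
  by rewrite ler_piMl ?exprn_ge0// exprn_ile1.
have e2 : (a * (a ^+ m * b ^+ m) >= a ^+ m.+1 * b ^+ m.+1)%R.
  rewrite mulrA -exprS ler_wpM2l ?exprn_ge0// exprS ler_piMl// exprn_ge0//.
rewrite -[m.+2%:R]natr1.
rewrite (_ : (m.+1%:R + 1) * c * _ = c * (a ^+ m.+1 * b ^+ m.+1) +
   m.+1%:R * c * (a ^+ m.+1 * b ^+ m.+1))%R; last by ring.
rewrite lerD//; first by rewrite ler_wpM2l.
by rewrite [leRHS]mulrCA ler_wpM2l// mulr_ge0.
Qed.

Let slope t i j : (0 < t)%R ->
  ((p (t / m.+1%:R) i j - (i == j)%:R) / (t / m.+1%:R))%R @[m --> \oo] --> Q i j.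
Proof.
move=> t0; have /cvg_at_rightP := @p_deriv i j; apply; split.
  by move=> n; rewrite divr_gt0.
rewrite -[X in _ --> X](mulr0 t); apply: cvgM; first exact: cvg_cst.
exact: cvg_harmonic.
Qed.

(** The chain confined to [i] is bounded below by Bernoulli's inequality on each mesh, and the mesh
    is then refined. *)
Lemma tame_diag_ge t i : (0 < t)%R -> (1 + Q i i * t <= tame_prob t i i)%R.
Proof.
move=> t0; have t0' := ltW t0.
rewrite -lee_fin; apply: le_trans (le_tame i i (finite_set1 i) t0').
have h1 : (1 + ((p (t / m.+1%:R) i i - (i == i)%:R) / (t / m.+1%:R)) * t)%:E @[m --> \oo]
    --> (1 + Q i i * t)%:E.
  apply: cvg_EFin; first exact: nearW.
  by apply: cvgD; [exact: cvg_cst|apply: cvgM; [exact: slope|exact: cvg_cst]].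
apply: (lee_cvg_to h1 (@cvg_mesh_to [set i] t i i t0' erefl)); apply: nearW => m.
have h0 : (0 <= t / m.+1%:R)%R by rewrite divr_ge0.
rewrite (path_event_weight mX p_ge0 p_0 fdd); last by move=> a; exact: mesh_to_ge0.
rewrite weight_stay// lee_fin eqxx; apply: le_trans (bernoulli _ _); last by rewrite p_ge0 ?p_le1.
rewrite le_eqVlt; apply/orP; left; apply/eqP; rewrite /=; field.
by rewrite nat1r pnatr_eq0 (gt_eqF t0).
Qed.

(** The paths confined to [i] and [j] with a single switch suffice to first order in [t].
    Bernoulli's inequality is used with [1 - a * b <= (1 - a) + (1 - b)]. *)
Lemma tame_offdiag_ge t i j : i != j -> (0 < t)%R ->
  (Q i j * t * (1 + Q i i * t + Q j j * t) <= tame_prob t i j)%R.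
Proof.
move=> ij t0; have t0' := ltW t0.
have fin2 : finite_set [set i; j] by exact: finite_set2.
rewrite -lee_fin; apply: le_trans (le_tame i j fin2 t0').
pose sl k l m := ((p (t / m.+1%:R) k l - (k == l)%:R) / (t / m.+1%:R))%R.
have h1 : (sl i j m * t * (1 + sl i i m * t + sl j j m * t))%:E @[m --> \oo]
    --> (Q i j * t * (1 + Q i i * t + Q j j * t))%:E.
  apply: cvg_EFin; first exact: nearW.
  apply: cvgM; first by apply: cvgM; [exact: slope|exact: cvg_cst].
  apply: cvgD; last by apply: cvgM; [exact: slope|exact: cvg_cst].
  by apply: cvgD; [exact: cvg_cst|apply: cvgM; [exact: slope|exact: cvg_cst]].
have Aj : [set i; j] j by right.
apply: (lee_cvg_to h1 (@cvg_mesh_to _ t i j t0' Aj)); apply: nearW => m.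
have h0 : (0 <= t / m.+1%:R)%R by rewrite divr_ge0.
apply: (@le_trans _ _ (P i (path_event X 0 (mesh_to (switch i j) j t m)))); last first.
  apply: le_measure; rewrite ?inE; try by apply: measurable_path_event => // a; exact: mesh_to_ge0.
  move=> w /path_event_mesh_to[/path_event_nseq pe Xj]; apply/path_event_mesh_to; split => //.
  apply/path_event_nseq => k km; have := pe k km; rewrite /switch.
  by case: ifP => // _ ->; right.
rewrite (path_event_weight mX p_ge0 p_0 fdd); last by move=> a; exact: mesh_to_ge0.
apply: le_trans (weight_switch _ ij h0); rewrite lee_fin.
set h := (t / m.+1%:R)%R in h0 *; set a := p h i i; set b := p h j j; set c := p h i j.
have a0 : (0 <= a)%R by exact: p_ge0. have b0 : (0 <= b)%R by exact: p_ge0.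
have c0 : (0 <= c)%R by exact: p_ge0.
have a1 : (a <= 1)%R by exact: p_le1. have b1 : (b <= 1)%R by exact: p_le1.
have ab1 : (0 <= a * b <= 1)%R by rewrite mulr_ge0//= mulr_ile1.
rewrite (_ : (sl i j m * t = m.+1%:R * c)%R); last first.
  by rewrite /sl -/h (negbTE ij) -/c /= /h subr0; field; rewrite nat1r pnatr_eq0 (gt_eqF t0).
rewrite (_ : (1 + sl i i m * t + sl j j m * t =
    1 - m.+1%:R * ((1 - a) + (1 - b)))%R); last first.
  by rewrite /sl -/h !eqxx -/a -/b /h /=; field; rewrite nat1r pnatr_eq0 (gt_eqF t0).
rewrite ler_wpM2l ?mulr_ge0//; apply: le_trans (bernoulli m ab1).
rewrite lerD2l lerN2 ler_pM//.
- by rewrite subr_ge0; case/andP: ab1.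
- by rewrite ler_nat.
rewrite -subr_ge0 (_ : _ - _ = (1 - a) * (1 - b))%R; last by ring.
by rewrite mulr_ge0// subr_ge0.
Qed.

Lemma tame_prob_sum t i : (0 <= t)%R ->
  \esum_(j in [set: E]) (tame_prob t i j)%:E = P i (\bigcup_n confined (finite_part n) 0 t).
Proof.
move=> t0; transitivity (\esum_(j in [set: E]) P i (tame_to 0 t j)).
  by apply: eq_esum => j _; exact: tame_probE.
rewrite -(@measure_countable_bigcup _ _ _ _ (P i))//.
- congr (P i _); apply/seteqP; split=> w.
    by move=> [j _ [n _ []]]; exists n.
  by move=> [n _ cw]; exists (X (0 + t)%R w) => //; exists n.
- by move=> j; exact: measurable_tame.
- by move=> j1 j2 _ _ [w [[n _ [_ <-]] [m _ [_ <-]]]].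
Qed.

Lemma measurable_finitely_confined t : (0 <= t)%R ->
  measurable (\bigcup_n confined (finite_part n) 0 t).
Proof. by move=> t0; apply: bigcupT_measurable => n; exact: measurable_confined. Qed.

Lemma tame_transition_function : transition_function tame_prob.
Proof.
split.
- by move=> t i j _; exact: fine_ge0.
- move=> t i t0; rewrite tame_prob_sum//; apply: probability_le1.
  exact: measurable_finitely_confined.
- move=> i j; apply: EFin_inj; rewrite tame_probE//.
  have -> : tame_to 0 0 j = [set w | X 0%R w = j].
    apply/seteqP; split=> w; first by move=> [n _ [_]]; rewrite /= addr0.
    move=> Xj; exists (pickle j).+1 => //; split; last by rewrite /= addr0.
    move=> s; rewrite addr0 => s0; have -> : s = 0%R by apply/eqP; rewrite eq_le andbC.
    by rewrite Xj /finite_part /=.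
  have [<-|ij] := eqVneq i j; first exact: (initial_state p_0 fdd).
  have mi : measurable [set w | X 0%R w = i] by exact: mX.
  transitivity (0 : \bar R); last by [].
  apply/eqP; rewrite eq_le measure_ge0 andbT.
  have <- : P i (~` [set w | X 0%R w = i]) = 0.
    by rewrite probability_setC// (initial_state p_0 fdd) subee.
  apply: le_measure; rewrite ?inE; [exact: mX|exact: measurableC|].
  by move=> w /= -> /eqP; rewrite eq_sym (negbTE ij).
- by move=> s t i j s0 t0; rewrite tame_chapman.
Qed.

(** The difference quotients at 0 are squeezed between the explicit lower bounds and those of [p],
    both of which tend to [Q i j]. *)
Lemma tame_Qfunction : Qfunction Q tame_prob.
Proof.
split; first exact: tame_transition_function.
move=> i j.
have cid : t @[t --> (0%R : R)^'+] --> (0%R : R) by exact: cvg_at_right_filter.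
pose lo t := if i == j then Q i j else (Q i j * (1 + Q i i * t + Q j j * t))%R.
have clo : lo t @[t --> (0%R : R)^'+] --> Q i j.
  rewrite /lo; case: (i == j); first exact: cvg_cst.
  have h : (Q i j * (1 + Q i i * t + Q j j * t))%R @[t --> (0%R : R)^'+] -->
      (Q i j * (1 + Q i i * 0 + Q j j * 0))%R.
    apply: cvgM; first exact: cvg_cst.
    apply: cvgD; last by apply: cvgM => //; exact: cvg_cst.
    apply: cvgD; first exact: cvg_cst.
    by apply: cvgM => //; exact: cvg_cst.
  by rewrite !mulr0 !addr0 mulr1 in h.
apply: (squeeze_cvgr _ clo (@p_deriv i j)).
near=> t; have t0 : (0 < t)%R by near: t; exact: nbhs_right_gt.
have t0' := ltW t0.
rewrite ler_pM2r ?invr_gt0// lerD2r tame_prob_le// andbT.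
rewrite ler_pdivlMr// /lo; case: eqVneq => [<-|ij].
  by rewrite lerBrDl tame_diag_ge.
by rewrite subr0 mulrAC tame_offdiag_ge.
Unshelve. all: by end_near.
Qed.

Lemma nonexplosion t i : regular Q -> (0 <= t)%R ->
  P i (\bigcup_n confined (finite_part n) 0 t) = 1.
Proof.
move=> [q [_ q_honest q_unique]] t0; rewrite -tame_prob_sum// -(q_honest t i t0).
by apply: eq_esum => j _; rewrite (q_unique _ tame_Qfunction).
Qed.

End Confinement.

(** * Return moments *)

Section DampedLimits.
Context {R : realType}.
Implicit Types (x : \bar R) (k n : nat).

(** Halving the rate makes monotonicity algebraic: with [z] the damping factor at the halved rate,
    [2 * (1 - z) - (1 - z ^+ 2)] is the square of [1 - z]. *)
Definition vanishing n : R := (2^-1 ^+ n)%R.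

Lemma vanishing_gt0 n : (0 < vanishing n)%R.
Proof. by rewrite exprn_gt0// invr_gt0. Qed.

Lemma cvg_vanishing : vanishing @ \oo --> 0%R.
Proof. by apply: cvg_expr; rewrite gtr0_norm ?invr_gt0// invf_lt1// ltr1n. Qed.

Lemma damped_power_le lam k x : (0 < lam)%R -> 0 <= x ->
  (damped_power lam k x)%:E <= x ^+ k.
Proof.
move=> l0; case: x => [s| |//] x0; last first.
  case: k => [|k]; first by rewrite /damped_power expr0 expe0.
  by rewrite expeS gt0_mulye ?leey// expe_gt0.
rewrite -EFin_expe lee_fin lerXn2r ?nnegrE//.
  by have /andP[] := damped_base_itv l0 x0.
have := damped_increment_itv l0 x0 => /andP[_].
by [].
Qed.

Lemma damped_power_homo k x n m : 0 <= x -> (n <= m)%N ->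
  (damped_power (vanishing n) k x <= damped_power (vanishing m) k x)%R.
Proof.
move=> x0; elim: m => [|m IH]; first by rewrite leqn0 => /eqP->.
rewrite leq_eqVlt ltnS => /predU1P[->//|/IH h]; apply: le_trans h _.
have b n' := @damped_base_itv _ _ x (vanishing_gt0 n') x0.
rewrite /damped_power lerXn2r ?nnegrE//; [by case/andP: (b m)|by case/andP: (b m.+1)|].
have l0 := vanishing_gt0 m.
have -> : vanishing m.+1 = (vanishing m / 2)%R by rewrite /vanishing exprSr.
rewrite ler_pdivrMr// [leRHS](_ : _ = 2 * (1 - damping (vanishing m / 2) x))%R; last first.
  by field; rewrite gt_eqF.
case: x x0 {IH b} => [s| |//] x0 /=; last by rewrite !subr0 mulr1 ler1n.
have -> : expR (- (vanishing m * s)) = (expR (- (vanishing m / 2 * s)) ^+ 2)%R.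
  by rewrite -expRM_natl; congr expR; field.
set z := expR _; rewrite -subr_ge0.
by rewrite (_ : _ - _ = (1 - z) ^+ 2)%R ?sqr_ge0//; ring.
Qed.

Lemma cvg_damped_power_vanishing k x : 0 <= x ->
  (damped_power (vanishing n) k x)%:E @[n --> \oo] --> x ^+ k.
Proof.
case: x => [s| |//] x0.
  rewrite -EFin_expe; apply: cvg_EFin; first exact: nearW.
  apply: cvg_exprn.
  apply: (@squeeze_cvgr _ _ _ _ (fun n => expR (- (vanishing n * s)) * s)%R (fun=> s)).
  - by apply: nearW => n; exact: damped_increment_itv (vanishing_gt0 n) x0.
  - rewrite -[X in _ --> X]mul1r -expR0; apply: cvgM; last exact: cvg_cst.
    apply: (@continuous_cvg _ _ _ _ _ _ (@expR R)); first exact: continuous_expR.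
    rewrite -oppr0 -[X in (- X)%R](mul0r s); apply: cvgN; apply: cvgM; last exact: cvg_cst.
    exact: cvg_vanishing.
  - exact: cvg_cst.
case: k => [|k].
  rewrite expe0; apply: cvg_near_cst; apply: nearW => n.
  by rewrite /damped_power expr0.
have -> : (+oo : \bar R) ^+ k.+1 = +oo by rewrite expeS gt0_mulye// expe_gt0.
apply/cvgeyPge => A; near=> n.
(* At [+oo] the damped power is the power [k.+1] of [2 ^+ n], which is at least [n]. *)
rewrite lee_fin /damped_power /= subr0 mul1r /vanishing exprVn invrK.
have h1 : (A <= n%:R)%R by near: n; exact: nbhs_infty_ger.
apply: (le_trans h1); rewrite -exprM -natrX ler_nat.
by rewrite (leq_trans (ltnW (ltn_expl n (ltnSn 1))))// leq_exp2l// leq_pmulr.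
Unshelve. all: by end_near.
Qed.

End DampedLimits.

(** * Step relations for damped and plain return moments, and exit from finite parts *)

Section ReturnMoments.
Context {R : realType} {E : countType} {Q : E -> E -> R} {d : measure_display}
  {Omega : measurableType d} {P : E -> probability Omega R}
  {X : R -> Omega -> E} {p : R -> E -> E -> R}.
Context (mX : forall (t : R) j, (0 <= t)%R -> measurable [set w | X t w = j])
  (rcX : forall w (t : R), (0 <= t)%R -> \forall s \near t^'+, X s w = X t w)
  (p_ge0 : forall (t : R) i j, (0 <= t)%R -> (0 <= p t i j)%R)
  (p_0 : forall i, p 0%R i i = 1%R)
  (p_honest : honest p)
  (p_deriv : forall i j,
    ((p t i j - (i == j)%:R) / t)%R @[t --> (0%R : R)^'+] --> Q i j)
  (fdd : forall i (s : seq (R * E)), (forall a, a \in s -> (0 <= a.1)%R) ->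
    P i (sample_event X 0%R s) = (sample_weight p i s)%:E)
  (Q_ge0 : forall i j, i != j -> (0 <= Q i j)%R)
  (Q_sum : forall i, \esum_(j in [set j | j != i]) (Q i j)%:E = (rate Q i)%:E)
  (Q_regular : regular Q)
  (rate_gt0 : forall i, (0 < rate Q i)%R).
Implicit Types (H : set E) (lam : R) (k n : nat).

Definition damped_moment H lam k i : R :=
  (\int[P i]_w damped_power lam k (return_time X H w))%R.

Lemma embedding_ge0 i j : (0 <= embedding Q i j)%R.
Proof.
rewrite /embedding; case: eqVneq => // ji.
by rewrite divr_ge0 ?(ltW (rate_gt0 i))// Q_ge0// eq_sym.
Qed.

Lemma embedding_sum i : \esum_(j in [set: E]) (embedding Q i j)%:E = 1.
Proof.
transitivity (\esum_(j in [set j | j != i]) ((Q i j)%:E * ((rate Q i)^-1)%:E)).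
  rewrite [RHS]esum_mkcond; apply: eq_esum => j _; rewrite /embedding.
  by case: eqVneq => [->|ji]; [rewrite memNset//= eqxx|rewrite mem_set].
transitivity (\esum_(j in [set j | j != i]) (`|Q i j|%:E * ((rate Q i)^-1)%:E)).
  by apply: eq_esum => j ji; rewrite ger0_norm// Q_ge0// eq_sym.
rewrite esumZr ?invr_ge0 ?(ltW (rate_gt0 i))//.
rewrite (_ : esum _ _ = (rate Q i)%:E) -?EFinM ?mulfV ?gt_eqF//.
by rewrite -Q_sum; apply: eq_esum => j ji; rewrite ger0_norm// Q_ge0// eq_sym.
Qed.

(** The hypotheses on test functions, checked for a damped power; [ge] is its derivative. *)
Lemma damped_setup lam k : (0 < lam)%R ->
  let f s := damped_power lam k.+1 s%:E in
  let ge x := (k.+1%:R * damped_power lam k x * damping lam x)%R in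
  [/\ f 0%R = 0%R,
   forall s t : R, (0 <= s)%R -> (s <= t)%R -> (f s <= f t)%R,
   forall s : R, (0 <= s)%R -> (f s <= lam^-1 ^+ k.+1)%R,
   forall s t : R, (0 <= s)%R -> (0 <= t)%R ->
     (f (s + t) - f s <= k.+1%:R * lam^-1 ^+ k * t)%R &
   [/\ forall (v : nat -> R) (s : R), (forall n, 0 <= v n)%R -> v @ \oo --> s ->
     f (v n) @[n --> \oo] --> damped_power lam k.+1 s%:E,
   f n.+1%:R @[n --> \oo] --> damped_power lam k.+1 +oo,
   forall (v : nat -> R) (s : R), (forall n, 0 <= v n)%R -> v @ \oo --> s ->
     ((f (v n + n.+1%:R^-1) - f (v n)) / n.+1%:R^-1)%R @[n --> \oo] --> ge s%:E &
   ge +oo = 0%R]].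
Proof.
move=> l0 f ge; split.
- by rewrite /f /damped_power /= mulr0 oppr0 expR0 subrr mul0r expr0n.
- by move=> s t; exact: damped_power_mono.
- move=> s s0; have s0' : 0 <= s%:E by [].
  by have /andP[_ h] := damped_power_itv k.+1 l0 s0'.
- by move=> s t; exact: damped_power_lip.
split.
- by move=> v s _; exact: cvg_damped_power.
- apply: cvg_exprn; apply: cvgM; last exact: cvg_cst.
  by apply: cvgB; [exact: cvg_cst|exact: cvg_damping_pinfty].
- by move=> v s; exact: cvg_damped_slope.
- by rewrite /ge /= mulr0.
Qed.

Lemma measurable_damped_power H lam k : (0 < lam)%R ->
  measurable_fun setT (fun w => damped_power lam k (return_time X H w)).
Proof.
move=> l0; case: k => [|k]; first by rewrite (_ : (fun w => _) = cst 1%R).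
have [f0 fm fC fL [fc fi gc gi]] := damped_setup k l0.
by have [] := @measurable_test_return _ _ _ _ _ mX rcX H
  (fun s => damped_power lam k.+1 s%:E) (damped_power lam k.+1)
  (fun x => k.+1%:R * damped_power lam k x * damping lam x)%R f0 fc fi gc gi.
Qed.

Lemma damped_moment_itv H lam k i : (0 < lam)%R ->
  (0 <= damped_moment H lam k i <= lam^-1 ^+ k)%R.
Proof.
move=> l0; apply: Rintegral_itv; first exact: measurable_damped_power.
by move=> w; apply: damped_power_itv => //; exact: return_time_ge0.
Qed.

Lemma integrable_damped_power H lam k i : (0 < lam)%R ->
  (P i).-integrable setT (EFin \o (fun w => damped_power lam k (return_time X H w))).
Proof.
move=> l0; apply: (@bounded_integrable _ _ _ (P i) _ (lam^-1 ^+ k)%R).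
  exact: measurable_damped_power.
move=> w; have /andP[h1 h2] := damped_power_itv k l0 (@return_time_ge0 _ _ _ _ X H w).
by rewrite ger0_norm.
Qed.

Lemma damped_moment0 H lam i : damped_moment H lam 0 i = 1%R.
Proof.
rewrite /damped_moment /damped_power; under eq_Rintegral do rewrite expr0.
exact: Rintegral_prob_cst.
Qed.

(** The damping factor is 1 minus [lam] times the damped time, so the derivative of a damped power
    is a combination of damped powers of orders [k] and [k.+1]. The latter accounts for the extra
    factor on the left. *)
Lemma damped_moment_step H lam k i : (0 < lam)%R ->
  ((1 + k.+1%:R / rate Q i * lam) * damped_moment H lam k.+1 i)%:E =
  \esum_(j in ~` H) (embedding Q i j * damped_moment H lam k.+1 j)%:E +
    (k.+1%:R / rate Q i * damped_moment H lam k i)%:E.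
Proof.
move=> l0.
have [f0 fm fC fL [fc fi gc gi]] := damped_setup k l0.
have := @first_step _ _ Q _ _ P X p mX rcX p_ge0 p_0 p_honest p_deriv fdd Q_ge0 Q_sum H
  (fun s => damped_power lam k.+1 s%:E) (damped_power lam k.+1)
  (fun x => k.+1%:R * damped_power lam k x * damping lam x)%R _ _
  f0 fm fC fL fc fi gc gi i (rate_gt0 i).
rewrite -[X in X = _]/((damped_moment H lam k.+1 i)%:E).
rewrite -[X in _ = X + _]/(\esum_(j in ~` H) (embedding Q i j * damped_moment H lam k.+1 j)%:E).
have -> : (\int[P i]_w (k.+1%:R * damped_power lam k (return_time X H w) *
      damping lam (return_time X H w)) =
    k.+1%:R * (damped_moment H lam k i - lam * damped_moment H lam k.+1 i))%R.
  rewrite -RintegralZl//; last exact: integrable_damped_power.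
  rewrite -RintegralB//; last 2 first.
  - exact: integrable_damped_power.
  - rewrite (_ : EFin \o _ = fun w => lam%:E * (damped_power lam k.+1 (return_time X H w))%:E)//.
    by apply: integrableZl => //; exact: integrable_damped_power.
  rewrite -RintegralZl//; last first.
    rewrite (_ : EFin \o _ = (fun w => (damped_power lam k (return_time X H w))%:E) \-
      (fun w => lam%:E * (damped_power lam k.+1 (return_time X H w))%:E))//.
    apply: integrableB => //; first exact: integrable_damped_power.
    by apply: integrableZl => //; exact: integrable_damped_power.
  apply: eq_Rintegral => w _; rewrite -mulrA; congr (_ * _)%R.
  by rewrite /damped_power exprS; field; rewrite gt_eqF.
move=> h; rewrite mulrDl mul1r EFinD h -addeA; congr (_ + _).
by rewrite -EFinD; congr (_%:E); field; rewrite (gt_eqF (rate_gt0 i)).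
Qed.

Lemma damped_momentE H lam k i : (0 < lam)%R -> (damped_moment H lam k i)%:E =
  \int[P i]_w (damped_power lam k (return_time X H w))%:E.
Proof.
move=> l0; rewrite fineK//; apply: integrable_fin_num => //.
exact: integrable_damped_power.
Qed.

(** Monotone convergence, the damped powers increasing along [vanishing]. *)
Lemma cvg_damped_moment H k i :
  (damped_moment H (vanishing n) k i)%:E @[n --> \oo] --> return_moment P X H k i.
Proof.
under eq_fun do rewrite damped_momentE ?vanishing_gt0//.
rewrite /return_moment.
rewrite (_ : (fun w => return_time X H w ^+ k) = (fun w =>
    limn (fun n => (damped_power (vanishing n) k (return_time X H w))%:E))).
  apply: (@cvg_monotone_convergence _ _ _ (P i) setT measurableT
    (fun n w => (damped_power (vanishing n) k (return_time X H w))%:E)).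
  - by move=> n; apply/measurable_EFinP; apply: measurable_damped_power; exact: vanishing_gt0.
  - move=> n w _; rewrite lee_fin.
    by case/andP: (damped_power_itv k (vanishing_gt0 n) (@return_time_ge0 _ _ _ _ X H w)).
  - move=> w _ n m nm; rewrite lee_fin; apply: damped_power_homo => //.
    exact: return_time_ge0.
apply/funext => w; apply/esym/cvg_lim => //.
by apply: cvg_damped_power_vanishing; exact: return_time_ge0.
Qed.

Lemma measurable_return_power H k :
  measurable_fun setT (fun w => return_time X H w ^+ k).
Proof.
apply: (@emeasurable_fun_cvg _ _ _ setT
  (fun n w => (damped_power (vanishing n) k (return_time X H w))%:E)) => [n|w _].
  by apply/measurable_EFinP; apply: measurable_damped_power; exact: vanishing_gt0.
by apply: cvg_damped_power_vanishing; exact: return_time_ge0.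
Qed.

Lemma damped_moment_le H k n i :
  (damped_moment H (vanishing n) k i)%:E <= return_moment P X H k i.
Proof.
rewrite damped_momentE ?vanishing_gt0//; apply: ge0_le_integral => //.
- by move=> w _; rewrite lee_fin;
    case/andP: (damped_power_itv k (vanishing_gt0 n) (@return_time_ge0 _ _ _ _ X H w)).
- by apply/measurable_EFinP; apply: measurable_damped_power; exact: vanishing_gt0.
- exact: measurable_return_power.
- by move=> w _; apply: damped_power_le; [exact: vanishing_gt0|exact: return_time_ge0].
Qed.

Lemma return_moment0 H i : return_moment P X H 0 i = 1.
Proof.
rewrite /return_moment; under eq_integral do rewrite expe0.
by rewrite integral_cst//; apply: etrans (mul1e _) (probability_setT (P i)).
Qed.

Lemma return_moment_ge0 H k i : 0 <= return_moment P X H k i.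
Proof. by apply: integral_ge0 => w _; rewrite expe_ge0// return_time_ge0. Qed.

Lemma expe_homo (x y : \bar R) k : 0 <= x -> x <= y -> x ^+ k <= y ^+ k.
Proof.
move=> x0 xy; elim: k => [|k IH]; first by rewrite !expe0.
by rewrite !expeS lee_pmul// expe_ge0.
Qed.

Lemma return_moment_subset H H' k i : H `<=` H' ->
  return_moment P X H' k i <= return_moment P X H k i.
Proof.
move=> HH'; apply: ge0_le_integral => //; try exact: measurable_return_power.
- by move=> w _; rewrite expe_ge0// return_time_ge0.
- by move=> w _; apply: expe_homo; [exact: return_time_ge0|exact: return_time_subset].
Qed.

Lemma return_moment_le H k k' i : (k <= k')%N ->
  return_moment P X H k i <= 1 + return_moment P X H k' i.
Proof.
move=> kk'; rewrite -(return_moment0 H i) /return_moment -ge0_integralD//.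
- apply: ge0_le_integral => //.
  + by move=> w _; rewrite expe_ge0// return_time_ge0.
  + exact: measurable_return_power.
  + by apply: emeasurable_funD; exact: measurable_return_power.
  move=> w _; rewrite expe0; have := @return_time_ge0 _ _ _ _ X H w.
  move: (return_time X H w) => [s| |//] s0.
    rewrite -!EFin_expe -EFinD lee_fin; rewrite lee_fin in s0.
    have [s1|s1] := leP s 1%R.
      by rewrite (le_trans (exprn_ile1 k s0 s1))// lerDl exprn_ge0.
    by rewrite (le_trans (ler_weXn2l (ltW s1) kk'))// lerDr.
  case: k' kk' => [|k' _]; first by rewrite leqn0 => /eqP->; rewrite expe0 leeDl.
  by rewrite [X in _ <= _ + X]expeS gt0_mulye ?expe_gt0// addey// leey.
- by move=> w _; rewrite expe_ge0// return_time_ge0.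
- exact: measurable_return_power.
Qed.

(** The damped equation is passed to the limit with Fatou's lemma for the sum, hence an
    inequality. *)
Lemma return_moment_step H k i : return_moment P X H k.+1 i < +oo ->
  \esum_(j in ~` H) ((embedding Q i j)%:E * return_moment P X H k.+1 j) +
    (k.+1%:R / rate Q i)%:E * return_moment P X H k i <= return_moment P X H k.+1 i.
Proof.
move=> mfin.
have m0 k' j := return_moment_ge0 H k' j.
have c0 : (0 < k.+1%:R / rate Q i)%R by rewrite divr_gt0// ltr0n.
set m := return_moment P X H k.+1 i in mfin *.
have /fineK : m \is a fin_num by rewrite ge0_fin_numE// m0.
set mr := fine m => mrE.
pose S n := \esum_(j in ~` H) (embedding Q i j * damped_moment H (vanishing n) k.+1 j)%:E.
have eqn n : ((1 + k.+1%:R / rate Q i * vanishing n) *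
      damped_moment H (vanishing n) k.+1 i)%:E =
    S n + (k.+1%:R / rate Q i * damped_moment H (vanishing n) k i)%:E.
  by apply: damped_moment_step; exact: vanishing_gt0.
have le n : S n + (k.+1%:R / rate Q i)%:E * (damped_moment H (vanishing n) k i)%:E <=
    ((1 + k.+1%:R / rate Q i * vanishing n) * mr)%:E.
  rewrite -EFinM -eqn lee_fin ler_wpM2l//.
    by rewrite addr_ge0// mulr_ge0 ?(ltW c0)// ltW// vanishing_gt0.
  by rewrite -lee_fin mrE damped_moment_le.
have cRHS : ((1 + k.+1%:R / rate Q i * vanishing n) * mr)%:E @[n --> \oo] --> m.
  rewrite -mrE; apply: cvg_EFin; first exact: nearW.
  have h : ((1 + k.+1%:R / rate Q i * vanishing n) * mr)%R @[n --> \oo] -->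
      ((1 + k.+1%:R / rate Q i * 0) * mr)%R.
    apply: cvgM; last exact: cvg_cst.
    apply: cvgD; first exact: cvg_cst.
    by apply: cvgM; [exact: cvg_cst|exact: cvg_vanishing].
  by rewrite mulr0 addr0 mul1r in h.
(* A real [x] below the sum stands in for it, so that no infinite terms have to be subtracted. *)
have key (x : R) : x%:E < \esum_(j in ~` H) ((embedding Q i j)%:E * return_moment P X H k.+1 j) ->
    x%:E + (k.+1%:R / rate Q i)%:E * return_moment P X H k i <= m.
  move=> /(@esum_fatou _ _ _ (fun n j =>
     (embedding Q i j)%:E * (damped_moment H (vanishing n) k.+1 j)%:E)) [||N _ hN].
  - move=> n j; rewrite mule_ge0// lee_fin ?embedding_ge0//.
    by case/andP: (damped_moment_itv H k.+1 j (vanishing_gt0 n)).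
  - by move=> j; apply: cvgeZl => //; exact: cvg_damped_moment.
  have cL : x%:E + (k.+1%:R / rate Q i)%:E * (damped_moment H (vanishing n) k i)%:E
      @[n --> \oo] --> x%:E + (k.+1%:R / rate Q i)%:E * return_moment P X H k i.
    apply: cvgeD; [|exact: cvg_cst|apply: cvgeZl => //; exact: cvg_damped_moment].
    by rewrite fin_num_adde_defr.
  apply: (lee_cvg_to cL cRHS); exists N => // n /= Nn; apply: le_trans (le n).
  by rewrite leeD2r// ltW// hN.
set c := (k.+1%:R / rate Q i)%:E * _ in key *.
set T := esum _ _ in key *.
have T0 : 0 <= T.
  by apply: esum_ge0 => j _; rewrite mule_ge0// lee_fin embedding_ge0.
(* The value [x = -1] is always below the non-negative sum and already bounds [c] by [m + 1]. *)
have cfin : c \is a fin_num.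
  have c0' : 0 <= c by rewrite mule_ge0// lee_fin ltW.
  rewrite ge0_fin_numE//.
  have [T1|T1] := ltP (-1)%:E T; last by move: (le_trans T0 T1); rewrite lee_fin oppr_ge0 ler10.
  have := key (-1)%R T1; case: (c) => [r _|/=|_]; rewrite ?ltry//.
  rewrite addey// leye_eq => /eqP e.
  by move: mfin; rewrite e.
rewrite -leeBrDr// leNgt; apply/negP; rewrite -mrE -(fineK cfin) -EFinB => h.
have [z /andP[z1 z2]] : exists z : R, ((mr - fine c)%:E < z%:E) && (z%:E < T).
  case: (T) h => [t| |//]; rewrite ?lte_fin => h.
    exists ((mr - fine c + t) / 2)%R; rewrite !lte_fin; apply/andP; split; lra.
  by exists (mr - fine c + 1)%R; rewrite ltry lte_fin ltrDl ltr01.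
have := key z z2; rewrite -(fineK cfin) -mrE -EFinD lee_fin => h1.
by move: z1; rewrite lte_fin => z1; lra.
Qed.

(** The expression is the Laplace transform of the return time to the complement of the finite part.
    It is at most [expR (- (lam * t))] plus the probability of leaving the finite part by time [t];
    [t] is chosen first, then [n] by non-explosion. *)
Lemma cvg_exit lam i : (0 < lam)%R ->
  (1 - lam * damped_moment (~` finite_part n) lam 1 i)%R @[n --> \oo] --> 0%R.
Proof.
move=> l0.
have psi n : (1 - lam * damped_moment (~` finite_part n) lam 1 i =
    \int[P i]_w damping lam (return_time X (~` finite_part n) w))%R.
  have <- : (\int[P i]_(_ in setT) (1 : R) = 1)%R by exact: Rintegral_prob_cst.
  rewrite -RintegralZl//; last exact: integrable_damped_power.
  rewrite -RintegralB//; last 2 first.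
  - by apply: (@bounded_integrable _ _ _ (P i) _ `|1|%R).
  - rewrite (_ : EFin \o _ = fun w => lam%:E *
      (damped_power lam 1 (return_time X (~` finite_part n) w))%:E)//.
    by apply: integrableZl => //; exact: integrable_damped_power.
  by apply: eq_Rintegral => w _; rewrite /damped_power expr1; field; rewrite gt_eqF.
pose B (t : R) n : set Omega := confined (X := X) (finite_part n) 0 t.
have mB t n : (0 <= t)%R -> measurable (B t n).
  by move=> t0; exact: (measurable_confined mX rcX).
have bound t n w : (0 <= t)%R -> (damping lam (return_time X (~` finite_part n) w) <=
    expR (- (lam * t)) + \1_(~` B t n) w)%R.
  move=> t0; rewrite indicE; have [wB|wB] := boolP (w \in ~` B t n).
    rewrite (le_trans (damping_le1 (ltW l0) _)) ?return_time_ge0//.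
    by rewrite lerDr expR_ge0.
  have Bw : B t n w by apply: contrapT => nB; move/negP: wB; apply; exact/mem_set.
  rewrite addr0.
  have : t%:E <= return_time X (~` finite_part n) w.
    apply: le_ereal_inf_tmp => _ [s [s0 _ nE] <-]; rewrite lee_fin leNgt; apply/negP => st.
    by apply: nE; apply: Bw; rewrite s0 add0r ltW.
  case: (return_time X _ w) => [s| |//]; last by rewrite /= expR_ge0.
  by rewrite lee_fin /= => ts; rewrite ler_expR lerN2 ler_wpM2l// ltW.
have le t n : (0 <= t)%R -> (1 - lam * damped_moment (~` finite_part n) lam 1 i <=
    expR (- (lam * t)) + fine (P i (~` B t n)))%R.
  move=> t0; have mc : measurable (~` B t n) by apply: measurableC; exact: mB.
  have -> : (expR (- (lam * t)) + fine (P i (~` B t n)) =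
      \int[P i]_w (expR (- (lam * t)) + \1_(~` B t n) w))%R.
    rewrite RintegralD//.
    - by rewrite Rintegral_prob_cst /Rintegral integral_indic// setIT.
    - by apply: (@bounded_integrable _ _ _ (P i) _ `|expR (- (lam * t))|%R).
    - apply: (@bounded_integrable _ _ _ (P i) _ 1%R); first exact/measurable_indic.
      by move=> w; rewrite indicE; case: (_ \in _); rewrite ?normr1 ?normr0.
  rewrite psi; apply: le_Rintegral => //.
  - apply: (@bounded_integrable _ _ _ (P i) _ 1%R).
      have := measurable_damped_power (~` finite_part n) 1 l0 => h.
      rewrite (_ : (fun w => _) = (fun w => 1 - lam *
         damped_power lam 1 (return_time X (~` finite_part n) w))%R).
        by apply: measurable_funB => //; exact: measurable_funM.
      by apply/funext => w; rewrite /damped_power expr1; field; rewrite gt_eqF.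
    move=> w; rewrite ger0_norm ?damping_ge0// damping_le1//; first exact: ltW.
    exact: return_time_ge0.
  - apply: (@bounded_integrable _ _ _ (P i) _ (expR (- (lam * t)) + 1)%R).
      by apply: measurable_funD => //; exact/measurable_indic.
    move=> w; rewrite indicE; have e0 := expR_ge0 (- (lam * t)).
    rewrite ger0_norm; last by apply: addr_ge0 => //; exact: ler0n.
    by rewrite lerD2l lern1; case: (w \in ~` B t n).
  - by move=> w _; exact: bound.
apply/cvgrPdist_lt => e e0.
(* This fixes the time [t = N.+1], at which the exponential is below [e / 2]. *)
have /cvgr_dist_lt/(_ (e / 2)%R) := @cvg_damping_pinfty _ lam l0.
rewrite divr_gt0// => /(_ isT)[N _ /(_ N (leqnn N))] /=.
rewrite sub0r normrN ger0_norm ?expR_ge0// => hN.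
have tN : (0 <= N.+1%:R :> R)%R by [].
have cB : P i (B N.+1%:R n) @[n --> \oo] --> 1.
  rewrite -(nonexplosion mX rcX p_ge0 p_0 p_honest p_deriv fdd i Q_regular tN).
  apply: eventually_cst_cvg => [n|w]; first exact: mB.
  have [[m _ cm]|no] := pselect ((\bigcup_n B N.+1%:R n) w).
    exists m => // n mn; split => _; first by exists m.
    by move=> s /cm; exact: finite_part_mono.
  by apply: nearW => n; split => // c; exfalso; apply: no; exists n.
have e2 : (1 - e / 2)%:E < 1 by rewrite lte_fin ltrBlDr ltrDl divr_gt0.
have ev : \forall n \near \oo, (1 - e / 2)%:E < P i (B N.+1%:R n).
  exact: (cB _ (open_ereal_gt' e2)).
apply: filterS ev => n hn; rewrite sub0r normrN.
rewrite ger0_norm; last first.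
  by rewrite psi; apply: Rintegral_ge0 => w _; exact: damping_ge0.
apply: (le_lt_trans (le _ n tN)); rewrite [ltRHS](splitr e) ltrD//.
rewrite -lte_fin fineK ?fin_num_measure//; last by apply: measurableC; exact: mB.
have mBn := mB N.+1%:R n tN.
rewrite probability_setC// -(fineK (_ : P i (B N.+1%:R n) \is a fin_num)) ?fin_num_measure//.
rewrite -EFinB lte_fin; move: hn.
rewrite -(fineK (_ : P i (B N.+1%:R n) \is a fin_num)) ?fin_num_measure// lte_fin.
lra.
Qed.

End ReturnMoments.

(** * Subsolutions *)

Section FiniteExtrema.
Context {R : realType} {E : choiceType}.

Lemma finite_argmin (A : set E) (f : E -> R) : finite_set A -> A !=set0 ->
  exists2 i, A i & forall j, A j -> (f i <= f j)%R.
Proof.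
move=> /finite_seqP[s ->] [x /= xs]; elim: s x xs => [//|a s IH] x _.
have [[y /= ys]|s0] := pselect (exists y, y \in s); last first.
  exists a => [|j] /=; first exact: mem_head.
  by rewrite in_cons => /orP[/eqP->//|js]; case: s0; exists j.
have [i /= si hi] := IH y ys.
have [ai|ia] := leP (f a) (f i).
  exists a => [|j] /=; first exact: mem_head.
  by rewrite in_cons => /orP[/eqP->//|/hi]; exact: le_trans.
exists i => [|j] /=; first by rewrite in_cons si orbT.
by rewrite in_cons => /orP[/eqP->|/hi//]; exact: ltW.
Qed.

Lemma finite_argmax (A : set E) (f : E -> R) : finite_set A -> A !=set0 ->
  exists2 i, A i & forall j, A j -> (f j <= f i)%R.
Proof.
move=> finA A0; have [i Ai hi] := finite_argmin (fun x => - f x)%R finA A0.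
by exists i => // j /hi; rewrite lerN2.
Qed.

Lemma finite_uniform_bound (A : set E) (p : E -> R -> Prop) : finite_set A ->
  (forall i (c c' : R), (c <= c')%R -> p i c -> p i c') ->
  (forall i, A i -> exists c, p i c) -> exists c, forall i, A i -> p i c.
Proof.
move=> finA mono h; have [A0|/set0P A0] := eqVneq A set0.
  by exists 0%R => i; rewrite A0.
have /choice[f hf] : forall i, exists c, A i -> p i c.
  move=> i; have [/h[c pc]|nA] := pselect (A i); first by exists c.
  by exists 0%R => Ai.
have [i Ai hi] := finite_argmax f finA A0.
by exists (f i) => j Aj; exact: mono (hi j Aj) (hf j Aj).
Qed.

End FiniteExtrema.

Section SignedSums.
Context {R : realType} {E : countType}.
Implicit Types (A : set E) (f g : E -> R).

Lemma signed_esum_le A f g : (forall j, A j -> f j <= g j)%R ->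
  (forall j, 0 <= g j)%R -> signed_esum A f <= \esum_(j in A) (g j)%:E.
Proof.
move=> fg g0; rewrite /signed_esum.
apply: (@le_trans _ _ (\esum_(j in A) (Num.max (f j) 0)%:E)).
  rewrite -[leRHS]adde0 leeD2l// leeNl oppe0 esum_ge0// => j _.
  by rewrite lee_fin le_max lexx orbT.
by apply: le_esum => j Aj; rewrite lee_fin ge_max fg//= g0.
Qed.

Lemma signed_esum_ge0 A f : (forall j, 0 <= f j)%R ->
  signed_esum A f = \esum_(j in A) (f j)%:E.
Proof.
move=> f0; rewrite /signed_esum [X in _ - X]esum1 ?sube0.
  by apply: eq_esum => j _; rewrite max_l.
by move=> j _; rewrite max_r// oppr_le0.
Qed.

(** The value at one index [k] is kept with its sign while the others are bounded above; this is
    what carries a lower bound from one state to the next along a path. *)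
Lemma signed_esum_split A f g k : A k -> (forall j, A j -> f j <= g j)%R ->
  (forall j, 0 <= g j)%R ->
  signed_esum A f <= (f k)%:E + \esum_(j in A `\ k) (g j)%:E.
Proof.
move=> Ak fg g0; rewrite /signed_esum.
have m0 (h : E -> R) j : 0 <= (Num.max (h j) 0 : R)%:E by rewrite lee_fin le_max lexx orbT.
rewrite (esum_setD1 Ak (m0 f)) (esum_setD1 Ak (m0 (fun j => - f j)%R)).
set Pk := \esum_(j in _) _; set N := \esum_(j in _) _.
have PG : Pk <= \esum_(j in A `\ k) (g j)%:E.
  by apply: le_esum => j [Aj _]; rewrite lee_fin ge_max fg//= g0.
have P0 : 0 <= Pk by apply: esum_ge0 => j _; exact: m0.
have N0 : 0 <= N by apply: esum_ge0 => j _; exact: (m0 (fun j => - f j)%R).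
have -> : (f k)%:E = (Num.max (f k) 0)%:E - (Num.max (- f k) 0)%:E.
  rewrite -EFinB; congr (_%:E); case: (leP (f k) 0%R) => h.
    by rewrite max_l ?oppr_ge0// sub0r opprK.
  by rewrite max_r ?subr0// oppr_le0 ltW.
rewrite [leRHS]addeAC; apply: leeD; first exact: leeD2l.
by rewrite leeN2 leeDl.
Qed.

End SignedSums.

Section MomentAnalysis.
(* The argument uses the process only through the relations below, satisfied by
   [return_moment P X] and [damped_moment]. *)
Context {R : realType} {E : countType} {Q : E -> E -> R}
  {moment : set E -> nat -> E -> \bar R}
  {dmoment : set E -> R -> nat -> E -> R}.
Local Notation Pi := (embedding Q).
Context (Pi_ge0 : forall i j, (0 <= Pi i j)%R)
  (Pi_sum : forall i, \esum_(j in [set: E]) (Pi i j)%:E = 1)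
  (rate_gt0 : forall i, (0 < rate Q i)%R)
  (Q_irreducible : irreducible Q)
  (moment0 : forall H i, moment H 0%N i = 1)
  (moment_ge0 : forall H k i, 0 <= moment H k i)
  (moment_step : forall H k i, moment H k.+1 i < +oo ->
    \esum_(j in ~` H) ((Pi i j)%:E * moment H k.+1 j) +
      (k.+1%:R / rate Q i)%:E * moment H k i <= moment H k.+1 i)
  (moment_subset : forall H H' k i, H `<=` H' -> moment H' k i <= moment H k i)
  (moment_le : forall H k k' i, (k <= k')%N -> moment H k i <= 1 + moment H k' i)
  (dmoment_itv : forall H lam k i, (0 < lam)%R ->
    (0 <= dmoment H lam k i <= lam^-1 ^+ k)%R)
  (dmoment0 : forall H lam i, dmoment H lam 0%N i = 1%R)
  (dmoment_step : forall H lam k i, (0 < lam)%R ->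
    ((1 + k.+1%:R / rate Q i * lam) * dmoment H lam k.+1 i)%:E =
    \esum_(j in ~` H) (Pi i j * dmoment H lam k.+1 j)%:E +
      (k.+1%:R / rate Q i * dmoment H lam k i)%:E)
  (dmoment_cvg : forall H k i,
    (dmoment H (vanishing n) k i)%:E @[n --> \oo] --> moment H k i)
  (dmoment_le : forall H k n i, (dmoment H (vanishing n) k i)%:E <= moment H k i)
  (dmoment_exit : forall lam i, (0 < lam)%R ->
    (1 - lam * dmoment (~` finite_part n) lam 1 i)%R @[n --> \oo] --> 0%R).
Implicit Types (H K A : set E) (lam c : R) (n : nat).

Lemma esum_Pi_cst A i c : (0 <= c)%R -> \esum_(j in A) (Pi i j * c)%:E <= c%:E.
Proof.
move=> c0; apply: (@le_trans _ _ (\esum_(j in [set: E]) (Pi i j * c)%:E)).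
  exact: le_esum_subset.
under eq_esum do rewrite EFinM.
by rewrite esumZr// ?Pi_sum ?mul1e// => j; rewrite lee_fin.
Qed.

(** The step equation of order one for [lam * dmoment H lam 1], which is 1 minus the Laplace
    transform of the return time. *)
Lemma psi_step H lam i : (0 < lam)%R ->
  \esum_(j in ~` H) (Pi i j * (lam * dmoment H lam 1 j))%:E =
  ((1 + lam / rate Q i) * (lam * dmoment H lam 1 i) - lam / rate Q i)%:E.
Proof.
move=> l0; have q0 := rate_gt0 i.
transitivity (lam%:E * \esum_(j in ~` H) (Pi i j * dmoment H lam 1 j)%:E).
  rewrite -esumZl ?(ltW l0)//; last first.
    by move=> j; rewrite lee_fin mulr_ge0//; case/andP: (dmoment_itv H 1 j l0).
  by apply: eq_esum => j _; rewrite -EFinM mulrCA.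
have := dmoment_step H 0 i l0; rewrite dmoment0.
set S := esum _ _; case: S => [s| |]//= [e].
rewrite -EFinM; congr (_%:E).
have -> : (s = (1 + 1 / rate Q i * lam) * dmoment H lam 1 i - 1 / rate Q i * 1)%R.
  by rewrite e; ring.
by field; rewrite gt_eqF.
Qed.

(* Comparison on the finite set [finite_part n], outside of which the exit
   term below equals 1. *)
Lemma subharmonic_exit_bound H w c lam n i : (0 < lam)%R ->
  (forall j, 0 <= w j <= c)%R ->
  (forall j, (w j)%:E <= \esum_(k in ~` H) (Pi j k * w k)%:E) ->
  finite_part n i ->
  (w i <= c * (lam * dmoment H lam 1 i + (1 - lam * dmoment (~` finite_part n) lam 1 i)))%R.
Proof.
move=> l0 wc wsub ni.
have c0 : (0 <= c)%R by case/andP: (wc i); exact: le_trans.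
pose psi j := (lam * dmoment H lam 1 j)%R.
pose chi j := (lam * dmoment (~` finite_part n) lam 1 j)%R.
have itv01 A j : (0 <= lam * dmoment A lam 1 j <= 1)%R.
  have /andP[d0 d1] := dmoment_itv A 1 j l0; rewrite mulr_ge0 ?(ltW l0)//=.
  by rewrite -(mulfV (lt0r_neq0 l0)) ler_wpM2l ?(ltW l0).
pose a j := (c * (psi j + (1 - chi j)) - w j)%R.
(* Minimum principle: [a] is the gap in the claimed bound, and a negative minimum over the finite
   part is refuted at [i0]. *)
have [i0 ni0 hmin] := @finite_argmin R E _ a (@finite_part_finite E n) (ex_intro _ i ni).
suff a0 : (0 <= a i0)%R.
  by have := le_trans a0 (hmin i ni); rewrite subr_ge0.
rewrite leNgt; apply/negP => alt.
(* The exit term is replaced by 1 off the finite part. There [1 - chi] need not be 1, since a return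
   is only counted after a jump. *)
pose tphi j := if j \in finite_part n then (1 - chi j)%R else 1%R.
have tphi0 j : (0 <= tphi j)%R.
  by rewrite /tphi; case: ifP => // _; rewrite subr_ge0; case/andP: (itv01 (~` finite_part n) j).
have wle j : (w j <= c * psi j + c * tphi j + (- a i0))%R.
  have /andP[p0 p1] := itv01 H j.
  rewrite /tphi; case: ifPn => nj.
    by have := hmin j (set_mem nj); rewrite {2}/a; lra.
  have /andP[_ wjc] := wc j.
  have : (0 <= c * psi j)%R by rewrite mulr_ge0.
  lra.
have q0 := rate_gt0 i0.
have Ephi : \esum_(j in [set: E]) (Pi i0 j * tphi j)%:E =
    ((1 + lam / rate Q i0) * (1 - chi i0))%:E.
  have e1 : \esum_(j in [set: E]) (Pi i0 j * tphi j)%:E +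
      \esum_(j in ~` (~` finite_part n)) (Pi i0 j * chi j)%:E = 1.
    rewrite -(Pi_sum i0) [X in _ + X]esum_mkcond -esumD.
    - apply: eq_esum => j _; rewrite setCK /tphi; case: ifP => _.
        by rewrite -EFinD; congr (_%:E); ring.
      by rewrite adde0 mulr1.
    - by move=> j _; rewrite lee_fin mulr_ge0.
    - by move=> j _; case: ifP => // _; rewrite lee_fin mulr_ge0//;
        case/andP: (itv01 (~` finite_part n) j).
  move: e1; rewrite psi_step// -/(chi i0).
  set S := esum _ _; case: S => [s| |]//= [e]; congr (_%:E).
  have -> : (s = 1 - ((1 + lam / rate Q i0) * chi i0 - lam / rate Q i0))%R.
    exact: canRL (addrK _) e.
  by ring.
have Epsi : \esum_(j in ~` H) (Pi i0 j * psi j)%:E =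
    ((1 + lam / rate Q i0) * psi i0 - lam / rate Q i0)%:E by exact: psi_step.
have up : (w i0)%:E <= (c * ((1 + lam / rate Q i0) * psi i0 - lam / rate Q i0))%:E +
    (c * ((1 + lam / rate Q i0) * (1 - chi i0)))%:E + (- a i0)%:E.
  apply: (le_trans (wsub i0)).
  apply: (@le_trans _ _ (\esum_(j in ~` H) (c%:E * (Pi i0 j * psi j)%:E) +
     \esum_(j in ~` H) (c%:E * (Pi i0 j * tphi j)%:E) +
     \esum_(j in ~` H) (Pi i0 j * - a i0)%:E)).
    have p0 j : (0 <= psi j)%R by case/andP: (itv01 H j).
    have na : (0 <= - a i0)%R by rewrite oppr_ge0 ltW.
    rewrite -!esumD.
    - apply: le_esum => j _; rewrite -!EFinM -!EFinD lee_fin.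
      apply: (le_trans (ler_wpM2l (Pi_ge0 i0 j) (wle j))).
      by rewrite le_eqVlt; apply/orP; left; apply/eqP; ring.
    - by move=> j _; rewrite -!EFinM -EFinD lee_fin addr_ge0// mulr_ge0// mulr_ge0.
    - by move=> j _; rewrite lee_fin mulr_ge0.
    - by move=> j _; rewrite -EFinM lee_fin mulr_ge0// mulr_ge0.
    - by move=> j _; rewrite -EFinM lee_fin mulr_ge0// mulr_ge0.
  apply: leeD; last by apply: esum_Pi_cst; rewrite oppr_ge0 ltW.
  rewrite esumZl//; last by move=> j; rewrite lee_fin mulr_ge0//; case/andP: (itv01 H j).
  apply: leeD; first by rewrite Epsi -EFinM.
  rewrite esumZl//; last by move=> j; rewrite lee_fin mulr_ge0.
  rewrite EFinM lee_wpmul2l ?lee_fin//.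
  by rewrite -Ephi; exact: le_esum_subset.
move: up; rewrite -!EFinD lee_fin => up.
have lq : (0 < lam / rate Q i0)%R by rewrite divr_gt0.
(* Once [a i0] is expanded, only the terms with the factor [lam / rate Q i0] survive. For [c > 0]
   they force [psi + (1 - chi)] to be at least 1 at [i0], so the gap there is at least [c - w i0],
   which is non-negative. *)
have h1 : (0 <= c * (lam / rate Q i0) * (psi i0 + (1 - chi i0) - 1))%R.
  rewrite -subr_ge0 in up; apply: (le_trans up); rewrite /a.
  by rewrite le_eqVlt; apply/orP; left; apply/eqP; ring.
have /andP[w0 wc0] := wc i0.
move: alt; rewrite /a => alt.
have [ceq|cne] := eqVneq c 0%R; first by move: alt wc0 w0; rewrite ceq; lra.
have cpos : (0 < c)%R by rewrite lt0r cne.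
have h2 : (1 <= psi i0 + (1 - chi i0))%R.
  by rewrite -subr_ge0 -(pmulr_rge0 _ (mulr_gt0 cpos lq)).
have : (c * 1 <= c * (psi i0 + (1 - chi i0)))%R by rewrite ler_wpM2l.
lra.
Qed.

(** First [n] tends to infinity, which removes the exit term; then [lam] tends to 0, where the
    finite first moment makes the remaining term vanish. *)
Lemma subharmonic_zero H w c : (forall i, moment H 1 i < +oo) ->
  (forall j, 0 <= w j <= c)%R ->
  (forall j, (w j)%:E <= \esum_(k in ~` H) (Pi j k * w k)%:E) ->
  forall i, (w i <= 0)%R.
Proof.
move=> m1 wc wsub i.
have le1 lam : (0 < lam)%R -> (w i <= c * (lam * dmoment H lam 1 i))%R.
  move=> l0.
  have cv : (c * (lam * dmoment H lam 1 i +
      (1 - lam * dmoment (~` finite_part n) lam 1 i)))%R @[n --> \oo] -->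
      (c * (lam * dmoment H lam 1 i + 0))%R.
    apply: cvgM; first exact: cvg_cst.
    by apply: cvgD; [exact: cvg_cst|exact: dmoment_exit].
  rewrite addr0 in cv.
  apply: (ler_cvg_to (cvg_cst (w i)) cv).
  exists (pickle i).+1 => // n /= ni; apply: subharmonic_exit_bound => //.
have mfin : moment H 1 i \is a fin_num by rewrite ge0_fin_numE.
have c0 : (0 <= c)%R by case/andP: (wc i); exact: le_trans.
have cv : (c * (vanishing n * fine (moment H 1 i)))%R @[n --> \oo] -->
    (c * (0 * fine (moment H 1 i)))%R.
  apply: cvgM; first exact: cvg_cst.
  by apply: cvgM; [exact: cvg_vanishing|exact: cvg_cst].
rewrite mul0r mulr0 in cv.
apply: (ler_cvg_to (cvg_cst (w i)) cv); apply: nearW => n.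
apply: (le_trans (le1 _ (vanishing_gt0 n))).
rewrite ler_wpM2l// ler_wpM2l ?(ltW (vanishing_gt0 n))//.
by rewrite -lee_fin fineK.
Qed.

Definition subsolution H (b y : E -> R) : Prop :=
  (exists c, forall i, (y i <= c)%R) /\
  forall i, (y i)%:E <= signed_esum (~` H) (fun j => Pi i j * y j)%R + (b i)%:E.

Lemma Pi_successor i : exists j, (0 < Pi i j)%R.
Proof.
apply: contrapT => /forallNP no.
have := Pi_sum i; rewrite esum1 => [[/esym/eqP]|j _]; first by rewrite oner_eq0.
by have := no j; rewrite lt0r Pi_ge0 andbT => /negP/negPn/eqP ->.
Qed.

(** A first step to a successor makes the path non-empty even when [i = j]. Diagonal entries of [Q]
    are negative, so every edge of an irreducibility path is an edge of the embedding chain. *)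
Lemma Pi_path i j : exists s, [/\ s != [::], path (fun a b => (0 < Pi a b)%R) i s &
  last i s = j].
Proof.
have [k ik] := Pi_successor i; have [s ps ls] := Q_irreducible k j.
exists (k :: s); split => //=; rewrite ik /=.
apply: sub_path ps => a b ab; rewrite /embedding; case: eqVneq => [ba|_].
  by move: ab (rate_gt0 a); rewrite ba /rate oppr_gt0 => h /(lt_trans h); rewrite ltxx.
by rewrite divr_gt0.
Qed.

(** * Uniform bounds on subsolutions, given a supersolution off the larger set [K] *)

Section Subsolutions.
Context (H K : set E) (HK : H `<=` K) (K_finite : finite_set K) (H_neq0 : H !=set0)
  (K1 : forall i, moment K 1 i < +oo).
Context {b m : E -> R} (m_ge0 : forall i, (0 <= m i)%R) (b_ge0 : forall i, (0 <= b i)%R)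
  (m_super : forall i, \esum_(j in ~` K) (Pi i j * m j)%:E + (b i)%:E <= (m i)%:E).

(** The upper bound for a subsolution that is at most [mu] on [K]. It omits [m] on [K], since the
    supersolution inequality controls only sums off [K]. *)
Let barrier (mu : R) j : R := ((if j \in K then 0 else m j) + mu)%R.

Let barrier_ge0 mu j : (0 <= mu)%R -> (0 <= barrier mu j)%R.
Proof. by move=> mu0; rewrite /barrier addr_ge0//; case: ifP. Qed.

(** The part with [m] is absorbed by the supersolution inequality, and the constant [mu] is weighted
    by the mass of [A]. A mass strictly below 1 is what [path_bound] exploits. *)
Let barrier_sum i A (mu c : R) : (0 <= mu)%R ->
  \esum_(j in A) (Pi i j)%:E <= c%:E ->
  \esum_(j in A) (Pi i j * barrier mu j)%:E + (b i)%:E <= (m i + c * mu)%:E.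
Proof.
move=> mu0 Ac.
apply: (@le_trans _ _ (\esum_(j in ~` K) (Pi i j * m j)%:E + (c * mu)%:E + (b i)%:E)).
  rewrite leeD2r//.
  have -> : \esum_(j in A) (Pi i j * barrier mu j)%:E =
      \esum_(j in A) (Pi i j * (if j \in K then 0 else m j))%:E +
      \esum_(j in A) ((Pi i j)%:E * mu%:E).
    rewrite -esumD.
    - by apply: eq_esum => j _; rewrite -EFinM -EFinD -mulrDr.
    - by move=> j _; case: ifP => _; rewrite lee_fin mulr_ge0.
    - by move=> j _; rewrite -EFinM lee_fin mulr_ge0.
  apply: leeD; last first.
    rewrite esumZr//; last by move=> j; rewrite lee_fin.
    have -> : (c * mu)%:E = c%:E * mu%:E by [].
    by apply: lee_wpmul2r.
  rewrite esum_mkcond [leRHS]esum_mkcond; apply: le_esum => j _.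
  rewrite in_setC; case: (j \in A); case: (j \in K) => /=;
    by rewrite ?mulr0 ?lee_fin// mulr_ge0.
by rewrite addeAC EFinD leeD2r.
Qed.

(** The comparison principle: the positive part [w] of [y - m - mu] is bounded and subharmonic off
    [K], hence zero. *)
Let subsolution_le y (mu : R) : subsolution H b y -> (0 <= mu)%R ->
  (forall a, K a -> (y a <= mu)%R) -> forall i, (y i <= m i + mu)%R.
Proof.
move=> [[c yc] ysub] mu0 Kmu i.
pose w j := Num.max (y j - m j - mu)%R 0%R.
have w0 j : (0 <= w j)%R by rewrite /w le_max lexx orbT.
have yw j : (y j <= m j + mu + w j)%R.
  have : (y j - m j - mu <= w j)%R by rewrite /w le_max lexx.
  lra.
have wc j : (0 <= w j <= `|c|)%R.
  rewrite w0 /w ge_max normr_ge0 andbT.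
  have := yc j; have := ler_norm c; have := m_ge0 j; lra.
have wsub j : (w j)%:E <= \esum_(k in ~` K) (Pi j k * w k)%:E.
  have S0 : 0 <= \esum_(k in ~` K) (Pi j k * w k)%:E.
    by apply: esum_ge0 => k _; rewrite lee_fin mulr_ge0.
  rewrite /w /Num.max; case: ifP => // _.
  have g0 k : (0 <= barrier mu k + (if k \in K then 0 else w k))%R.
    by rewrite addr_ge0 ?barrier_ge0//; case: ifP.
  (* On [K] the bound [mu] suffices without [w]. The sum over the complement of the smaller set [H]
     therefore involves [w] only off [K]. *)
  have yg k : (y k <= barrier mu k + (if k \in K then 0 else w k))%R.
    rewrite /barrier; case: ifPn => kK; first by have := Kmu k (set_mem kK); lra.
    exact: yw.
  have := ysub j.
  move=> /le_trans/(_ (leeD2r _ (signed_esum_le (g := fun k =>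
     Pi j k * (barrier mu k + (if k \in K then 0 else w k)))%R
     (fun k _ => ler_wpM2l (Pi_ge0 j k) (yg k))
     (fun k => mulr_ge0 (Pi_ge0 j k) (g0 k))))) h.
  have : (y j)%:E <= (m j + 1 * mu)%:E + \esum_(k in ~` K) (Pi j k * w k)%:E.
    apply: (le_trans h).
    have -> : \esum_(k in ~` H) (Pi j k * (barrier mu k + (if k \in K then 0 else w k)))%:E =
        \esum_(k in ~` H) (Pi j k * barrier mu k)%:E +
        \esum_(k in ~` H) (Pi j k * (if k \in K then 0 else w k))%:E.
      rewrite -esumD.
      - by apply: eq_esum => k _; rewrite -EFinD mulrDr.
      - by move=> k _; rewrite lee_fin mulr_ge0// barrier_ge0.
      - by move=> k _; case: ifP => _; rewrite lee_fin mulr_ge0.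
    rewrite addeAC; apply: leeD; first apply: barrier_sum => //.
      by rewrite -(Pi_sum j); exact: le_esum_subset.
    rewrite esum_mkcond [leRHS]esum_mkcond; apply: le_esum => k _.
    rewrite !in_setC; case: (k \in H); case: (k \in K) => /=;
      by rewrite ?mulr0 ?lee_fin// mulr_ge0.
  case: (esum _ _) => [s| |]; rewrite ?leey//.
  by rewrite -EFinD !lee_fin; lra.
have := subharmonic_zero K1 wc wsub i.
by have := yw i; lra.
Qed.

(** If [y i] is within [c'] of the upper bound [mu], the inequality at [i] puts [y j] within
    [(m i + c') / Pi i j] of [mu] at the next state [j]. When [j] lies in [H] its mass is missing
    from the sum, and the same quantity bounds [mu] itself. The constant is chosen before [y] and
    [mu]. *)
Let path_bound s i : s != [::] -> path (fun a b => (0 < Pi a b)%R) i s ->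
  H (last i s) -> forall c', exists c, forall y (mu : R), subsolution H b y -> (0 <= mu)%R ->
  (forall a, K a -> (y a <= mu)%R) -> (mu - c' <= y i)%R -> (mu <= c)%R.
Proof.
elim: s i => // j s IH i _ /= /andP[ij js] lastH c'.
have rest : \esum_(k in [set: E] `\ j) (Pi i k)%:E = (1 - Pi i j)%:E.
  have := Pi_sum i; rewrite (esum_setD1 (k := j))//; last by move=> k; rewrite lee_fin.
  by set S := esum _ _; case: S => [x| |]//= [e]; congr (_%:E); lra.
have yg (y : E -> R) (mu : R) : subsolution H b y -> (0 <= mu)%R ->
    (forall a, K a -> (y a <= mu)%R) ->
    forall k : E, (y k <= barrier mu k)%R.
  move=> sy mu0 Kmu k; rewrite /barrier; case: ifPn => kK.
    by rewrite add0r; apply: Kmu; exact: set_mem.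
  exact: subsolution_le.
have [Hj|nHj] := pselect (H j).
  exists ((m i + c') / Pi i j)%R => y mu sy mu0 Kmu yi.
  have := sy.2 i.
  move=> /le_trans/(_ (leeD2r _ (signed_esum_le (g := fun k => Pi i k * barrier mu k)%R
     (fun k _ => ler_wpM2l (Pi_ge0 i k) (yg y mu sy mu0 Kmu k))
     (fun k => mulr_ge0 (Pi_ge0 i k) (barrier_ge0 k mu0))))) h.
  have sub : \esum_(k in ~` H) (Pi i k)%:E <= (1 - Pi i j)%:E.
    by rewrite -rest; apply: le_esum_subset => k nHk; split => // kj; apply: nHk; rewrite kj.
  have := le_trans h (barrier_sum mu0 sub); rewrite lee_fin => h1.
  by rewrite ler_pdivlMr//; lra.
have [|c hc] := IH j _ js lastH ((m i + c') / Pi i j)%R.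
  by case: s js lastH {IH} => //= _ /nHj.
exists c => y mu sy mu0 Kmu yi; apply: (hc y) => //.
have := sy.2 i.
move=> /le_trans/(_ (leeD2r _ (signed_esum_split (k := j) (g := fun k => Pi i k * barrier mu k)%R
   nHj (fun k _ => ler_wpM2l (Pi_ge0 i k) (yg y mu sy mu0 Kmu k))
   (fun k => mulr_ge0 (Pi_ge0 i k) (barrier_ge0 k mu0))))).
rewrite -addeA => h.
have sub : \esum_(k in ~` H `\ j) (Pi i k)%:E <= (1 - Pi i j)%:E.
  by rewrite -rest; apply: le_esum_subset => k [_ kj]; split.
have := le_trans h (leeD2l _ (barrier_sum mu0 sub)).
rewrite -EFinD lee_fin => h1.
by rewrite lerBlDr -lerBlDl ler_pdivlMr//; lra.
Qed.

(** The path bound is taken from each state of the finite set [K] with defect 0, as for a maximiser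
    of [y] over [K]. *)
Lemma subsolution_bound : exists c, forall y, subsolution H b y ->
  forall i, (y i <= m i + c)%R.
Proof.
have [c hc] : exists c, forall a, K a -> forall y (mu : R), subsolution H b y ->
    (0 <= mu)%R -> (forall a, K a -> (y a <= mu)%R) -> (mu - 0 <= y a)%R -> (mu <= c)%R.
  apply: finite_uniform_bound => // [i c c' cc' h y mu sy mu0 Kmu yi|a Ka].
    exact: le_trans (h y mu sy mu0 Kmu yi) cc'.
  have [h0 Hh0] := H_neq0; have [s [s0 ps ls]] := Pi_path a h0.
  by apply: (path_bound s0 ps); rewrite ls.
exists (Num.max c 0%R) => y sy i.
have K_neq0 : K !=set0 by have [h0 /HK Kh0] := H_neq0; exists h0.
have [a Ka amax] := finite_argmax y K_finite K_neq0.
(* The comparison needs [mu >= 0]: the maximum serves as [mu] when it is non-negative, and 0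
   otherwise. *)
have [ya|ya] := leP 0%R (y a).
  apply: (le_trans (subsolution_le sy ya amax i)); rewrite lerD2l le_max.
  by rewrite (hc a Ka y (y a))// subr0.
apply: le_trans (subsolution_le sy (lexx 0%R) _ i) _; last first.
  by rewrite lerD2l le_max lexx orbT.
by move=> x /amax /le_trans -> //; exact: ltW.
Qed.

End Subsolutions.

(** The damping term on the left of the step equation is discarded, and the damped moment of order
    [k] on the right is enlarged to the true one. *)
Lemma dmoment_subsolution H n k i :
  (dmoment H (vanishing n) k.+1 i)%:E <=
  signed_esum (~` H) (fun j => Pi i j * dmoment H (vanishing n) k.+1 j)%R +
    (k.+1%:R / rate Q i)%:E * moment H k i.
Proof.
have v0 := vanishing_gt0 (R := R) n.
have c0 : (0 < k.+1%:R / rate Q i)%R by rewrite divr_gt0// ltr0n.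
have d0 j : (0 <= dmoment H (vanishing n) k.+1 j)%R.
  by case/andP: (dmoment_itv H k.+1 j v0).
rewrite signed_esum_ge0; last by move=> j; rewrite mulr_ge0.
apply: (@le_trans _ _ ((1 + k.+1%:R / rate Q i * vanishing n) *
    dmoment H (vanishing n) k.+1 i)%:E).
  by rewrite lee_fin mulrDl mul1r lerDl mulr_ge0// mulr_ge0// ltW.
rewrite dmoment_step// leeD2l// EFinM.
by apply: lee_wpmul2l => //; rewrite lee_fin ltW.
Qed.

(** For [j] outside [H], the step inequality at [a] bounds [Pi a j] times the moment at [j], so
    finiteness travels along paths; inside [H] it is assumed. *)
Lemma moment_propagation H k : H !=set0 ->
  (forall i, H i -> moment H k.+1 i < +oo) -> forall i, moment H k.+1 i < +oo.
Proof.
move=> [h Hh] fin i; have [s [_ ps <-]] := Pi_path h i.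
have := fin h Hh; elim: s h {Hh} ps => //= j s IH a /andP[aj ps] afin.
apply: IH ps _.
have [Hj|Hj] := pselect (H j); first exact: fin.
rewrite ltNge leye_eq; apply/negP => /eqP mj.
have := moment_step afin.
have c0 : 0 <= (k.+1%:R / rate Q a)%:E * moment H k a.
  by rewrite mule_ge0// lee_fin divr_ge0// ltW.
move=> /(le_trans (leeDl _ c0)).
move=> /(le_trans (@esum_lb _ _ (~` H) (fun j => (Pi a j)%:E * moment H k.+1 j) j Hj _)) h'.
have m0 j' : 0 <= (Pi a j')%:E * moment H k.+1 j' by rewrite mule_ge0// lee_fin.
have := h' m0.
by rewrite mj gt0_muley ?lte_fin// leye_eq => /eqP e; rewrite e in afin.
Qed.

(** Moments to the union [K] are finite because [K] contains [H']. They yield supersolutions off [K]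
    once the inhomogeneity, a moment to [H], is itself bounded by moments to [K]; that bound is
    proved by induction on the order. *)
Lemma moment_transfer H H' l : finite_set H -> H !=set0 ->
  finite_set H' -> H' !=set0 -> (forall i, H' i -> moment H' l.+1 i < +oo) ->
  exists D : E -> R, forall y : E -> R,
    (exists c, forall i, (y i <= c)%R) ->
    (forall i, (y i)%:E <= signed_esum (~` H) (fun j => Pi i j * y j)%R +
       (l.+1%:R / rate Q i)%:E * moment H l i) ->
    forall i, (y i <= D i)%R.
Proof.
move=> finH H0 finH' H'0 /(moment_propagation H'0) finite'.
pose K := H `|` H'; have finK : finite_set K by rewrite finite_setU.
have HK : H `<=` K by move=> x; left.
have Kfin k i : (k <= l.+1)%N -> moment K k i < +oo.
  move=> kl; apply: (le_lt_trans (moment_le K i kl)).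
  apply: lte_add_pinfty; first exact: ltry.
  by apply: le_lt_trans (finite' i); apply: moment_subset => x; right.
pose mk k i := fine (moment K k i).
have mkE k i : (k <= l.+1)%N -> (mk k i)%:E = moment K k i.
  by move=> kl; rewrite fineK// ge0_fin_numE// Kfin.
have mk0 k i : (0 <= mk k i)%R by exact: fine_ge0.
have mk1 i : mk 0%N i = 1%R by rewrite /mk moment0.
have K1 i : moment K 1 i < +oo by exact: Kfin.
(* [S'] collects the orders 1 to [k] and [S] the orders 0 to [k - 1]: the step inequality makes [S']
   a supersolution off [K] with inhomogeneity [S / rate]. *)
pose S k i := (\sum_(0 <= j < k) mk j i)%R.
pose S' k i := (\sum_(0 <= j < k) mk j.+1 i)%R.
have S0 k i : (0 <= S k i)%R by apply: sumr_ge0.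
have S'0 k i : (0 <= S' k i)%R by apply: sumr_ge0.
have super k i : (k <= l.+1)%N ->
    \esum_(j in ~` K) (Pi i j * S' k j)%:E + (S k i / rate Q i)%:E <= (S' k i)%:E.
  move=> kl.
  have -> : \esum_(j in ~` K) (Pi i j * S' k j)%:E =
      \sum_(0 <= r < k) \esum_(j in ~` K) (Pi i j * mk r.+1 j)%:E.
    rewrite -esum_sum; last by move=> j r _ _; rewrite lee_fin mulr_ge0.
    by apply: eq_esum => j _; rewrite sumEFin mulr_sumr.
  rewrite /S mulr_suml -sumEFin -big_split/= /S' -sumEFin.
  rewrite big_nat_cond [leRHS]big_nat_cond; apply: lee_sum => r /andP[/andP[_ rk] _].
  have rl : (r < l.+1)%N by exact: leq_trans rk kl.
  have mfin : moment K r.+1 i < +oo by exact: Kfin.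
  rewrite (mkE r.+1)//; apply: le_trans (moment_step mfin); apply: leeD.
    by apply: le_esum => j _; rewrite EFinM mkE.
  rewrite -(mkE r) ?(ltnW rl)// -EFinM lee_fin.
  by rewrite mulrAC -mulrA ler_peMl ?ler1n// mulr_ge0// invr_ge0 ltW.
(* A bound of the order-[k] moment by a multiple of [S k.+1] makes the matching multiple of
   [S' k.+1] a supersolution; the resulting constant [C] serves all subsolutions at once. *)
have build k c : (k <= l)%N -> (0 <= c)%R ->
    (forall i, moment H k i <= (c * S k.+1 i)%:E) ->
    exists C : R, forall y, (exists c', forall i, (y i <= c')%R) ->
    (forall i, (y i)%:E <= signed_esum (~` H) (fun j => Pi i j * y j)%R +
       (k.+1%:R / rate Q i)%:E * moment H k i) ->
    forall i, (y i <= k.+1%:R * c * S' k.+1 i + C)%R.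
  move=> kl c0 mc.
  have mHfin i : moment H k i \is a fin_num.
    by rewrite ge0_fin_numE//; apply: le_lt_trans (mc i) _; exact: ltry.
  pose b i := (k.+1%:R / rate Q i * fine (moment H k i))%R.
  have bE i : (b i)%:E = (k.+1%:R / rate Q i)%:E * moment H k i.
    by rewrite /b EFinM fineK.
  have kc0 : (0 <= k.+1%:R * c)%R by rewrite mulr_ge0.
  pose mm i := (k.+1%:R * c * S' k.+1 i)%R.
  have mm0 i : (0 <= mm i)%R by rewrite mulr_ge0.
  have b0 i : (0 <= b i)%R.
    by rewrite mulr_ge0 ?fine_ge0// divr_ge0// ltW.
  have msup i : \esum_(j in ~` K) (Pi i j * mm j)%:E + (b i)%:E <= (mm i)%:E.
    apply: (@le_trans _ _ ((k.+1%:R * c)%:E * (\esum_(j in ~` K) (Pi i j * S' k.+1 j)%:E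
       + (S k.+1 i / rate Q i)%:E))); last first.
      rewrite [leRHS]EFinM; apply: lee_wpmul2l; first by rewrite lee_fin.
      exact: super.
    rewrite ge0_muleDr; last 2 first.
    - by apply: esum_ge0 => j _; rewrite lee_fin mulr_ge0.
    - by rewrite lee_fin divr_ge0// ltW.
    apply: leeD.
      rewrite -esumZl//; last by move=> j; rewrite lee_fin mulr_ge0.
      by apply: le_esum => j _; rewrite -EFinM lee_fin mulrCA.
    rewrite -EFinM lee_fin /b -mulrA -[leRHS]mulrA ler_wpM2l//.
    rewrite [leLHS]mulrC [leRHS]mulrA ler_wpM2r ?invr_ge0 ?(ltW (rate_gt0 i))//.
    by rewrite -lee_fin fineK.
  have [C hC] := subsolution_bound HK finK H0 K1 mm0 msup.
  exists C => y yb ysub i; apply: hC; split => // j.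
  by rewrite bE.
(* The damped moments of order [k.+1] are subsolutions, so [build] bounds them uniformly in the
   rate, and the bound survives the limit. *)
have key k : (k <= l)%N -> exists2 c : R, (0 <= c)%R &
    forall i, moment H k i <= (c * S k.+1 i)%:E.
  elim: k => [_|k IH kl].
    by exists 1%R => // i; rewrite moment0 mul1r /S big_nat1 mk1.
  have [c c0 mc] := IH (ltnW kl); have [C hC] := build k c (ltnW kl) c0 mc.
  have kc0 : (0 <= k.+1%:R * c)%R by rewrite mulr_ge0.
  exists (k.+1%:R * c + `|C|)%R => [|i]; first by rewrite addr_ge0.
  apply: (@le_trans _ _ (k.+1%:R * c * S' k.+1 i + C)%:E).
    apply: (cvge_to_le (@dmoment_cvg H k.+1 i)); apply: nearW => n; rewrite lee_fin.
    apply: hC => [|j]; last exact: dmoment_subsolution.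
    exists ((vanishing n)^-1 ^+ k.+1)%R => j.
    by case/andP: (dmoment_itv H k.+1 j (vanishing_gt0 n)).
  (* The term of order 0 in [S k.+2] equals 1 and absorbs the additive constant [C]. *)
  rewrite lee_fin (_ : S k.+2 i = 1 + S' k.+1 i)%R; last first.
    by rewrite /S big_nat_recl// mk1.
  have := ler_norm C; have := normr_ge0 C; have := S'0 k.+1 i; move: kc0.
  move: (k.+1%:R * c)%R (S' k.+1 i) (`|C|)%R => x z t x0 z0 t0 Ct.
  have := mulr_ge0 t0 z0; lra.
have [c c0 mc] := key l (leqnn l); have [C hC] := build l c (leqnn l) c0 mc.
by exists (fun i => l.+1%:R * c * S' l.+1 i + C)%R => y yb ysub i; exact: hC.
Qed.

End MomentAnalysis.

(** * The criterion *)

Section Suprema.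
Context {R : realType}.
Implicit Types (A : set (\bar R)) (u : nat -> R).

Lemma ereal_sup_pinftyP A :
  ereal_sup A = +oo <-> forall r : R, exists2 x, A x & r%:E < x.
Proof.
split=> [Ay r|h]; first by apply: ereal_sup_gt; rewrite Ay ltry.
apply/eqP; rewrite -leye_eq leNgt; apply/negP => lty.
have [x Ax] := h (fine (ereal_sup A)).
have Ax' : x <= ereal_sup A by exact: ereal_sup_ubound.
have [y Ay y0] := h 0%R; have y1 : y <= ereal_sup A by exact: ereal_sup_ubound.
rewrite fineK ?ltNge ?Ax'// ge0_fin_numE//.
exact: le_trans (ltW y0) y1.
Qed.

(** A tail omits only finitely many real values, so its supremum is infinite as soon as the whole
    one is. *)
Lemma limn_esup_pinftyP u :
  ereal_sup [set (u n)%:E | n in [set n : nat | (1 <= n)%N]] = +oo <->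
  limn_esup (fun n => (u n)%:E) = +oo.
Proof.
split=> [/ereal_sup_pinftyP h|].
  apply/eqP; rewrite -leye_eq; apply: le_ereal_inf_tmp => _ [V [N _ NV] <-].
  rewrite leye_eq; apply/eqP/ereal_sup_pinftyP => r.
  (* A value above [r] and above the first [N] terms can only occur at an index at least [N]. *)
  have [_ [m m1 <-]] := h (\big[Num.max/r]_(j < N) u j)%R; rewrite lte_fin => um.
  exists (u m)%:E; last first.
    rewrite lte_fin; apply: le_lt_trans um.
    exact: bigmax_ge_id.
  exists m => //; apply: NV => /=; rewrite leqNgt; apply/negP => mN.
  by have := le_lt_trans (le_bigmax _ (fun j : 'I_N => u j) (Ordinal mN)) um; rewrite ltxx.
move=> h; apply/eqP; rewrite -leye_eq -h; apply: ereal_inf_lbound.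
by exists [set n : nat | (1 <= n)%N] => //; exists 1%N.
Qed.

Lemma ereal_sup_finite {E : choiceType} (H : set E) (y : E -> R) :
  finite_set H -> H !=set0 ->
  ereal_sup [set (y i)%:E | i in H] = (fine (ereal_sup [set (y i)%:E | i in H]))%:E.
Proof.
move=> finH H0; have [a Ha amax] := finite_argmax y finH H0.
suff -> : ereal_sup [set (y i)%:E | i in H] = (y a)%:E by [].
apply/eqP; rewrite eq_le; apply/andP; split; last first.
  by apply: ereal_sup_ubound; exists a.
by apply: ge_ereal_sup => _ [i Hi <-]; rewrite lee_fin amax.
Qed.

End Suprema.

Section SingleState.
Context {R : realType} {E : countType} {d : measure_display}
  {Omega : measurableType d} {P : E -> probability Omega R}
  {X : R -> Omega -> E}.

(** On a single state there is no jump, so all return times are infinite, against ergodicity. A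
    second state is what makes every jump rate positive. *)
Lemma ergodic_two_states l : ergodic P X l -> forall i : E, exists j, j != i.
Proof.
move=> erg i; apply: contrapT => /forallNP no.
have eqi j : j = i by apply/eqP/negPn/negP; exact: no.
have rty H w : return_time X H w = +oo.
  have jy : first_jump X w = +oo.
    rewrite /first_jump (_ : [set t | _] = set0) ?image_set0 ?ereal_inf0//.
    by rewrite -subset0 => t [_]; rewrite (eqi (X t w)) (eqi (X _ w)).
  rewrite /return_time (_ : [set t | _] = set0) ?image_set0 ?ereal_inf0//.
  by rewrite -subset0 => t [_]; rewrite jy leye_eq.
case: l erg => [rec|l [H [_ [k Hk]] fin]].
  have := rec i; rewrite (_ : [set w | _] = set0) ?measure0.
    by move=> [/esym/eqP]; rewrite oner_eq0.
  by rewrite -subset0 => w /=; rewrite rty ltxx.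
have := fin k Hk; rewrite /return_moment.
under eq_integral => w _ do rewrite rty expeS gt0_mulye ?expe_gt0//.
rewrite integral_cst//.
suff -> : (+oo * P k setT = +oo)%E by rewrite ltxx.
by rewrite probability_setT mule1.
Qed.

End SingleState.

Theorem theorem3 (R : realType) (E : countType) (Q : E -> E -> R)
    (Q_matrix : is_Qmatrix Q) (Q_irreducible : irreducible Q)
    (Q_regular : regular Q)
    (d : measure_display) (Omega : measurableType d)
    (P : E -> probability Omega R) (X : R -> Omega -> E)
    (X_process : is_Qprocess Q P X)
    (H : set E) (H_finite : finite_set H) (H_nonempty : H !=set0)
    (l : nat) (X_ergodic : ergodic P X l) :
  (~ ergodic P X l.+1 <->
   exists y : nat -> E -> R,
     (forall n : nat, (1 <= n)%N ->
        ereal_sup [set (y n i)%:E | i in [set: E]] < +oo /\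
        forall i : E,
          (y n i)%:E <=
            signed_esum (~` H) (fun j => (embedding Q i j * y n j)%R) +
            (l.+1%:R / rate Q i)%:E * return_moment P X H l i) /\
     ereal_sup [set ereal_sup [set (y n i)%:E | i in H]
                 | n in [set n : nat | (1 <= n)%N]] = +oo) /\
  (forall y : nat -> E -> R,
     ereal_sup [set ereal_sup [set (y n i)%:E | i in H]
                 | n in [set n : nat | (1 <= n)%N]] = +oo <->
     limn_esup (fun n => ereal_sup [set (y n i)%:E | i in H]) = +oo).
Proof.
split; last first.
  move=> y; have e := fun n => ereal_sup_finite (y n) H_finite H_nonempty.
  rewrite (funext e); under eq_imagel => n _ do rewrite e.
  exact: limn_esup_pinftyP.
have [Q_ge0 Q_sum] := Q_matrix.
have rate_gt0 i : (0 < rate Q i)%R.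
  have [j ji] := ergodic_two_states X_ergodic i.
  have [s ps ls] := Q_irreducible i j.
  (* The first edge of a path from [i] to another state is a genuine jump, since [Q i i] is not
     positive; its rate bounds [rate Q i] from below. *)
  case: s ps ls => [_ /= ij|k s /= /andP[ik _] _]; first by rewrite ij eqxx in ji.
  have [ki|ki] := eqVneq k i.
    rewrite ki in ik; have : 0 <= (rate Q i)%:E.
      rewrite -Q_sum; apply: esum_ge0 => a /= ai; rewrite lee_fin Q_ge0// eq_sym//.
    by rewrite lee_fin /rate oppr_ge0 => /(lt_le_trans ik); rewrite ltxx.
  rewrite -lte_fin -Q_sum; apply: (@lt_le_trans _ _ (Q i k)%:E); first by rewrite lte_fin.
  apply: (@le_trans _ _ (\esum_(j in [set k]) (Q i j)%:E)).
    by rewrite esum_set1// lee_fin ltW.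
  by apply: le_esum_subset => a ->.
have [mX rcX [p pQ fdd]] := X_process.
have [[p_ge0 _ p_0 _] p_deriv] := pQ.
have p_00 i : p 0%R i i = 1%R by rewrite p_0 eqxx.
have p_honest : honest p.
  have [q [_ q_honest q_unique]] := Q_regular.
  move=> t i t0; rewrite -(q_honest t i t0).
  by apply: eq_esum => j _; rewrite (q_unique _ pQ).
have Pi_ge0 := embedding_ge0 Q_ge0 rate_gt0.
have Pi_sum := embedding_sum Q_ge0 Q_sum rate_gt0.
have dstep := damped_moment_step mX rcX p_ge0 p_00 p_honest p_deriv fdd Q_ge0 Q_sum rate_gt0.
have mstep := return_moment_step mX rcX p_ge0 p_00 p_honest p_deriv fdd Q_ge0 Q_sum rate_gt0.
have dle := damped_moment_le (P := P) mX rcX.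
have dcvg H0 k i : (damped_moment (P := P) (X := X) H0 (vanishing n) k i)%:E @[n --> \oo] -->
    return_moment P X H0 k i by exact: cvg_damped_moment.
have dexit := cvg_exit mX rcX p_ge0 p_00 p_honest p_deriv fdd Q_regular.
have ditv := @damped_moment_itv R E d Omega P X mX rcX.
split.
  move=> not_erg.
  (* Otherwise [H] itself would witness ergodicity of order [l.+1]. *)
  have [i Hi infi] : exists2 i, H i & return_moment P X H l.+1 i = +oo.
    apply: contrapT => no; apply: not_erg; exists H; split => // i Hi.
    by rewrite ltey; apply/eqP => infi; apply: no; exists i.
  pose y n j := damped_moment (P := P) (X := X) H (vanishing n) l.+1 j.
  exists y; split => [n _|].
    split => [|j]; last first.
      exact: (dmoment_subsolution Pi_ge0 rate_gt0 ditv dstep dle H n l j).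
    apply: (@le_lt_trans _ _ (((vanishing n)^-1 ^+ l.+1)%R)%:E); last exact: ltry.
    apply: ge_ereal_sup => _ [j _ <-]; rewrite lee_fin.
    by case/andP: (ditv H (vanishing n) l.+1 j (vanishing_gt0 n)).
  apply/ereal_sup_pinftyP => r.
  have : (y n i)%:E @[n --> \oo] --> +oo by rewrite -infi; exact: cvg_damped_moment.
  move=> /cvgey_gt/(_ r)[N _ hN].
  (* The index [N.+1] is both beyond [N] and at least 1, as the supremum requires. *)
  exists (ereal_sup [set (y N.+1 j)%:E | j in H]); first by exists N.+1.
  apply: (@lt_le_trans _ _ (y N.+1 i)%:E); first by apply: hN => /=.
  by apply: ereal_sup_ubound; exists i.
(* Ergodicity of order [l.+1] may be witnessed by a set [H'] unrelated to [H]. The transfer lemma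
   gives a bound [D] common to all [y n], and its maximum over [H] contradicts the infinite
   supremum. *)
move=> [y [ysub ysup]] [H' [finH' H'0 fin']].
have [D hD] := moment_transfer (moment := return_moment P X)
  (dmoment := damped_moment (P := P) (X := X)) Pi_ge0 Pi_sum rate_gt0 Q_irreducible
  return_moment0 return_moment_ge0 mstep (return_moment_subset mX rcX)
  (return_moment_le mX rcX) ditv damped_moment0 dstep dcvg dle dexit
  H_finite H_nonempty finH' H'0 fin'.
have [a Ha amax] := finite_argmax D H_finite H_nonempty.
have [x [n n1 <-]] := (ereal_sup_pinftyP _).1 ysup (D a).
apply/negP; rewrite -leNgt; apply: ge_ereal_sup => _ [i Hi <-].
rewrite lee_fin; apply: le_trans (amax _ Hi).
have [ybd yineq] := ysub n n1.
(* The supremum is finite, so its real part is an upper bound: it is not [-oo] because [y n] takes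
   real values. *)
apply: (hD (y n) _ yineq); exists (fine (ereal_sup [set (y n j)%:E | j in [set: E]])) => j.
rewrite -lee_fin fineK; first by apply: ereal_sup_ubound; exists j.
rewrite fin_numE -ltey ybd andbT; apply/eqP => e.
suff : (y n j)%:E <= -oo by [].
by rewrite -e; apply: ereal_sup_ubound; exists j.
Qed.
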